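(* Let $1<p\le2\le q<\infty$. Suppose that $A$ is a $(k,a)$-Fourier multiplier with symbol $h$, i.e. $h:\mathbb{R}^N\to\mathbb{C}$ is measurable and $\mathcal{F}_{k,a}(Af)(\xi)=h(\xi)\,\mathcal{F}_{k,a}f(\xi)$ for (almost every) $\xi\in\mathbb{R}^N$ and all $f\in C_c^\infty(\mathbb{R}^N)$. Then $$\|A\|_{L^p_{k,a}(\mathbb{R}^N)\to L^q_{k,a}(\mathbb{R}^N)}\le C\,\sup_{s>0}\, s\left[\int_{\{\xi\in\mathbb{R}^N:\ |h(\xi)|\ge s\}}d\mu_{k,a}(\xi)\right]^{\frac1p-\frac1q},$$ where $C>0$ is a constant independent of $A$ and $h$. In particular, if the right-hand side is finite, $A$ extends to a bounded linear operator from $L^p_{k,a}(\mathbb{R}^N)$ to $L^q_{k,a}(\mathbb{R}^N)$.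
   Context: Setting. $N\ge1$; $\mathcal{R}\subset\mathbb{R}^N\setminus\{0\}$ is a (reduced) root system with positive subsystem $\mathcal{R}_+$; $r_\alpha$ is the orthogonal reflection in the hyperplane $\alpha^\perp$; $\mathfrak{G}\subset O(N,\mathbb{R})$ is the reflection group generated by the $r_\alpha$, $\alpha\in\mathcal{R}$; $k:\mathcal{R}\to[0,\infty)$, $\alpha\mapsto k_\alpha$, is a $\mathfrak{G}$-invariant function (multiplicity function); $a>0$. $\langle\cdot,\cdot\rangle$ and $\|\cdot\|$ are the Euclidean inner product and norm. Put $\langle k\rangle=\frac12\sum_{\alpha\in\mathcal{R}}k_\alpha$, $v_k(x)=\prod_{\alpha\in\mathcal{R}}|\langle\alpha,x\rangle|^{k_\alpha}$, $v_{k,a}(x)=\|x\|^{a-2}v_k(x)$, $d\mu_{k,a}(x)=v_{k,a}(x)\,dx$, and $L^p_{k,a}(\mathbb{R}^N)=L^p(\mathbb{R}^N,\mu_{k,a})$. Dunkl Laplacian. For $\xi\in\mathbb{R}^N$, $T_\xi(k)f(x)=\partial_\xi f(x)+\sum_{\alpha\in\mathcal{R}_+}k_\alpha\langle\alpha,\xi\rangle\frac{f(x)-f(r_\alpha x)}{\langle\alpha,x\rangle}$, and $\Delta_k=\sum_{j=1}^N T_{\xi_j}(k)^2$ for any orthonormal basis $\xi_1,\dots,\xi_N$ of $\mathbb{R}^N$. $(k,a)$-generalised Fourier transform. Let $\Delta_{k,a}=\|x\|^{2-a}\Delta_k-\|x\|^a$ and assume $a+2\langle k\rangle+N-2>0$.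 Then $$\mathcal{F}_{k,a}=\exp\left[\frac{i\pi}{2}\cdot\frac{2\langle k\rangle+N+a-2}{a}\right]\exp\left[\frac{i\pi}{2a}\Delta_{k,a}\right],$$ a unitary operator on $L^2_{k,a}(\mathbb{R}^N)$. Here the exponential is that of the self-adjoint realisation of $\Delta_{k,a}$ diagonalised by the functions $\Phi(x)=p(x)\,L_\ell^{(\lambda_m)}\!\left(\tfrac2a\|x\|^a\right)e^{-\|x\|^a/a}$, where $\ell,m\in\mathbb{N}_0$, $p$ is a homogeneous polynomial of degree $m$ with $\Delta_kp=0$, $\lambda_m=(2m+2\langle k\rangle+N-2)/a$, and $L_\ell^{(\lambda)}$ are the Laguerre polynomials; these functions span a dense subspace of $L^2_{k,a}(\mathbb{R}^N)$ and $\mathcal{F}_{k,a}\Phi=e^{-i\pi(\ell+m/a)}\Phi$. One has $\mathcal{F}_{k,a}f(\xi)=c_{k,a}\int_{\mathbb{R}^N}B_{k,a}(\xi,x)f(x)\,d\mu_{k,a}(x)$ with a normalising constant $c_{k,a}$ and a symmetric distribution kernel $B_{k,a}$. Standing assumption. $N\ge1$, $k\ge0$, $a>0$, $a+2\langle k\rangle+N-2>0$, and $B_{k,a}$ is uniformly bounded: $|B_{k,a}(\xi,x)|\le M<\infty$ for all $x,\xi\in\mathbb{R}^N$. (It is known that this boundedness holds if, in addition to $a+2\langle k\rangle+N-2>0$, one of the following holds: $N=1$ and $a>0$; $a=1$ and $2\langle k\rangle+N-2\ge0$; $a=2$; $k=0$ and $a=2/m$ for some $m\in\mathbb{N}$.)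 Under it $\mathcal{F}_{k,a}$ and its inverse $\mathcal{F}_{k,a}^{-1}$ (the inverse on $L^2_{k,a}$, which also has a uniformly bounded kernel) extend to $L^1_{k,a}(\mathbb{R}^N)+L^2_{k,a}(\mathbb{R}^N)$, hence to $L^s_{k,a}(\mathbb{R}^N)$, $1\le s\le2$. Conventions. The identity $\mathcal{F}_{k,a}(Af)=h\,\mathcal{F}_{k,a}f$ is understood as: $h\,\mathcal{F}_{k,a}f\in L^1_{k,a}+L^2_{k,a}$ and $Af=\mathcal{F}_{k,a}^{-1}(h\,\mathcal{F}_{k,a}f)$. The norm $\|A\|_{L^p_{k,a}\to L^q_{k,a}}$ is the supremum of $\|Af\|_{L^q_{k,a}}/\|f\|_{L^p_{k,a}}$ over nonzero $f\in C_c^\infty(\mathbb{R}^N)$. When $p=q=2$ the bracket to the power $0$ is read as $1$ if the set has positive measure and $0$ if it is null, so the supremum is the essential supremum of $|h|$. *)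

(* Defs.v *)
From HB Require Import structures.
From mathcomp Require Import all_boot all_order all_algebra.
From mathcomp Require Import finmap complex.
From mathcomp Require Import all_classical all_reals all_analysis.
From mathcomp Require Import measurable_realfun.

Set Implicit Arguments.
Unset Strict Implicit.
Unset Printing Implicit Defensive.
Import Order.TTheory GRing.Theory Num.Theory.
Import numFieldNormedType.Exports.
Local Open Scope classical_set_scope.
Local Open Scope ring_scope.

Definition measure_rV_display : measure_display.
Proof. exact: default_measure_display. Qed.

(* The row vectors carry the product sigma-algebra (generated by the
   coordinates), which is the Borel sigma-algebra of R^n. *)
Section measurable_rV.
Context {R : realType} (n : nat).

Let coor (i : 'I_n) (x : 'rV[R]_n) : measurableTypeR R := x 0 i.

Let rV_set0 : g_sigma_preimage coor set0.
Proof. exact: sigma_algebra0. Qed.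

Let rV_setC A : g_sigma_preimage coor A -> g_sigma_preimage coor (~` A).
Proof. exact: sigma_algebraC. Qed.

Let rV_bigcup (F : (set 'rV[R]_n)^nat) :
  (forall i, g_sigma_preimage coor (F i)) ->
  g_sigma_preimage coor (\bigcup_i (F i)).
Proof. exact: sigma_algebra_bigcup. Qed.

HB.instance Definition _ :=
  @isMeasurable.Build measure_rV_display
  'rV[R]_n (g_sigma_preimage coor) rV_set0 rV_setC rV_bigcup.

Lemma measurable_coor (i : 'I_n) :
  measurable_fun [set: 'rV[R]_n] (fun x : 'rV[R]_n => x 0 i).
Proof.
move=> _ Y mY; rewrite setTI; apply: sub_sigma_algebra => /=.
rewrite -bigcup_seq/=; exists i => /=; first by rewrite mem_index_enum.
by exists Y => //; rewrite setTI.
Qed.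

Lemma measurable_rVP d (T : measurableType d) (f : T -> 'rV[R]_n) :
  (forall i, measurable_fun [set: T] (fun t => f t 0 i)) ->
  measurable_fun [set: T] f.
Proof.
move=> mf.
have prefS : g_sigma_preimage (fun i => coor i \o f) `<=` measurable.
  apply: smallest_sub; first exact: sigma_algebra_measurable.
  rewrite -bigcup_seq/=; apply: bigcup_sub => i _.
  by move=> A [B mB <-]; exact: mf.
rewrite g_sigma_preimage_comp in prefS.
by move=> _ A mA; apply: prefS; exists A.
Qed.

End measurable_rV.

Section lebesgue_rV.
Context {R : realType}.

Definition cons_rV n (z : measurableTypeR R * 'rV[R]_n) : 'rV[R]_n.+1 :=
  \row_i if unlift ord0 i is Some j then z.2 0 j else z.1.

Definition uncons_rV n (x : 'rV[R]_n.+1) : measurableTypeR R * 'rV[R]_n :=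
  (x 0 ord0, \row_j x 0 (lift ord0 j)).

Lemma cons_rVK n : cancel (@cons_rV n) (@uncons_rV n).
Proof.
move=> [t y]; rewrite /uncons_rV; congr pair; first by rewrite mxE unlift_none.
by apply/rowP => j; rewrite !mxE liftK.
Qed.

Lemma measurable_cons_rV n : measurable_fun setT (@cons_rV n).
Proof.
apply: measurable_rVP => i; case: (unliftP ord0 i) => [j|] ->.
  under eq_fun do rewrite mxE liftK.
  exact: (measurableT_comp (measurable_coor j) measurable_snd).
under eq_fun do rewrite mxE unlift_none.
exact: measurable_fst.
Qed.

Lemma measurable_uncons_rV n : measurable_fun setT (@uncons_rV n).
Proof.
apply: measurable_fun_pair; first exact: measurable_coor.
apply: measurable_rVP => j; under eq_fun do rewrite mxE.
exact: measurable_coor.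
Qed.

Section step.
Variables (n : nat) (m : {sigma_finite_measure set 'rV[R]_n -> \bar R}).

Definition lebesgue_cons : set 'rV[R]_n.+1 -> \bar R :=
  pushforward (@lebesgue_measure R \x m)%E (@cons_rV n).

Let lebesgue_cons0 : lebesgue_cons set0 = 0%E.
Proof. by rewrite /lebesgue_cons /pushforward preimage_set0 measure0. Qed.

Let lebesgue_cons_ge0 A : (0 <= lebesgue_cons A)%E.
Proof. by rewrite /lebesgue_cons /pushforward measure_ge0. Qed.

Let lebesgue_cons_sigma_additive : semi_sigma_additive lebesgue_cons.
Proof.
have mC := @measurable_cons_rV n.
exact: (@measure_semi_sigma_additive _ _ _ (pushforward _ _)).
Qed.

HB.instance Definition _ := isMeasure.Build _ _ _ lebesgue_cons
  lebesgue_cons0 lebesgue_cons_ge0 lebesgue_cons_sigma_additive.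

Let lebesgue_cons_sigma_finite : sigma_finite setT lebesgue_cons.
Proof.
have /sigma_finiteP[F [TF ndF Foo]] := sigma_finiteT (@lebesgue_measure R).
have /sigma_finiteP[G [TG ndG Goo]] := sigma_finiteT m.
have mU := @measurable_uncons_rV n.
exists (fun i => @uncons_rV n @^-1` (F i `*` G i)).
  rewrite predeqE => x; split=> // _.
  have [i _ Fi] : (\bigcup_i F i) (uncons_rV x).1 by rewrite -TF.
  have [j _ Gj] : (\bigcup_i G i) (uncons_rV x).2 by rewrite -TG.
  exists (maxn i j) => //; split.
  - by move: Fi; exact/subsetPset/ndF/leq_maxl.
  - by move: Gj; exact/subsetPset/ndG/leq_maxr.
move=> i; have [mF Fioo] := Foo i; have [mG Gioo] := Goo i.
have mFG := measurableX mF mG.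
split; first by rewrite -[X in measurable X]setTI; exact: mU.
rewrite /lebesgue_cons /pushforward -comp_preimage.
rewrite (_ : _ \o _ = id); last by apply/funext => z /=; rewrite cons_rVK.
by rewrite preimage_id product_measure1E// lte_mul_pinfty// ge0_fin_numE.
Qed.

HB.instance Definition _ := Measure_isSigmaFinite.Build _ _ _ lebesgue_cons
  lebesgue_cons_sigma_finite.

End step.

(* Lebesgue measure on R^n, as the n-fold product of [lebesgue_measure]. *)
Fixpoint lebesgue_rV n : {sigma_finite_measure set 'rV[R]_n -> \bar R} :=
  if n is n'.+1 then lebesgue_cons (lebesgue_rV n') else \d_(0 : 'rV[R]_0).

End lebesgue_rV.

Section root_systems.
Context {R : realType} {N : nat}.
Implicit Types (x y alpha beta : 'rV[R]_N) (Rs Rp : {fset 'rV[R]_N}).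

Definition dot x y : R := \sum_i x 0 i * y 0 i.

(* The library norm [`|x|] of a row vector is the sup norm. *)
Definition enorm x : R := Num.sqrt (dot x x).

Definition reflect alpha x : 'rV[R]_N :=
  x - (2 * dot alpha x / dot alpha alpha) *: alpha.

Definition root_system Rs :=
  [/\ 0 \notin Rs,
      forall alpha beta, alpha \in Rs -> beta \in Rs ->
        reflect alpha beta \in Rs &
      forall alpha (t : R), alpha \in Rs -> t *: alpha \in Rs ->
        t = 1 \/ t = -1].

Definition positive_subsystem Rs Rp :=
  exists beta, (forall alpha, alpha \in Rs -> dot alpha beta != 0) /\
    Rp = [fset alpha in Rs | 0 < dot alpha beta]%fset.

(* Reflections are involutions, so products of reflections form a group. *)
Inductive reflection_group Rs : ('rV[R]_N -> 'rV[R]_N) -> Prop :=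
| reflection_group1 : reflection_group Rs id
| reflection_groupM alpha g : alpha \in Rs -> reflection_group Rs g ->
    reflection_group Rs (reflect alpha \o g).

Definition multiplicity_function Rs (k : 'rV[R]_N -> R) :=
  (forall alpha, alpha \in Rs -> 0 <= k alpha) /\
  (forall g alpha, reflection_group Rs g -> alpha \in Rs ->
     k (g alpha) = k alpha).

(* The constant written <k>. *)
Definition mult_sum Rs (k : 'rV[R]_N -> R) : R :=
  2^-1 * \sum_(alpha <- Rs) k alpha.

End root_systems.

Section weighted_measure.
Context {R : realType} {N : nat}.
Variables (Rs : {fset 'rV[R]_N}) (k : 'rV[R]_N -> R) (a : R).

(* [0 `^ r] is 0 for r < 0, so for a < 2 the weight is 0 instead of +oo at the
   origin, a Lebesgue-null set. *)
Definition weight (x : 'rV[R]_N) : R :=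
  enorm x `^ (a - 2) * \prod_(alpha <- Rs) `|dot alpha x| `^ k alpha.

Lemma weight_ge0 x : 0 <= weight x.
Proof. by rewrite mulr_ge0 ?powR_ge0// prodr_ge0// => i _; rewrite powR_ge0. Qed.

Lemma measurable_weight : measurable_fun setT weight.
Proof.
apply: measurable_funM.
  apply: (measurableT_comp (@measurable_powR _ _)).
  apply: (measurableT_comp (continuous_measurable_fun (@sqrt_continuous R))).
  by apply: measurable_sum => i; apply: measurable_funM; exact: measurable_coor.
apply: measurable_prod => alpha _.
apply: (measurableT_comp (@measurable_powR _ _)).
apply: measurableT_comp => //.
apply: measurable_sum => i; apply: measurable_funM => //.
exact: measurable_coor.
Qed.

Definition mu_ka (A : set 'rV[R]_N) : \bar R :=
  (\int[lebesgue_rV N]_(x in A) (weight x)%:E)%E.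

Let mu_ka0 : mu_ka set0 = 0%E.
Proof. by rewrite /mu_ka integral_set0. Qed.

Let mu_ka_ge0 A : (0 <= mu_ka A)%E.
Proof. by apply: integral_ge0 => x _; rewrite lee_fin weight_ge0. Qed.

Let mu_ka_sigma_additive : semi_sigma_additive mu_ka.
Proof.
move=> /= A mA tA mUA; rewrite /mu_ka/= ge0_integral_bigcup//=.
- by apply: is_cvg_ereal_nneg_natsum_cond => n _ _; exact: mu_ka_ge0.
- apply/measurable_EFinP; apply: measurable_funTS; exact: measurable_weight.
- by move=> x _; rewrite lee_fin weight_ge0.
Qed.

HB.instance Definition _ := isMeasure.Build _ _ _ mu_ka
  mu_ka0 mu_ka_ge0 mu_ka_sigma_additive.

End weighted_measure.

Section complex_Lebesgue_spaces.
Context {d : measure_display} {T : measurableType d} {R : realType}.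
Variable mu : {measure set T -> \bar R}.
Implicit Types (f g : T -> R[i]) (p : \bar R).

Definition cmeasurable f :=
  measurable_fun setT (fun x => complex.Re (f x)) /\
  measurable_fun setT (fun x => complex.Im (f x)).

Definition cintegral f : R[i] :=
  Complex (\int[mu]_x complex.Re (f x))%R (\int[mu]_x complex.Im (f x))%R.

Definition cLnorm p f : \bar R := Lnorm mu p (fun x => (Normc.normc (f x))%:E).

Definition inL p f := cmeasurable f /\ (cLnorm p f < +oo)%E.

Definition aeq f g := {ae mu, forall x, f x = g x}.

(* Operators act on functions rather than on almost-everywhere classes; the two
   conditions below make [T1] well defined on classes. *)
Definition linear_on p (T1 : (T -> R[i]) -> (T -> R[i])) :=
  forall (c : R[i]) f g, inL p f -> inL p g ->
    aeq (T1 (fun x => c * f x + g x)) (fun x => c * T1 f x + T1 g x).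

Definition bounded_operator p q (T1 : (T -> R[i]) -> (T -> R[i])) :=
  linear_on p T1 /\
  exists K : R, forall f, inL p f ->
    inL q (T1 f) /\ (cLnorm q (T1 f) <= K%:E * cLnorm p f)%E.

Definition unitary_L2 (U : (T -> R[i]) -> (T -> R[i])) :=
  [/\ linear_on 2%:E U,
      forall f, inL 2%:E f ->
        inL 2%:E (U f) /\ cLnorm 2%:E (U f) = cLnorm 2%:E f &
      forall g, inL 2%:E g -> exists2 f, inL 2%:E f & aeq (U f) g].

(* A representative of the class of the inverse image of g under U. *)
Definition inverse_L2 (U : (T -> R[i]) -> (T -> R[i])) g : T -> R[i] :=
  xget (fun=> 0) [set f | inL 2%:E f /\ aeq (U f) g].

(* [w] is the value at [g \in L^1] of the continuous extension
   L^1 -> L^oo of the operator [U] restricted to the intersection of L^1 and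
   L^2. *)
Definition L1_extension (U : (T -> R[i]) -> (T -> R[i])) g w :=
  cmeasurable w /\
  forall u : nat -> T -> R[i],
    (forall n, inL 1%:E (u n) /\ inL 2%:E (u n)) ->
    cLnorm 1%:E (fun x => u n x - g x) @[n --> \oo] --> 0%E ->
    cLnorm +oo%E (fun x => U (u n) x - w x) @[n --> \oo] --> 0%E.

(* [g] is in L^1 + L^2 and [v] is the value at [g] of the extension of [U] to
   L^1 + L^2. *)
Definition L1L2_extension (U : (T -> R[i]) -> (T -> R[i])) g v :=
  exists g1 g2 w, [/\ inL 1%:E g1, inL 2%:E g2,
    aeq g (fun x => g1 x + g2 x), L1_extension U g1 w &
    aeq v (fun x => w x + U g2 x)].

End complex_Lebesgue_spaces.

Section test_functions.
Context {R : realType} {N : nat}.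

Definition partials (s : seq 'I_N) (f : 'rV[R]_N -> R) : 'rV[R]_N -> R :=
  foldr (fun i g x => 'D_(delta_mx 0 i) g x) f s.

Definition smooth (f : 'rV[R]_N -> R) :=
  forall s, continuous (partials s f) /\
    forall i x, derivable (partials s f) x (delta_mx 0 i).

Definition test_function (f : 'rV[R]_N -> R[i]) :=
  [/\ smooth (fun x => complex.Re (f x)), smooth (fun x => complex.Im (f x)) &
      compact (closure [set x | f x != 0])].

End test_functions.

Section dunkl.
Context {R : realType} {N : nat}.
Variables (Rs Rp : {fset 'rV[R]_N}) (k : 'rV[R]_N -> R) (a : R).
Implicit Types x xi : 'rV[R]_N.

(* On the hyperplane dot alpha x = 0 the quotient is given its limit value for
   differentiable f. *)
Definition dunkl_quotient alpha (f : 'rV[R]_N -> R) x : R :=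
  if dot alpha x == 0 then 2 / dot alpha alpha * 'D_alpha f x
  else (f x - f (reflect alpha x)) / dot alpha x.

Definition dunkl_operator xi (f : 'rV[R]_N -> R) x : R :=
  'D_xi f x + \sum_(alpha <- Rp) k alpha * dot alpha xi * dunkl_quotient alpha f x.

Definition dunkl_laplacian (f : 'rV[R]_N -> R) x : R :=
  \sum_(j < N)
    dunkl_operator (delta_mx 0 j) (dunkl_operator (delta_mx 0 j) f) x.

Definition Delta_ka (f : 'rV[R]_N -> R) x : R :=
  enorm x `^ (2 - a) * dunkl_laplacian f x - enorm x `^ a * f x.

Definition laguerre (l : nat) (lambda t : R) : R :=
  \sum_(j < l.+1) (-1) ^+ j * (\prod_(j.+1 <= i < l.+1) (lambda + i%:R)) /
    ((l - j)`!%:R * j`!%:R) * t ^+ j.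

(* Exponents of a monomial of degree m are at most m. *)
Definition homogeneous (m : nat) (p : 'rV[R]_N -> R) :=
  exists c : {ffun 'I_N -> 'I_m.+1} -> R, forall x,
    p x = \sum_(e : {ffun 'I_N -> 'I_m.+1} | (\sum_i e i == m)%N)
            c e * \prod_i x 0 i ^+ e i.

Definition harmonic (p : 'rV[R]_N -> R) := forall x, dunkl_laplacian p x = 0.

Definition lambda_ka (m : nat) : R :=
  (2 * m%:R + 2 * mult_sum Rs k + N%:R - 2) / a.

Definition Phi (l m : nat) (p : 'rV[R]_N -> R) x : R :=
  p x * laguerre l (lambda_ka m) (2 / a * enorm x `^ a) *
    expR (- (enorm x `^ a / a)).

Definition cis (t : R) : R[i] := Complex (cos t) (sin t).

Local Notation mu := (mu_ka Rs k a).

(* U = exp(i t Delta_ka), for the self-adjoint realisation of Delta_ka in which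
   the functions Phi are eigenvectors. Since these functions span a dense
   subspace of L^2, this determines U. The eigenvalue of Phi l m p is
   nu = - (2 * a * l + 2 * m + 2 * mult_sum Rs k + N + a - 2). *)
Definition exp_i_Delta (t : R)
    (U : ('rV[R]_N -> R[i]) -> ('rV[R]_N -> R[i])) :=
  unitary_L2 mu U /\
  forall (l m : nat) (p : 'rV[R]_N -> R) (nu : R),
    homogeneous m p -> harmonic p ->
    (forall x, x != 0 -> Delta_ka (Phi l m p) x = nu * Phi l m p x) ->
    aeq mu (U (fun x => (Phi l m p x)%:C%C))
           (fun x => cis (t * nu) * (Phi l m p x)%:C%C).

Definition generalised_fourier
    (F : ('rV[R]_N -> R[i]) -> ('rV[R]_N -> R[i])) :=
  exists2 U, exp_i_Delta (pi / (2 * a)) U &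
    forall f x, F f x =
      cis (pi / 2 * ((2 * mult_sum Rs k + N%:R + a - 2) / a)) * U f x.

Definition integral_kernel
    (F : ('rV[R]_N -> R[i]) -> ('rV[R]_N -> R[i])) (c : R[i])
    (B : 'rV[R]_N -> 'rV[R]_N -> R[i]) :=
  [/\ cmeasurable (fun z : 'rV[R]_N * 'rV[R]_N => B z.1 z.2),
      forall xi x, B xi x = B x xi &
      forall f, inL mu 1%:E f -> inL mu 2%:E f ->
        aeq mu (F f) (fun xi => c * cintegral mu (fun x => B xi x * f x))].

(* F (A f) = h * F f, in the sense that h * F f is in L^1 + L^2 and A f is its
   image under the extension of the inverse of F to L^1 + L^2. *)
Definition fourier_multiplier
    (F : ('rV[R]_N -> R[i]) -> ('rV[R]_N -> R[i])) (h : 'rV[R]_N -> R[i])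
    (A : ('rV[R]_N -> R[i]) -> ('rV[R]_N -> R[i])) :=
  cmeasurable h /\
  forall f, test_function f -> cmeasurable (A f) /\
    L1L2_extension mu (inverse_L2 mu F) (fun xi => h xi * F f xi) (A f).

Definition operator_norm (p q : R)
    (A : ('rV[R]_N -> R[i]) -> ('rV[R]_N -> R[i])) : \bar R :=
  ereal_sup [set (cLnorm mu q%:E (A f) / cLnorm mu p%:E f)%E
    | f in [set f | test_function f /\ f <> (fun=> 0)]].

(* The bracket to the power r, with the convention for r = 0. *)
Definition measure_power (E : set 'rV[R]_N) (r : R) : \bar R :=
  if r == 0 then (if mu E == 0%E then 0%E else 1%E) else (mu E `^ r)%E.

Definition symbol_bound (p q : R) (h : 'rV[R]_N -> R[i]) : \bar R :=
  ereal_sup [set (s%:E *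
      measure_power [set xi | (s <= Normc.normc (h xi))%R] (p^-1 - q^-1)%R)%E
    | s in [set s : R | 0 < s]].

End dunkl.

(* Main.v *)
Require Import Defs.
From mathcomp Require Import all_boot all_order all_algebra.
From mathcomp Require Import finmap complex.
From mathcomp Require Import all_classical all_reals all_analysis.
From mathcomp Require Import ring lra.
From mathcomp Require Import measurable_realfun ess_sup_inf.

(* Only two properties of the transform F matter: it is unitary on L^2, and
   |F f| <= K ||f||_1 because its kernel is bounded.

   The heart is the estimate int |F f|^2 phi^(2/p - 1) <= C ||f||_p^2 for
   1 < p <= 2 and phi >= 0 with mu {phi >= t} <= 1/t. On a dyadic level set
   {L < phi <= 2 L}, of measure at most 1/L, split f at the height where
   |f|^p = ||f||_p^p / L; the lower part is controlled by Plancherel and the upper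
   part by the L^1 -> L^oo bound, and the sums over L are geometric.

   Let S be the supremum in the theorem and phi = (|h| / S)^r with
   1/r = 1/p - 1/q, so that phi has the weak-type bound above. As
   |h| / S = phi^(1/p - 1/2) phi^(1/q' - 1/2), where 1/q + 1/q' = 1, Cauchy-Schwarz and the
   estimate for the exponents p and q' give
   |<A f, g>| = |<h F f, F g>| <= C S ||f||_p ||g||_q', and duality concludes. *)

Set Implicit Arguments.
Unset Strict Implicit.
Unset Printing Implicit Defensive.
Import Order.TTheory GRing.Theory Num.Theory.
Import numFieldNormedType.Exports.
Local Open Scope classical_set_scope.
Local Open Scope ring_scope.

(** * Complex-valued functions and their Lebesgue norms *)

(** On a dyadic level the L^1 norm of the upper part of f enters squared, which would prevent
    summing over the levels under the integral. Only one of the two factors is therefore bounded by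
    ||f||_p^p; the other stays an integral of |f|, and for each x the sum over L is geometric, with
    ratio 2^(2/p - 1) > 1 for the lower part and 2^(1/p - 1) < 1 for the upper one. This needs 1 < p
    < 2; at p = 2 the estimate is Plancherel's identity. A f is given only through the extension of
    the inverse transform to L^1 + L^2. It is known by its pairings with g in L^1 and L^2, so
    duality is tested on such g alone. The bounded extension is built from h. The symbols h cut to
    {|h| <= n} define operators on L^2 that are bounded from L^p to L^q uniformly in n. Their errors
    are governed by the part of the weighted integral of |F f|^2 over {|h| > n}, which tends to 0.
    Closing the graph of their limit gives an operator on all of L^p that agrees with A on test
    functions. *)

Section complex_pointwise.
Variable R : realType.
Implicit Types z w : R[i].
Local Notation nc := (@Normc.normc R).

Lemma sqr_normc z : nc z ^+ 2 = complex.Re z ^+ 2 + complex.Im z ^+ 2.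
Proof. by case: z => x y /=; rewrite sqr_sqrtr// addr_ge0// sqr_ge0. Qed.

Lemma normc_ge0 z : 0 <= nc z.
Proof. by case: z => x y /=; exact: sqrtr_ge0. Qed.

Lemma normcD z w : nc (z + w) <= nc z + nc w.
Proof. exact: (@le_normcD R z w). Qed.

Lemma normc_opp z : nc (- z) = nc z.
Proof. exact: (@normcN R z). Qed.

Lemma normcB_sym z w : nc (z - w) = nc (w - z).
Proof. by rewrite -normc_opp opprB. Qed.

Lemma ler_dist_normc z w : `|nc z - nc w| <= nc (z - w).
Proof.
have := normcD (z - w) w; have := normcD (w - z) z.
by rewrite !subrK (normcB_sym w z) ler_norml => h1 h2; apply/andP; split; lra.
Qed.

Lemma normc_real (x : R) : nc (x%:C)%C = `|x|.
Proof. by rewrite /= expr0n/= addr0 sqrtr_sqr. Qed.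

Lemma normc_Re z : `|complex.Re z| <= nc z.
Proof.
case: z => x y /=; rewrite -sqrtr_sqr ler_sqrt ?addr_ge0 ?sqr_ge0//.
by rewrite lerDl sqr_ge0.
Qed.

Lemma normc_Im z : `|complex.Im z| <= nc z.
Proof.
case: z => x y /=; rewrite -sqrtr_sqr ler_sqrt ?addr_ge0 ?sqr_ge0//.
by rewrite lerDr sqr_ge0.
Qed.

Lemma normc_le_ReIm z : nc z <= `|complex.Re z| + `|complex.Im z|.
Proof.
rewrite -(@ler_pXn2r _ 2)// ?nnegrE ?normc_ge0 ?addr_ge0// sqr_normc sqrrD.
by rewrite !real_normK ?num_real// lerD2r lerDl mulrn_wge0// mulr_ge0.
Qed.

(* Pairing with the real part of the Hermitian product determines a complex
   function as well, and only real integrals occur. *)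
Definition rdot z w : R := complex.Re z * complex.Re w + complex.Im z * complex.Im w.

Lemma rdotxx z : rdot z z = nc z ^+ 2.
Proof. by rewrite sqr_normc /rdot -!expr2. Qed.

Lemma rdot_polar z w : 2 * rdot z w = nc (z + w) ^+ 2 - nc z ^+ 2 - nc w ^+ 2.
Proof. by rewrite !sqr_normc /rdot; case: z w => [a b] [c d] /=; ring. Qed.

Lemma normr_rdot z w : `|rdot z w| <= nc z * nc w.
Proof.
rewrite -(@ler_pXn2r _ 2)// ?nnegrE ?mulr_ge0 ?normc_ge0// exprMn.
rewrite real_normK ?num_real// !sqr_normc /rdot.
case: z w => [a b] [c d] /=; rewrite -subr_ge0.
have -> : (a ^+ 2 + b ^+ 2) * (c ^+ 2 + d ^+ 2) - (a * c + b * d) ^+ 2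
  = (a * d - b * c) ^+ 2 by ring.
exact: sqr_ge0.
Qed.

Lemma rdotDl z1 z2 w : rdot (z1 + z2) w = rdot z1 w + rdot z2 w.
Proof. by rewrite /rdot; case: z1 z2 w => [a b] [c d] [e f] /=; ring. Qed.

Lemma rdotBl z1 z2 w : rdot (z1 - z2) w = rdot z1 w - rdot z2 w.
Proof. by rewrite /rdot; case: z1 z2 w => [a b] [c d] [e f] /=; ring. Qed.

Lemma rdotZr (x : R) z w : rdot z (x%:C%C * w) = x * rdot z w.
Proof. by rewrite /rdot; case: z w => [a b] [c d] /=; ring. Qed.

End complex_pointwise.

Section complex_measurable.
Context {d : measure_display} {T : measurableType d} {R : realType}.
Implicit Types (f g : T -> R[i]) (E : set T).
Local Notation nc := (@Normc.normc R).

Lemma cmeasurable_normc f : cmeasurable f ->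
  measurable_fun setT (fun x => nc (f x)).
Proof.
move=> [mr mi].
rewrite (_ : (fun x => _) = fun x =>
  Num.sqrt (complex.Re (f x) ^+ 2 + complex.Im (f x) ^+ 2)); last first.
  by apply/funext => x; case: (f x).
apply: (measurableT_comp (continuous_measurable_fun (@sqrt_continuous R))).
by apply: measurable_funD; apply: measurable_funX.
Qed.

Lemma cmeasurableD f g : cmeasurable f -> cmeasurable g ->
  cmeasurable (fun x => f x + g x).
Proof.
move=> [fr fi] [gr gi]; split.
  rewrite (_ : (fun x => _) = (fun x => complex.Re (f x) + complex.Re (g x))).
    exact: measurable_funD.
  by apply/funext => x; case: (f x) (g x) => [? ?] [].
rewrite (_ : (fun x => _) = (fun x => complex.Im (f x) + complex.Im (g x))).
  exact: measurable_funD.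
by apply/funext => x; case: (f x) (g x) => [? ?] [].
Qed.

Lemma cmeasurableM f g : cmeasurable f -> cmeasurable g ->
  cmeasurable (fun x => f x * g x).
Proof.
move=> [fr fi] [gr gi]; split.
  rewrite (_ : (fun x => _) = (fun x => complex.Re (f x) * complex.Re (g x)
     - complex.Im (f x) * complex.Im (g x))).
    by apply: measurable_funB; exact: measurable_funM.
  by apply/funext => x; case: (f x) (g x) => [? ?] [].
rewrite (_ : (fun x => _) = (fun x => complex.Re (f x) * complex.Im (g x)
     + complex.Im (f x) * complex.Re (g x))).
  by apply: measurable_funD; exact: measurable_funM.
by apply/funext => x; case: (f x) (g x) => [? ?] [].
Qed.

Lemma cmeasurable_cst (z : R[i]) : cmeasurable (fun _ : T => z).
Proof. by split; exact: measurable_cst. Qed.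

Lemma cmeasurable_real (f : T -> R) : measurable_fun setT f ->
  cmeasurable (fun x => (f x)%:C%C).
Proof. by move=> mf; split => //=; exact: measurable_cst. Qed.

Lemma cmeasurableB f g : cmeasurable f -> cmeasurable g ->
  cmeasurable (fun x => f x - g x).
Proof.
move=> mf mg; rewrite (_ : (fun x => _) = (fun x => f x + (-1) * g x)).
  by apply: cmeasurableD => //; apply: cmeasurableM => //; exact: cmeasurable_cst.
by apply/funext => x; rewrite mulN1r.
Qed.

Definition crestr E f x : R[i] := if x \in E then f x else 0.

Lemma crestrE E f x : crestr E f x = (\1_E x)%:C%C * f x.
Proof. by rewrite /crestr indicE; case: ifPn; rewrite ?mul1r ?mul0r. Qed.

Lemma normc_crestr E f x : nc (crestr E f x) = \1_E x * nc (f x).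
Proof.
by rewrite /crestr indicE; case: ifPn; rewrite ?mul1r ?mul0r ?Normc.normc0.
Qed.

Lemma normc_crestr_le E f x : nc (crestr E f x) <= nc (f x).
Proof. by rewrite /crestr; case: ifPn; rewrite ?Normc.normc0 ?normc_ge0. Qed.

Lemma crestr_split E f x : f x = crestr E f x + crestr (~` E) f x.
Proof. by rewrite /crestr in_setC; case: ifPn; rewrite /= ?addr0 ?add0r. Qed.

Lemma cmeasurable_crestr E f : measurable E -> cmeasurable f ->
  cmeasurable (crestr E f).
Proof.
move=> mE mf; rewrite (_ : crestr E f = fun x => (\1_E x)%:C%C * f x).
  by apply: cmeasurableM => //; apply: cmeasurable_real; exact: measurable_indic.
by apply/funext => x; rewrite crestrE.
Qed.

Lemma measurable_rdot f g : cmeasurable f -> cmeasurable g ->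
  measurable_fun setT (fun x => rdot (f x) (g x)).
Proof.
move=> [fr fi] [gr gi].
by apply: measurable_funD; exact: measurable_funM.
Qed.

End complex_measurable.

Local Open Scope ring_scope.

Section Lp_tools.
Context {d : measure_display} {T : measurableType d} {R : realType}.
Variable mu : {measure set T -> \bar R}.
Implicit Types (f g : T -> R[i]) (E : set T) (p : R).
Local Notation nc := (@Normc.normc R).

Definition pint p f : \bar R := (\int[mu]_x (nc (f x) `^ p)%:E)%E.

Lemma pint_ge0 p f : (0 <= pint p f)%E.
Proof. by apply: integral_ge0 => x _; rewrite lee_fin powR_ge0. Qed.

Lemma cLnormE p f : cLnorm mu p%:E f = (pint p f `^ p^-1)%E.
Proof.
rewrite /cLnorm unlock /pint; congr (_ `^ _)%E; apply: eq_integral => x _.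
by rewrite abse_EFin poweR_EFin ger0_norm// normc_ge0.
Qed.

Lemma pintE p f : p != 0 -> pint p f = (cLnorm mu p%:E f `^ p)%E.
Proof. by move=> p0; rewrite cLnormE -poweRrM mulVf// poweRe1// pint_ge0. Qed.

Lemma cLnorm_ge0 (p : \bar R) f : (0 <= cLnorm mu p f)%E.
Proof. exact: Lnorm_ge0. Qed.

Lemma inLE p f : 0 < p -> inL mu p%:E f <-> cmeasurable f /\ (pint p f < +oo)%E.
Proof.
move=> p0; split=> -[mf fp]; split => //.
  by rewrite pintE ?gt_eqF//; exact: poweR_lty.
by rewrite cLnormE; exact: poweR_lty.
Qed.

Lemma measurable_powR_normc p f : cmeasurable f ->
  measurable_fun setT (fun x => (nc (f x) `^ p)%:E).
Proof.
move=> mf; apply/measurable_EFinP.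
by apply: (measurableT_comp (measurable_powR _)); exact: cmeasurable_normc.
Qed.

Lemma le_pint p f g : 0 <= p -> cmeasurable f -> cmeasurable g ->
  (\forall x \ae mu, nc (f x) <= nc (g x)) -> (pint p f <= pint p g)%E.
Proof.
move=> p0 mf mg fg; apply: ae_ge0_le_integral => //.
- by move=> x _; rewrite lee_fin powR_ge0.
- exact: measurable_powR_normc.
- by move=> x _; rewrite lee_fin powR_ge0.
- exact: measurable_powR_normc.
- by apply: filterS fg => x + _; rewrite lee_fin; apply: ge0_ler_powR;
     rewrite ?nnegrE ?normc_ge0.
Qed.

Lemma le_cLnorm p f g : 0 <= p -> cmeasurable f -> cmeasurable g ->
  (\forall x \ae mu, nc (f x) <= nc (g x)) ->
  (cLnorm mu p%:E f <= cLnorm mu p%:E g)%E.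
Proof.
move=> p0 mf mg fg; rewrite !cLnormE; apply: gt0_ler_poweR.
- by rewrite invr_ge0.
- by rewrite in_itv/= pint_ge0 leey.
- by rewrite in_itv/= pint_ge0 leey.
- exact: le_pint.
Qed.

Lemma cLnormD p f g : 1 <= p -> cmeasurable f -> cmeasurable g ->
  (cLnorm mu p%:E (fun x => f x + g x)%R
   <= cLnorm mu p%:E f + cLnorm mu p%:E g)%E.
Proof.
move=> p1 mf mg.
pose nf x := nc (f x); pose ng x := nc (g x).
apply: le_trans (minkowski_EFin mu _ _ p1); last 2 first.
- exact: (cmeasurable_normc mf).
- exact: (cmeasurable_normc mg).
have -> : Lnorm mu p%:E (EFin \o ((fun x => nc (f x)) \+ (fun x => nc (g x)))) =
   cLnorm mu p%:E (fun x => (nf x + ng x)%:C%C).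
  by apply: eq_Lnorm => x /=; rewrite expr0n/= addr0 sqrtr_sqr ger0_norm//
    addr_ge0 ?normc_ge0.
apply: le_cLnorm => //.
- exact: le_trans p1.
- exact: cmeasurableD.
- by apply: cmeasurable_real; apply: measurable_funD; exact: cmeasurable_normc.
- by apply: aeW => x; rewrite normc_real ger0_norm ?addr_ge0 ?normc_ge0 ?normcD.
Qed.

Lemma cLnormZ p (c : R[i]) f : 0 < p -> cmeasurable f ->
  (cLnorm mu p%:E (fun x => c * f x)%R = (nc c)%:E * cLnorm mu p%:E f)%E.
Proof.
move=> p0 mf; rewrite !cLnormE /pint.
under eq_integral do rewrite Normc.normcM powRM ?normc_ge0// EFinM.
rewrite ge0_integralZl//; last 3 first.
- exact: measurable_powR_normc.
- by move=> x _; rewrite lee_fin powR_ge0.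
- by rewrite lee_fin powR_ge0.
rewrite poweRM ?lee_fin ?powR_ge0 ?pint_ge0//.
by rewrite poweR_EFin -powRrM divff ?gt_eqF// powRr1// normc_ge0.
Qed.

Lemma inLD p f g : 1 <= p -> inL mu p%:E f -> inL mu p%:E g ->
  inL mu p%:E (fun x => f x + g x).
Proof.
move=> p1 [mf fp] [mg gp]; split; first exact: cmeasurableD.
by apply: le_lt_trans (cLnormD p1 mf mg) _; rewrite lte_add_pinfty.
Qed.

Lemma inLZ p (c : R[i]) f : 0 < p -> inL mu p%:E f ->
  inL mu p%:E (fun x => c * f x).
Proof.
move=> p0 [mf fp]; split.
  by apply: cmeasurableM => //; exact: cmeasurable_cst.
by rewrite cLnormZ// lte_mul_pinfty// ?lee_fin ?normc_ge0.
Qed.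

Lemma inLB p f g : 1 <= p -> inL mu p%:E f -> inL mu p%:E g ->
  inL mu p%:E (fun x => f x - g x).
Proof.
move=> p1 fp gp; rewrite (_ : (fun x => _) = fun x => f x + (-1) * g x).
  by apply: inLD => //; apply: inLZ => //; exact: lt_le_trans p1.
by apply/funext => x; rewrite mulN1r.
Qed.

Lemma le_inL p f g : 0 <= p -> cmeasurable f -> inL mu p%:E g ->
  (\forall x \ae mu, nc (f x) <= nc (g x)) -> inL mu p%:E f.
Proof.
move=> p0 mf [mg gp] fg; split => //.
exact: le_lt_trans (le_cLnorm p0 mf mg fg) gp.
Qed.

Lemma inL_crestr p E f : 0 <= p -> measurable E -> inL mu p%:E f ->
  inL mu p%:E (crestr E f).
Proof.
move=> p0 mE fp; have [mf _] := fp; apply: (le_inL p0 _ fp).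
  exact: cmeasurable_crestr.
by apply: aeW => x; exact: normc_crestr_le.
Qed.

Lemma pint2E f : pint 2 f = (\int[mu]_x (nc (f x) ^+ 2)%:E)%E.
Proof. by apply: eq_integral => x _; rewrite powR_mulrn// normc_ge0. Qed.

Lemma pint1E f : pint 1 f = (\int[mu]_x (nc (f x))%:E)%E.
Proof. by apply: eq_integral => x _; rewrite powRr1// normc_ge0. Qed.

Lemma cLnormB_sym (p : \bar R) f g :
  cLnorm mu p (fun x => (f x - g x)%R) = cLnorm mu p (fun x => (g x - f x)%R).
Proof. by rewrite /cLnorm; congr Lnorm; apply/funext => x; rewrite normcB_sym. Qed.

Lemma inL2P f : inL mu 2%:E f -> cmeasurable f /\ (pint 2 f < +oo)%E.
Proof. by move=> /inLE; apply; exact: ltr0n. Qed.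

Lemma inL1P f : inL mu 1%:E f -> cmeasurable f /\ (pint 1 f < +oo)%E.
Proof. by move=> /inLE; apply. Qed.

End Lp_tools.

(** * A weighted L^2 estimate for the Fourier transform *)

Section geometric_sums.
Variable R : realType.
Implicit Types r x V : R.

Lemma geometric_sum_le r x V n : 1 < r -> 0 < x -> 0 <= V ->
  (r - 1) * \sum_(i < n) (if x * r ^+ i <= V then x * r ^+ i else 0) <= r * V.
Proof.
move=> r1 x0 V0; have r0 : 0 < r by exact: lt_trans r1.
suff [] : (r - 1) * \sum_(i < n) (if x * r ^+ i <= V then x * r ^+ i else 0)
    <= r * V /\
  (r - 1) * \sum_(i < n) (if x * r ^+ i <= V then x * r ^+ i else 0) <= x * r ^+ n.
  by [].
elim: n => [|n [IH1 IH2]].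
  by rewrite big_ord0 mulr0 expr0 mulr1; split; [rewrite mulr_ge0// ltW|exact: ltW].
rewrite big_ord_recr/= mulrDr exprS.
have xn0 : 0 < x * r ^+ n by rewrite mulr_gt0// exprn_gt0.
case: ifPn => xV.
  have h : (r - 1) * \sum_(i < n) (if x * r ^+ i <= V then x * r ^+ i else 0) +
    (r - 1) * (x * r ^+ n) <= r * (x * r ^+ n).
    by move: IH2; set S := (r - 1) * \sum_(i < n) _ => IH2; lra.
  split; last by rewrite [leRHS]mulrCA.
  by apply: (le_trans h); rewrite ler_pM2l.
rewrite mulr0 addr0; split => //; rewrite [leRHS]mulrCA.
by apply: (le_trans IH2); rewrite ler_peMl// ltW.
Qed.

(** In a decreasing progression the terms below V are dominated by the first of them. The induction
    peels off the first term, so it runs over all starting values x; again a second bound, by x, is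
    carried along. *)
Lemma geometric_sum_lt r x V n : 0 < r < 1 -> 0 <= x -> 0 <= V ->
  (1 - r) * \sum_(i < n) (if x * r ^+ i < V then x * r ^+ i else 0) <= V.
Proof.
move=> /andP[r0 r1] x0 V0.
suff [] : (1 - r) * \sum_(i < n) (if x * r ^+ i < V then x * r ^+ i else 0) <= V /\
  (1 - r) * \sum_(i < n) (if x * r ^+ i < V then x * r ^+ i else 0) <= x by [].
elim: n x x0 => [|n IH] x x0; first by rewrite big_ord0 mulr0.
rewrite big_ord_recl/= expr0 mulr1.
have -> : \sum_(i < n) (if x * r ^+ bump 0 i < V then x * r ^+ bump 0 i else 0) =
   \sum_(i < n) (if x * r * r ^+ i < V then x * r * r ^+ i else 0).
  by apply: eq_bigr => i _; rewrite /bump/= add1n exprS mulrA.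
have [|IH1 IH2] := IH (x * r); first by rewrite mulr_ge0// ltW.
rewrite mulrDr; case: ifPn => xV.
  suff h : (1 - r) * x + (1 - r) * (\sum_(i < n) (if x * r * r ^+ i < V then x * r * r ^+ i else 0)) <= x.
    by split => //; exact: le_trans h (ltW xV).
  by move: IH2; set S := (1 - r) * \sum_(i < n) _ => IH2; lra.
rewrite mulr0 add0r; split => //; apply: (le_trans IH2).
by rewrite ler_piMr// ltW.
Qed.

Lemma powR_pow2 (t b : R) i : 0 <= t ->
  (t * 2 ^+ i) `^ b = t `^ b * (2 `^ b) ^+ i.
Proof.
move=> t0; rewrite powRM// ?exprn_ge0//; congr (_ * _).
by rewrite -(powR_mulrn i (powR_ge0 2 b)) -(powR_mulrn i (ler0n R 2)) powRAC.
Qed.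

End geometric_sums.

(** * The estimate on one dyadic level set *)

Section level.
Context {d : measure_display} {T : measurableType d} {R : realType}.
Variable mu : {measure set T -> \bar R}.
Implicit Types (f g : T -> R[i]) (E : set T).
Local Notation nc := (@Normc.normc R).

(** The transform acts on L^2 functions, so the L^1 -> L^oo bound is stated on the intersection of
    L^1 and L^2. *)
Definition L1_bounded (F : (T -> R[i]) -> (T -> R[i])) (K : R) :=
  forall f, inL mu 1%:E f -> inL mu 2%:E f ->
    {ae mu, forall x, nc (F f x) <= K * fine (pint mu 1 f)}.

Variables (F : (T -> R[i]) -> (T -> R[i])) (K : R).
Hypotheses (Funi : unitary_L2 mu F) (FK : L1_bounded F K) (K0 : 0 <= K).

Lemma pint2_unitary f : inL mu 2%:E f -> pint mu 2 (F f) = pint mu 2 f.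
Proof.
by move=> f2; have [_ /(_ f f2)[_ e] _] := Funi; rewrite !pintE ?pnatr_eq0// e.
Qed.

Lemma inL2_unitary f : inL mu 2%:E f -> inL mu 2%:E (F f).
Proof. by move=> f2; have [_ /(_ f f2)[]] := Funi. Qed.

Lemma unitaryD f g : inL mu 2%:E f -> inL mu 2%:E g ->
  aeq mu (F (fun x => f x + g x)) (fun x => F f x + F g x).
Proof.
move=> f2 g2; have [/(_ 1 f g f2 g2)] := Funi.
rewrite (_ : (fun x => 1 * f x + g x) = fun x => f x + g x); last first.
  by apply/funext => x; rewrite mul1r.
by move=> + _ _; apply: filterS => x ->; rewrite mul1r.
Qed.

Variables (phi : T -> R) (p : R).
Hypotheses (mphi : measurable_fun setT phi)
  (phi_weak : forall t, 0 < t -> (mu [set x | (t <= phi x)%R] <= (t^-1)%:E)%E)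
  (p1 : 1 < p) (p2 : p <= 2).

Let b := 2 / p - 1.

Variables (f : T -> R[i]) (A : R).
Hypotheses (f2 : inL mu 2%:E f) (fA : pint mu p f = A%:E) (A0 : 0 < A).

Let mf : cmeasurable f. Proof. by case: f2. Qed.
Let p0 : 0 < p. Proof. exact: lt_trans p1. Qed.

Let cutoff L := (A / L) `^ p^-1.
Let low L : set T := [set x | nc (f x) <= cutoff L].

Let mlow L : measurable (low L).
Proof.
rewrite -[X in measurable X]setTI; apply: measurable_fun_le => //.
exact: cmeasurable_normc.
Qed.

Let cutoff_gt0 L : 0 < L -> 0 < cutoff L.
Proof. by move=> L0; rewrite powR_gt0// divr_gt0. Qed.

Let highE L x : x \notin low L -> cutoff L < nc (f x).
Proof. by move=> /negP; rewrite inE /low/= => /negP; rewrite ltNge. Qed.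

(** Above the cutoff write |f| = |f|^(1 - p) |f|^p; the exponent 1 - p is negative, so the first
    factor is largest at the cutoff. *)
Let pint_high L : 0 < L ->
  (pint mu 1 (crestr (~` low L) f) <= (cutoff L `^ (1 - p) * A)%:E)%E.
Proof.
move=> L0; rewrite EFinM -fA -ge0_integralZl//; last 3 first.
- exact: measurable_powR_normc.
- by move=> x _; rewrite lee_fin powR_ge0.
- by rewrite lee_fin powR_ge0.
apply: ge0_le_integral => //.
- by move=> x _; rewrite lee_fin powR_ge0.
- apply: measurable_powR_normc; apply: cmeasurable_crestr => //.
  exact: measurableC.
- by apply: measurable_funeM; exact: measurable_powR_normc.
move=> x _; rewrite -EFinM lee_fin /crestr in_setC; case: ifPn => [xL|_].
  have xc := highE xL; have x0 : 0 < nc (f x) by exact: lt_trans (cutoff_gt0 L0) xc.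
  have -> : (1 : R) = (1 - p) + p by rewrite subrK.
  rewrite powRD; last by apply/implyP => _; rewrite gt_eqF.
  rewrite ler_pM2r ?powR_gt0// subrK -opprB !powRN lef_pV2 ?posrE ?powR_gt0//.
    by apply: ge0_ler_powR; rewrite ?nnegrE ?subr_ge0 ?normc_ge0 ?ltW ?cutoff_gt0.
  by rewrite divr_gt0.
by rewrite Normc.normc0 powR0// mulr_ge0// powR_ge0.
Qed.

(** The factor L^b comes from the weight and 1/L from the measure of the level set. The remaining
    exponent 1/p - 1 of L is negative, which makes the upper parts summable over large L. *)
Let cutoff_pow L : 0 < L ->
  L `^ b * (cutoff L `^ (1 - p) * A) / L = A `^ p^-1 * L `^ (p^-1 - 1).
Proof.
move=> L0; have pn0 : p != 0 by rewrite gt_eqF.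
have An0 : A != 0 by rewrite gt_eqF.
have Ln0 : L != 0 by rewrite gt_eqF.
rewrite /cutoff -powRrM.
have -> : p^-1 * (1 - p) = p^-1 - 1 by field.
have -> : (A / L) `^ (p^-1 - 1) = A `^ (p^-1 - 1) * L `^ (1 - p^-1).
  rewrite powRM ?invr_ge0 ?ltW// -(@powR_inv1 _ L) ?ltW// -powRrM; congr (_ * _ `^ _).
  by ring.
have -> : A `^ p^-1 = A `^ (p^-1 - 1) * A.
  rewrite -[X in _ = _ * X]powRr1 ?ltW// -powRD ?subrK//.
  by apply/implyP.
have -> : L `^ (p^-1 - 1) = L `^ b * L `^ (1 - p^-1) * L^-1.
  rewrite -(@powR_inv1 _ L) ?ltW// -!powRD ?Ln0 ?implybT//; congr (_ `^ _).
  by rewrite /b; field.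
by ring.
Qed.

(* Plancherel bounds the part of f below the cutoff, and the L^1 -> L^oo estimate
   the part above it. *)
Lemma level_bound L E : 0 < L -> measurable E ->
  (forall x, E x -> L < phi x <= 2 * L) ->
  (\int[mu]_(x in E) (nc (F f x) ^+ 2 * phi x `^ b)%:E <=
   \int[mu]_x ((4 * L `^ b) * (if nc (f x) <= cutoff L then nc (f x) ^+ 2 else 0)
     + (4 * K ^+ 2 * (A `^ p^-1 * L `^ (p^-1 - 1))) *
         (if nc (f x) <= cutoff L then 0 else nc (f x)))%:E)%E.
Proof.
move=> L0 mE Ephi.
pose f1 := crestr (~` low L) f; pose g := crestr (low L) f.
have mlC : measurable (~` low L) by exact: measurableC.
have f12 : inL mu 2%:E f1 by exact: inL_crestr.
have g2 : inL mu 2%:E g by exact: inL_crestr.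
have mf1 : cmeasurable f1 by case: f12.
have mg : cmeasurable g by case: g2.
have f11 : inL mu 1%:E f1.
  by apply/inLE => //; split => //; apply: (le_lt_trans (pint_high L0)); rewrite ltry.
pose I1 := fine (pint mu 1 f1).
have I1E : pint mu 1 f1 = I1%:E.
  rewrite fineK// ge0_fin_numE ?pint_ge0//.
  by apply: (le_lt_trans (pint_high L0)); rewrite ltry.
have I1_ge0 : 0 <= I1 by rewrite fine_ge0// pint_ge0.
have I1_le : I1 <= cutoff L `^ (1 - p) * A by rewrite -lee_fin -I1E pint_high.
have mFf : cmeasurable (F f) by case: (inL2_unitary f2).
have mFg : cmeasurable (F g) by case: (inL2_unitary g2).
have b_ge0 : 0 <= b by rewrite subr_ge0 ler_pdivlMr// mul1r.
have b_le1 : b <= 1.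
  rewrite /b lerBlDr ler_pdivrMr//; by move: p1; lra.
have sq_mfun (h : T -> R[i]) : cmeasurable h -> measurable_fun setT (fun x => (nc (h x) ^+ 2)%:E).
  by move=> mh; apply/measurable_EFinP; apply: measurable_funX; exact: cmeasurable_normc.
(* Here 2^b <= 2, because b <= 1. *)
have phiE x : E x -> phi x `^ b <= 2 * L `^ b.
  move=> Ex; have /andP[lt1 le2] := Ephi _ Ex.
  apply: (@le_trans _ _ ((2 * L) `^ b)).
    by apply: ge0_ler_powR; rewrite ?nnegrE//; [exact: ltW (lt_trans L0 lt1)|rewrite mulr_ge0// ltW].
  by rewrite powRM ?(ltW L0)// ler_wpM2r ?powR_ge0// ler1_powR// ler1n.
have Fsplit : {ae mu, forall x, nc (F f x) ^+ 2 <=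
   2 * (K * I1) ^+ 2 + 2 * nc (F g x) ^+ 2}.
  have fE : f = fun x => g x + f1 x by apply/funext => x; exact: crestr_split.
  have := unitaryD g2 f12; rewrite -fE => H.
  have H' := FK f11 f12.
  apply: filterS2 H H' => x -> H'.
  apply: (@le_trans _ _ ((nc (F g x) + nc (F f1 x)) ^+ 2)).
    by rewrite ler_pXn2r ?nnegrE ?addr_ge0 ?normc_ge0// normcD.
  have : nc (F f1 x) ^+ 2 <= (K * I1) ^+ 2.
    by rewrite ler_pXn2r ?nnegrE ?normc_ge0// mulr_ge0.
  have := sqr_ge0 (nc (F g x) - nc (F f1 x)).
  by rewrite sqrrB sqrrD; lra.
have muE : (mu E <= (L^-1)%:E)%E.
  apply: le_trans (phi_weak L0); apply: le_measure; rewrite ?inE//.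
    rewrite -[X in measurable X]setTI; apply: measurable_fun_le => //.
  by move=> x /Ephi /andP[/ltW].
apply: (@le_trans _ _ (\int[mu]_(x in E) ((2 * L `^ b * 2)%:E *
    (((K * I1) ^+ 2)%:E + (nc (F g x) ^+ 2)%:E)))%E).
  apply: ae_ge0_le_integral => //.
  - by move=> x _; rewrite lee_fin mulr_ge0 ?powR_ge0// sqr_ge0.
  - apply/measurable_EFinP; apply: measurable_funTS; apply: measurable_funM.
      by apply: measurable_funX; exact: cmeasurable_normc.
    exact: (measurableT_comp (measurable_powR _)).
  - by move=> x _; rewrite -EFinD -EFinM lee_fin !mulr_ge0 ?powR_ge0// addr_ge0 ?sqr_ge0.
  - apply: measurable_funTS; apply: measurable_funeM; apply: emeasurable_funD => //.
    exact: sq_mfun.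
  apply: filterS Fsplit => x Hx Ex; rewrite -EFinD -EFinM lee_fin.
  rewrite [leRHS](_ : _ = (2 * (K * I1) ^+ 2 + 2 * nc (F g x) ^+ 2) * (2 * L `^ b)); last by ring.
  by apply: ler_pM; rewrite ?sqr_ge0 ?powR_ge0// phiE.
have mg2 := sq_mfun _ mFg.
rewrite ge0_integralZl//; last 3 first.
- by apply: measurable_funTS; apply: emeasurable_funD.
- by move=> x _; rewrite -EFinD lee_fin addr_ge0 ?sqr_ge0.
- by rewrite lee_fin !mulr_ge0 ?powR_ge0.
rewrite ge0_integralD//; last 3 first.
- by move=> x _; rewrite lee_fin sqr_ge0.
- by move=> x _; rewrite lee_fin sqr_ge0.
- exact: measurable_funTS.
rewrite integral_cst//.
have FgE : (\int[mu]_(x in E) (nc (F g x) ^+ 2)%:E <= \int[mu]_x (nc (g x) ^+ 2)%:E)%E.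
  rewrite -pint2E -(pint2_unitary g2) pint2E; apply: ge0_subset_integral => //.
  by move=> x _; rewrite lee_fin sqr_ge0.
(* In [I1 ^+ 2] one factor is replaced by its bound; the other remains the integral of |f| above the
   cutoff, to be summed over L pointwise. *)
apply: (@le_trans _ _ ((2 * L `^ b * 2)%:E * ((K ^+ 2 * (I1 * (cutoff L `^ (1 - p) * A)) / L)%:E + \int[mu]_x (nc (g x) ^+ 2)%:E))%E).
  apply: lee_wpmul2l; first by rewrite lee_fin !mulr_ge0// powR_ge0.
  apply: leeD => //; rewrite [leRHS]EFinM; apply: lee_pmul => //.
    by rewrite lee_fin sqr_ge0.
  by rewrite lee_fin exprMn ler_wpM2l ?sqr_ge0// expr2 ler_wpM2l.
have -> : (\int[mu]_x ((4 * L `^ b) * (if nc (f x) <= cutoff L then nc (f x) ^+ 2 else 0)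
     + (4 * K ^+ 2 * (A `^ p^-1 * L `^ (p^-1 - 1))) *
         (if nc (f x) <= cutoff L then 0 else nc (f x)))%:E =
  (4 * L `^ b)%:E * \int[mu]_x (nc (g x) ^+ 2)%:E + (4 * K ^+ 2 * (A `^ p^-1 * L `^ (p^-1 - 1)))%:E * I1%:E)%E.
  rewrite -I1E pint1E -!ge0_integralZl//; last 6 first.
  - by apply/measurable_EFinP; exact: cmeasurable_normc.
  - by move=> x _; rewrite lee_fin normc_ge0.
  - by rewrite lee_fin !mulr_ge0 ?powR_ge0 ?sqr_ge0.
  - exact: sq_mfun.
  - by move=> x _; rewrite lee_fin sqr_ge0.
  - by rewrite lee_fin !mulr_ge0 ?powR_ge0 ?sqr_ge0.
  rewrite -ge0_integralD//; last 4 first.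
  - by move=> x _; rewrite -EFinM lee_fin !mulr_ge0 ?powR_ge0 ?sqr_ge0 ?normc_ge0.
  - by apply: measurable_funeM; exact: sq_mfun.
  - by move=> x _; rewrite -EFinM lee_fin !mulr_ge0 ?powR_ge0 ?sqr_ge0 ?normc_ge0.
  - by apply: measurable_funeM; apply/measurable_EFinP; exact: cmeasurable_normc.
  apply: eq_integral => x _; rewrite -!EFinM -EFinD /g /f1 /crestr in_setC.
  have -> : (x \in low L) = (nc (f x) <= cutoff L).
    by apply/idP/idP => h; [move: h; rewrite inE|exact: mem_set].
  by rewrite if_neg; case: ifPn => _; rewrite Normc.normc0 ?expr0n.
rewrite -(cutoff_pow L0) muleDr// ?fin_num_adde_defr//.
rewrite addeC; apply: leeD.
  by rewrite (_ : 2 * L `^ b * 2 = 4 * L `^ b)//; ring.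
by rewrite -!EFinM lee_fin le_eqVlt; apply/orP; left; apply/eqP; ring.
Qed.

End level.

(** * Summation over the dyadic levels at a fixed point, with y = |f x| *)

Section pitt_pointwise.
Variable R : realType.
Variables (p K A tau y : R).
Hypotheses (p1 : 1 < p) (p2 : p < 2) (A0 : 0 < A) (t0 : 0 < tau) (y0 : 0 <= y).

Let b := 2 / p - 1.
Let g := p^-1 - 1.
Let rho : R := 2 `^ b.
Let r : R := 2 `^ g.
Let p0 : 0 < p. Proof. exact: lt_trans p1. Qed.
Let pn0 : p != 0. Proof. by rewrite gt_eqF. Qed.
Let L (i : nat) := tau * 2 ^+ i.
Let low L0 := y <= (A / L0) `^ p^-1.

Let b0 : 0 < b. Proof. by rewrite subr_gt0 ltr_pdivlMr// mul1r. Qed.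
Let g0 : g < 0. Proof. by rewrite subr_lt0 invf_lt1. Qed.
Let rho1 : 1 < rho.
Proof.
have := @gt0_ltr_powR R _ b0 1 2; rewrite powR1; apply; rewrite ?nnegrE//.
by rewrite ltr1n.
Qed.

Let ltr_powRn (s t : R) : 0 < s -> s < t -> t `^ g < s `^ g.
Proof.
move=> s0 st; have t1 : 0 < t by exact: lt_trans st.
rewrite -[g]opprK powRN [ltRHS]powRN ltf_pV2 ?posrE ?powR_gt0//.
by apply: gt0_ltr_powR; rewrite ?nnegrE ?oppr_gt0// ltW.
Qed.

Let r01 : 0 < r < 1.
Proof.
rewrite powR_gt0//=; have := @ltr_powRn 1 2; rewrite powR1; apply => //.
by rewrite ltr1n.
Qed.

Let L_gt0 i : 0 < L i. Proof. by rewrite mulr_gt0// exprn_gt0. Qed.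

(** The value y is low at level L i exactly when L i <= A / y^p. The powers L i^b that are kept thus
    form an increasing progression stopped at V = (A / y^p)^b, and V y^2 = A^b y^p. *)
Let sum_low n : \sum_(i < n) L i `^ b * (if low (L i) then y ^+ 2 else 0) <=
  rho / (rho - 1) * (A `^ b * y `^ p).
Proof.
have rho1' : 0 < rho - 1 by rewrite subr_gt0.
have rho0 : 0 < rho by exact: lt_trans rho1.
have [y_eq0|y_neq0] := eqVneq y 0.
  rewrite big1 => [|i _]; last by rewrite y_eq0 expr0n/= if_same mulr0.
  by rewrite !mulr_ge0 ?powR_ge0// ?invr_ge0 ltW.
have y_gt0 : 0 < y by rewrite lt_neqAle eq_sym y_neq0.
set V := (A / y `^ p) `^ b.
have Vy : V * y ^+ 2 = A `^ b * y `^ p.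
  rewrite /V powRM ?invr_ge0 ?powR_ge0 ?(ltW A0)// -mulrA; congr (_ * _).
  rewrite -powR_inv1 ?powR_ge0// -!powRrM -powR_mulrn// -powRD ?y_neq0 ?implybT//.
  by congr (_ `^ _); rewrite /b; field.
rewrite -Vy mulrA.
apply: (@le_trans _ _ (\sum_(i < n)
    (if tau `^ b * rho ^+ i <= V then tau `^ b * rho ^+ i else 0) * y ^+ 2)).
  apply: ler_sum => i _; rewrite /L powR_pow2 ?(ltW t0)// -/rho.
  case: ifPn => lowi; last by rewrite mulr0 mulr_ge0 ?sqr_ge0//; case: ifPn => // _;
    rewrite mulr_ge0 ?powR_ge0// exprn_ge0// powR_ge0.
  rewrite ifT// -powR_pow2 ?(ltW t0)//; apply: ge0_ler_powR.
  - exact: ltW.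
  - by rewrite nnegrE ltW// L_gt0.
  - by rewrite nnegrE divr_ge0 ?powR_ge0// ltW.
  rewrite ler_pdivlMr ?powR_gt0// mulrC -ler_pdivlMr ?L_gt0//.
  apply: (@le_trans _ _ (((A / L i) `^ p^-1) `^ p)).
    by apply: ge0_ler_powR; rewrite ?nnegrE ?powR_ge0// ltW.
  by rewrite -powRrM mulVf// powRr1// divr_ge0// ltW.
rewrite -mulr_suml ler_wpM2r ?sqr_ge0//.
rewrite mulrAC ler_pdivlMr// mulrC.
by apply: geometric_sum_le => //; rewrite ?powR_gt0 ?powR_ge0.
Qed.

(** The complementary levels satisfy L i > A / y^p. As g < 0, the powers L i^g that are kept form
    the part of a decreasing progression below V = (A / y^p)^g, and V y = A^g y^p. *)
Let sum_high n : \sum_(i < n) L i `^ g * (if low (L i) then 0 else y) <=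
  (1 - r)^-1 * (A `^ g * y `^ p).
Proof.
have [r0 r1] := andP r01.
have r1' : 0 < 1 - r by rewrite subr_gt0.
have [y_eq0|y_neq0] := eqVneq y 0.
  rewrite big1 => [|i _]; last by rewrite y_eq0 if_same mulr0.
  by rewrite !mulr_ge0 ?powR_ge0// ?invr_ge0 ltW.
have y_gt0 : 0 < y by rewrite lt_neqAle eq_sym y_neq0.
set V := (A / y `^ p) `^ g.
have Vy : V * y = A `^ g * y `^ p.
  rewrite /V powRM ?invr_ge0 ?powR_ge0 ?(ltW A0)// -mulrA; congr (_ * _).
  rewrite -powR_inv1 ?powR_ge0// -!powRrM -[X in _ * X = _]powRr1//.
  rewrite -powRD ?y_neq0 ?implybT//.
  by congr (_ `^ _); rewrite /g; field.
rewrite -Vy mulrA.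
apply: (@le_trans _ _ (\sum_(i < n)
    (if tau `^ g * r ^+ i < V then tau `^ g * r ^+ i else 0) * y)).
  apply: ler_sum => i _; rewrite /L powR_pow2 ?(ltW t0)// -/r.
  case: ifPn => lowi; first by rewrite mulr0 mulr_ge0//; case: ifPn => // _;
    rewrite mulr_ge0 ?powR_ge0// exprn_ge0// powR_ge0.
  rewrite ifT// -powR_pow2 ?(ltW t0)//; apply: ltr_powRn.
    by rewrite divr_gt0// powR_gt0.
  rewrite ltr_pdivrMr ?powR_gt0// mulrC -ltr_pdivrMr ?L_gt0//.
  apply: (@le_lt_trans _ _ (((A / L i) `^ p^-1) `^ p)).
    by rewrite -powRrM mulVf// powRr1// divr_ge0// ltW.
  by apply: gt0_ltr_powR; rewrite ?nnegrE ?powR_ge0// ltNge.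
rewrite -mulr_suml ler_wpM2r// mulrC ler_pdivlMr// mulrC.
by apply: geometric_sum_lt; rewrite ?powR_ge0.
Qed.

(** The first summand comes from Plancherel, the second from the L^1 -> L^oo bound. Each 4 is 2 from
    (u + v)^2 <= 2 u^2 + 2 v^2 times 2 from the variation of phi^b on a level set. The geometric
    factors blow up as p tends to 2 and to 1 respectively. *)
Definition pitt_const : R := 4 * (rho / (rho - 1)) + 4 * K ^+ 2 * (1 - r)^-1.

Lemma pitt_const_ge0 : 0 <= pitt_const.
Proof.
have [r0 r1] := andP r01.
apply: addr_ge0; apply: mulr_ge0.
- by [].
- by rewrite divr_ge0 ?powR_ge0// subr_ge0 ltW.
- by rewrite mulr_ge0// sqr_ge0.
- by rewrite invr_ge0 subr_ge0 ltW.
Qed.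

Lemma level_sum n : \sum_(i < n)
  ((4 * L i `^ b) * (if low (L i) then y ^+ 2 else 0) +
   (4 * K ^+ 2 * (A `^ p^-1 * L i `^ g)) * (if low (L i) then 0 else y))
  <= pitt_const * (A `^ b * y `^ p).
Proof.
rewrite big_split/= /pitt_const [leRHS]mulrDl; apply: lerD.
  rewrite (_ : \sum_(i < n) _ = 4 * \sum_(i < n) L i `^ b * (if low (L i) then y ^+ 2 else 0)).
    by rewrite -mulrA ler_wpM2l.
  by rewrite mulr_sumr; apply: eq_bigr => i _; rewrite mulrA.
rewrite (_ : \sum_(i < n) _ = 4 * K ^+ 2 * A `^ p^-1 *
    \sum_(i < n) L i `^ g * (if low (L i) then 0 else y)); last first.
  by rewrite mulr_sumr; apply: eq_bigr => i _; rewrite !mulrA.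
have -> : A `^ b = A `^ p^-1 * A `^ g.
  rewrite -powRD ?(gt_eqF A0) ?implybT//.
  by congr (_ `^ _); rewrite /b /g; field.
rewrite [leRHS](_ : _ = 4 * K ^+ 2 * A `^ p^-1 * ((1 - r)^-1 * (A `^ g * y `^ p))); last by ring.
by rewrite ler_wpM2l// mulr_ge0 ?powR_ge0// mulr_ge0// sqr_ge0.
Qed.

End pitt_pointwise.

Section pitt.
Context {d : measure_display} {T : measurableType d} {R : realType}.
Variable mu : {measure set T -> \bar R}.
Implicit Types (f g : T -> R[i]) (E : set T).
Local Notation nc := (@Normc.normc R).
Variables (F : (T -> R[i]) -> (T -> R[i])) (K : R).
Hypotheses (Funi : unitary_L2 mu F) (FK : L1_bounded mu F K) (K0 : 0 <= K).
Variables (phi : T -> R) (p : R).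
Hypotheses (mphi : measurable_fun setT phi) (phi0 : forall x, 0 <= phi x)
  (phi_weak : forall t, 0 < t -> (mu [set x | (t <= phi x)%R] <= (t^-1)%:E)%E)
  (p1 : 1 < p).

Lemma pint_eq0 r f : 0 < r -> cmeasurable f -> pint mu r f = 0%E ->
  {ae mu, forall x, nc (f x) = 0}.
Proof.
move=> r0 mf f0.
have mp := measurable_powR_normc r mf.
have /ae_eq_integral_abs : (\int[mu]_(x in setT) `|(nc (f x) `^ r)%:E|)%E = 0%E.
  rewrite -f0; apply: eq_integral => x _.
  by rewrite abse_EFin ger0_norm// powR_ge0.
move=> /(_ measurableT mp); apply: filterS => x /(_ I)/= [] /eqP.
by rewrite powR_eq0 => /andP[/eqP].
Qed.

(** The levels are cut from a bottom set {phi <= tau} upwards; the added 1 in the constant pays for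
    that set. It also makes the constant positive, so the right-hand side is infinite when ||f||_p
    is. *)
Lemma pitt_lt2 f : p < 2 -> inL mu 2%:E f ->
  (\int[mu]_x (nc (F f x) ^+ 2 * phi x `^ (2 / p - 1))%:E
    <= (pitt_const p K + 1)%:E * pint mu p f `^ (2 / p))%E.
Proof.
move=> p2 f2; set b := 2 / p - 1.
have p0 : 0 < p by exact: lt_trans p1.
have b0 : 0 < b by rewrite subr_gt0 ltr_pdivlMr// mul1r.
have C0 : 0 <= pitt_const p K by exact: pitt_const_ge0.
have [mf f2y] := f2.
have mFf : cmeasurable (F f) by case: (inL2_unitary Funi f2).
have mI : measurable_fun setT (fun x => (nc (F f x) ^+ 2 * phi x `^ b)%:E).
  apply/measurable_EFinP; apply: measurable_funM.
    by apply: measurable_funX; exact: cmeasurable_normc.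
  exact: (measurableT_comp (measurable_powR _)).
have I0 x : (0 <= (nc (F f x) ^+ 2 * phi x `^ b)%:E)%E.
  by rewrite lee_fin mulr_ge0 ?sqr_ge0 ?powR_ge0.
have := pint_ge0 mu p f; rewrite le_eqVlt => /orP[/eqP fp0|].
  have f20 : {ae mu, forall x, nc (f x) = 0} by exact: (pint_eq0 p0).
  have Ff0 : pint mu 2 (F f) = 0%E.
    rewrite (pint2_unitary Funi f2) /pint (@ae_eq_integral _ _ _ _ _ (cst 0%E))//.
    - by rewrite integral0.
    - exact: measurable_powR_normc.
    - by apply: filterS f20 => x -> _; rewrite powR0.
  rewrite (@ae_eq_integral _ _ _ _ _ (cst 0%E))//.
    by rewrite integral0 mule_ge0// ?poweR_ge0// lee_fin addr_ge0.
  by apply: filterS (pint_eq0 (ltr0n _ 2) mFf Ff0) => x -> _; rewrite expr0n/= mul0r.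
have [fpy|] := eqVneq (pint mu p f) +oo%E.
  move=> _; rewrite fpy poweRyr ?gt_eqF ?divr_gt0// gt0_muley ?leey//.
  by rewrite lte_fin ltr_wpDl.
rewrite -ltey => fpy fp0.
pose A := fine (pint mu p f).
have fA : pint mu p f = A%:E by rewrite fineK// ge0_fin_numE// ltW.
have A0 : 0 < A by rewrite -lte_fin -fA.
pose B := fine (pint mu 2 f).
have fB : pint mu 2 f = B%:E.
  rewrite fineK// ge0_fin_numE ?pint_ge0//.
  by have /inLE[] := f2.
have B0 : 0 <= B by rewrite -lee_fin -fB pint_ge0.
rewrite fA poweR_EFin -EFinM.
pose D := A `^ (2 / p).
have D0 : 0 < D by rewrite powR_gt0.
(* tau is so small that Plancherel alone settles the set {phi <= tau}. *)
pose tau := (D / (B + 1)) `^ b^-1.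
have tau0 : 0 < tau by rewrite powR_gt0// divr_gt0// ltr_wpDl.
have tauB : tau `^ b * B <= D.
  rewrite /tau -powRrM mulVf ?gt_eqF// powRr1; last by rewrite divr_ge0// ?ltW// ltr_wpDl.
  rewrite -mulrA ler_piMr ?(ltW D0)// mulrC ler_pdivrMr ?ltr_wpDl// mul1r.
  by rewrite lerDl.
pose L i := tau * 2 ^+ i.
have L0 i : 0 < L i by rewrite mulr_gt0// exprn_gt0.
pose S i := [set x | phi x <= L i].
have mS i : measurable (S i).
  rewrite -[X in measurable X]setTI; apply: measurable_fun_le => //.
have ndS : {homo S : n m / (n <= m)%N >-> (n <= m)%O}.
  move=> n m nm; apply/subsetPset => x /= /le_trans; apply.
  by rewrite ler_pM2l// ler_weXn2l// ler1n.
have US : \bigcup_i seqD S i = setT.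
  rewrite eq_bigcup_seqD; apply/seteqP; split => // x _.
  have /archi_boundP : 0 <= phi x / tau by rewrite divr_ge0// ltW.
  set n := Num.bound _ => hn; exists n => //=; rewrite /S/= /L mulrC -ler_pdivrMr//.
  by rewrite (le_trans (ltW hn))// -natrX ler_nat ltnW// ltn_expl.
have mSD i : measurable (seqD S i) by case: i => [|i]//=; exact: measurableD.
have IE : (\int[mu]_x (nc (F f x) ^+ 2 * phi x `^ b)%:E =
  \sum_(0 <= i <oo) \int[mu]_(x in seqD S i) (nc (F f x) ^+ 2 * phi x `^ b)%:E)%E.
  rewrite -US ge0_integral_bigcup//.
  - by rewrite US.
  - exact: trivIset_seqD.
rewrite IE; apply: lime_le.
  by apply: is_cvg_nneseries => n _ _; exact: integral_ge0.
apply: nearW => -[|n].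
  by rewrite big_nil lee_fin mulr_ge0 ?powR_ge0// addr_ge0.
(* The summand D is for the bottom set {phi <= tau}, the other one for the dyadic shells above
   it. *)
rewrite (_ : (pitt_const p K + 1) * D = D + pitt_const p K * D); last by ring.
rewrite big_nat_recl//= EFinD; apply: leeD.
  apply: (@le_trans _ _ (\int[mu]_(x in S 0%N) ((tau `^ b)%:E * (nc (F f x) ^+ 2)%:E)))%E.
    apply: ge0_le_integral => //.
    - exact: measurable_funTS.
    - apply: measurable_funTS; apply: measurable_funeM; apply/measurable_EFinP.
      by apply: measurable_funX; exact: cmeasurable_normc.
    move=> x; rewrite /S/= /L expr0 mulr1 => xt.
    rewrite -EFinM lee_fin mulrC ler_wpM2r ?sqr_ge0//.
    by apply: ge0_ler_powR; rewrite ?nnegrE// ltW.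
  have mF2 : measurable_fun setT (fun x => (nc (F f x) ^+ 2)%:E).
    by apply/measurable_EFinP; apply: measurable_funX; exact: cmeasurable_normc.
  rewrite ge0_integralZl//; last 3 first.
  - exact: measurable_funTS.
  - by move=> x _; rewrite lee_fin sqr_ge0.
  - by rewrite lee_fin powR_ge0.
  apply: le_trans (_ : (tau `^ b * B)%:E <= _)%E; last by rewrite lee_fin.
  rewrite EFinM -fB -(pint2_unitary Funi f2) pint2E; apply: lee_wpmul2l.
    by rewrite lee_fin powR_ge0.
  by apply: ge0_subset_integral => // x _; rewrite lee_fin sqr_ge0.
pose G i x := (4 * L i `^ b) * (if nc (f x) <= (A / L i) `^ p^-1 then nc (f x) ^+ 2 else 0)
     + (4 * K ^+ 2 * (A `^ p^-1 * L i `^ (p^-1 - 1))) *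
         (if nc (f x) <= (A / L i) `^ p^-1 then 0 else nc (f x)).
have G0 i x : 0 <= G i x.
  rewrite /G addr_ge0//; case: ifPn => _; rewrite ?mulr0// !mulr_ge0 ?powR_ge0 ?normc_ge0//.
have mG i : measurable_fun setT (G i).
  have mn := cmeasurable_normc mf.
  apply: measurable_funD; apply: measurable_funM => //; apply: measurable_fun_ifT => //.
  - by apply: measurable_fun_ler.
  - exact: measurable_funX.
  - by apply: measurable_fun_ler.
apply: (@le_trans _ _ (\sum_(0 <= i < n) \int[mu]_x (G i x)%:E)%E).
  apply: lee_sum => i _; apply: (level_bound Funi FK K0 mphi phi_weak p1 (ltW p2) f2 fA A0) => //.
    exact: measurableD.
  move=> x [] /= h1 /negP; rewrite -ltNge => ->/=.
  by move: h1; rewrite /S/= /L exprS mulrCA.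
(* Sum and integral change places, so that [level_sum] applies at each point. *)
rewrite -ge0_integral_sum//; last 2 first.
- by move=> i; exact/measurable_EFinP.
- by move=> i x _; rewrite lee_fin.
apply: (@le_trans _ _ (\int[mu]_x ((pitt_const p K * A `^ b)%:E * (nc (f x) `^ p)%:E))%E).
  apply: ge0_le_integral => //.
  - by move=> x _; apply: sume_ge0 => i _; rewrite lee_fin.
  - by apply: emeasurable_sum => i; exact/measurable_EFinP.
  - by apply: measurable_funeM; exact: measurable_powR_normc.
  move=> x _; rewrite sumEFin -EFinM lee_fin -mulrA big_mkord.
  by apply: (@level_sum _ _ K A tau) => //; exact: normc_ge0.
rewrite ge0_integralZl//; last 3 first.
- exact: measurable_powR_normc.
- by move=> x _; rewrite lee_fin powR_ge0.
- by rewrite lee_fin mulr_ge0// powR_ge0.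
rewrite -/(pint mu p f) fA -EFinM lee_fin -mulrA ler_wpM2l//.
rewrite -[X in _ * X]powRr1 ?(ltW A0)// -powRD.
  by rewrite /b subrK.
by apply/implyP => _; rewrite gt_eqF.
Qed.

End pitt.

(** * Plancherel pairing, duality and completeness *)

Section pairing.
Context {d : measure_display} {T : measurableType d} {R : realType}.
Variable mu : {measure set T -> \bar R}.
Implicit Types (f g u v w : T -> R[i]) (E : set T).
Local Notation nc := (@Normc.normc R).

Definition ip u v : R := \int[mu]_x rdot (u x) (v x).

(** [ip] takes a default value when the integral is infinite or undefined, so its additivity carries
    this condition. *)
Definition ip_integrable u v :=
  mu.-integrable setT (EFin \o (fun x => rdot (u x) (v x))).

Lemma le_ip_integrable u v (b : T -> R) : cmeasurable u -> cmeasurable v ->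
  measurable_fun setT b -> (forall x, 0 <= b x) ->
  {ae mu, forall x, nc (u x) * nc (v x) <= b x} ->
  (\int[mu]_x (b x)%:E < +oo)%E ->
  ip_integrable u v /\ ((`|ip u v|)%:E <= \int[mu]_x (b x)%:E)%E.
Proof.
move=> mu_ mv mb b0 uvb bfin.
have mr := measurable_rdot mu_ mv.
have le : (\int[mu]_x `|(rdot (u x) (v x))%:E| <= \int[mu]_x (b x)%:E)%E.
  apply: ae_ge0_le_integral => //.
  - by apply: measurableT_comp => //; exact/measurable_EFinP.
  - by move=> x _; rewrite lee_fin.
  - exact/measurable_EFinP.
  apply: filterS uvb => x uvx _; rewrite abse_EFin lee_fin.
  exact: le_trans (normr_rdot _ _) uvx.
have i : ip_integrable u v.
  apply/integrableP; split; first exact/measurable_EFinP.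
  exact: le_lt_trans le bfin.
split => //; apply: le_trans le.
rewrite /ip EFin_normr_Rintegral//.
by apply: le_abse_integral => //; exact/measurable_EFinP.
Qed.

Lemma ip_integrable2 u v : inL mu 2%:E u -> inL mu 2%:E v -> ip_integrable u v.
Proof.
move=> /inL2P[mu_ u2] /inL2P[mv v2].
have mn (f : T -> R[i]) : cmeasurable f -> measurable_fun setT (fun x => nc (f x) ^+ 2).
  by move=> mf; apply: measurable_funX; exact: cmeasurable_normc.
apply: (@le_ip_integrable u v (fun x => nc (u x) ^+ 2 + nc (v x) ^+ 2) _ _ _ _ _ _).1 => //.
- by apply: measurable_funD; exact: mn.
- by move=> x; rewrite addr_ge0 ?sqr_ge0.
- apply: aeW => x; have := sqr_ge0 (nc (u x) - nc (v x)); rewrite sqrrB.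
  by have := mulr_ge0 (normc_ge0 (u x)) (normc_ge0 (v x)); lra.
under eq_integral do rewrite EFinD.
rewrite ge0_integralD//; last 4 first.
- by move=> x _; rewrite lee_fin sqr_ge0.
- exact/measurable_EFinP/mn.
- by move=> x _; rewrite lee_fin sqr_ge0.
- exact/measurable_EFinP/mn.
by rewrite lte_add_pinfty// -pint2E.
Qed.

Lemma ipD u v w : ip_integrable u w -> ip_integrable v w ->
  ip (fun x => u x + v x) w = ip u w + ip v w.
Proof.
move=> iu iv; rewrite /ip -RintegralD//.
by apply: eq_Rintegral => x _; rewrite rdotDl.
Qed.

Lemma ip_integrableD u v w : ip_integrable u w -> ip_integrable v w ->
  ip_integrable (fun x => u x + v x) w.
Proof.
move=> iu iv; have := integrableD measurableT iu iv.
by apply: eq_integrable => // x _ /=; rewrite rdotDl.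
Qed.

Lemma ipB u v w : ip_integrable u w -> ip_integrable v w ->
  ip (fun x => u x - v x) w = ip u w - ip v w.
Proof.
move=> iu iv; rewrite /ip -RintegralB//.
by apply: eq_Rintegral => x _; rewrite rdotBl.
Qed.

Lemma ip_integrableB u v w : ip_integrable u w -> ip_integrable v w ->
  ip_integrable (fun x => u x - v x) w.
Proof.
move=> iu iv; have := integrableB measurableT iu iv.
by apply: eq_integrable => // x _ /=; rewrite rdotBl.
Qed.

Lemma ae_ip_integrable u v u' v' : cmeasurable u -> cmeasurable v ->
  cmeasurable u' -> cmeasurable v' -> aeq mu u u' -> aeq mu v v' ->
  ip_integrable u v -> ip_integrable u' v' /\ ip u' v' = ip u v.
Proof.
move=> mu_ mv mu' mv' uu' vv' i.
have m1 := measurable_rdot mu_ mv; have m2 := measurable_rdot mu' mv'.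
have e : {ae mu, forall x, rdot (u x) (v x) = rdot (u' x) (v' x)}.
  by apply: filterS2 uu' vv' => x -> ->.
split; last first.
  rewrite /ip /Rintegral; congr fine; apply: ae_eq_integral => //.
  - exact/measurable_EFinP.
  - exact/measurable_EFinP.
  by apply: filterS e => x ->.
apply/integrableP; split; first exact/measurable_EFinP.
have /integrableP[_] := i; congr (_ < _)%E; apply: ae_eq_integral => //.
- by apply: measurableT_comp => //; exact/measurable_EFinP.
- by apply: measurableT_comp => //; exact/measurable_EFinP.
by apply: filterS e => x /= ->.
Qed.

Lemma ip_polar u v : inL mu 2%:E u -> inL mu 2%:E v ->
  2 * ip u v = fine (pint mu 2 (fun x => u x + v x)) - fine (pint mu 2 u)
    - fine (pint mu 2 v).
Proof.
move=> u2 v2; have uv2 : inL mu 2%:E (fun x => u x + v x) by apply: inLD; rewrite ?ler1n.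
have i f : inL mu 2%:E f -> mu.-integrable setT (EFin \o (fun x => nc (f x) ^+ 2)).
  move=> /inL2P[mf f2]; apply/integrableP; split.
    by apply/measurable_EFinP; apply: measurable_funX; exact: cmeasurable_normc.
  under eq_integral do rewrite /= ger0_norm ?sqr_ge0//.
  by rewrite -pint2E.
have fE f : fine (pint mu 2 f) = \int[mu]_x (nc (f x) ^+ 2) by rewrite pint2E.
rewrite !fE -RintegralB//; [|exact: i..].
rewrite -RintegralB//; [|exact: (integrableB measurableT (i _ uv2) (i _ u2))|exact: i].
rewrite /ip -RintegralZl//; last exact: ip_integrable2.
by apply: eq_Rintegral => x _; rewrite rdot_polar.
Qed.

Variable F : (T -> R[i]) -> (T -> R[i]).
Hypothesis Funi : unitary_L2 mu F.

(** An additive map that preserves the norm preserves the real pairing, by polarisation. *)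
Lemma plancherel u v : inL mu 2%:E u -> inL mu 2%:E v -> ip (F u) (F v) = ip u v.
Proof.
move=> u2 v2.
have uv2 : inL mu 2%:E (fun x => u x + v x) by apply: inLD; rewrite ?ler1n.
have Fu2 := inL2_unitary Funi u2; have Fv2 := inL2_unitary Funi v2.
have Fuv2 : inL mu 2%:E (fun x => F u x + F v x) by apply: inLD; rewrite ?ler1n.
have two : (2 : R) != 0 by rewrite pnatr_eq0.
apply: (mulfI two); rewrite (ip_polar Fu2 Fv2) (ip_polar u2 v2).
rewrite (pint2_unitary Funi u2) (pint2_unitary Funi v2).
have -> : pint mu 2 (fun x => F u x + F v x) = pint mu 2 (F (fun x => u x + v x)).
  have [mFuv _] := Fuv2; have [mF' _] := inL2_unitary Funi uv2.
  have e := unitaryD Funi u2 v2.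
  by apply/eqP; rewrite eq_le; apply/andP; split; apply: le_pint => //;
    apply: filterS e => x ->.
by rewrite (pint2_unitary Funi uv2).
Qed.

Local Notation Finv := (inverse_L2 mu F).

Lemma inverse_L2P w : inL mu 2%:E w -> inL mu 2%:E (Finv w) /\ aeq mu (F (Finv w)) w.
Proof.
move=> w2; have [_ _ /(_ w w2)[u u2 uw]] := Funi.
rewrite /inverse_L2; case: xgetP => [y _ []|/(_ u)[]]//; by [].
Qed.

(** The inverse of a unitary operator is its adjoint: w is F (Finv w) almost everywhere, and
    [plancherel] removes F. *)
Lemma ip_inverse w v : inL mu 2%:E w -> inL mu 2%:E v -> ip (Finv w) v = ip w (F v).
Proof.
move=> w2 v2; have [iw2 e] := inverse_L2P w2.
rewrite -(plancherel iw2 v2).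
have Fv2 := inL2_unitary Funi v2; have Fiw2 := inL2_unitary Funi iw2.
have [] // := @ae_ip_integrable (F (Finv w)) (F v) w (F v).
- by case: Fiw2.
- by case: Fv2.
- by case: w2.
- by case: Fv2.
- by apply: aeW.
- exact: ip_integrable2.
Qed.

End pairing.

(** * Tails of integrals and truncations *)

Section tails.
Context {d : measure_display} {T : measurableType d} {R : realType}.
Variable mu : {measure set T -> \bar R}.

Lemma measurable_tail (r : T -> R) (t : R) : measurable_fun setT r ->
  measurable [set x | t < r x].
Proof.
move=> mr; rewrite (_ : [set x | t < r x] = ~` [set x | r x <= t]).
  apply: measurableC; rewrite -[X in measurable X]setTI.
  exact: measurable_fun_le.
by apply/seteqP; split => x /=; rewrite ltNge => /negP.
Qed.

(** Dominated convergence, since the sets {r > n} shrink to the empty set. With r = |f| it shows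
    that truncations converge, with r = |h| that the high part of the symbol is negligible. *)
Lemma integral_tail (r g : T -> R) : measurable_fun setT r ->
  measurable_fun setT g -> (forall x, 0 <= g x) -> (\int[mu]_x (g x)%:E < +oo)%E ->
  (\int[mu]_(x in [set x | (n%:R < r x)%R]) (g x)%:E)%E @[n --> \oo] --> 0%E.
Proof.
move=> mr mg g0 gfin.
pose h n x := (g x * \1_([set x | n%:R < r x]) x)%:E.
have gi : mu.-integrable setT (EFin \o g).
  apply/integrableP; split; first exact/measurable_EFinP.
  by under eq_integral do rewrite /= ger0_norm//.
have [] := @dominated_convergence _ T R mu setT measurableT h (cst 0%E) (EFin \o g).
- move=> n; apply/measurable_EFinP; apply: measurable_funM => //.
  by apply: measurable_indic; exact: measurable_tail.
- by [].
- apply: aeW => x _; apply: cvg_near_cst.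
  have /archi_boundP hb : 0 <= `|r x| by [].
  exists (Num.bound `|r x|) => // n /= hn.
  rewrite /h indicE memNset ?mulr0//= => /lt_geF/negP; apply.
  apply: le_trans (ler_norm _) _; apply: (le_trans (ltW hb)).
  by rewrite ler_nat.
- exact: gi.
- apply: aeW => x n _; rewrite /h abse_EFin lee_fin ger0_norm ?mulr_ge0//.
  by rewrite indicE; case: (_ \in _); rewrite ?mulr1// mulr0.
move=> _ _; rewrite integral0; apply: cvg_trans; apply: near_eq_cvg.
apply: nearW => n; rewrite [RHS]integral_mkcond; apply: eq_integral => x _.
rewrite patchE /h indicE; case: ifPn => _; by rewrite ?mulr1 ?mulr0.
Qed.

End tails.

Lemma cvge0_lt (R : realType) (u : (\bar R)^nat) (e : R) : 0 < e ->
  u n @[n --> \oo] --> 0%E -> \forall n \near \oo, (u n < e%:E)%E.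
Proof. by move=> e0 /(_ _ (@nbhs_open_ereal_lt R 0 (fun=> e) e0)). Qed.

Section truncation.
Context {d : measure_display} {T : measurableType d} {R : realType}.
Variable mu : {measure set T -> \bar R}.
Implicit Types (f g u v w : T -> R[i]) (E : set T).
Local Notation nc := (@Normc.normc R).

(** A bounded function gains integrability: |f|^r <= M^(r - p) |f|^p. *)
Lemma inL_bounded p r M f : 0 < p -> p <= r -> 0 <= M ->
  (forall x, nc (f x) <= M) -> inL mu p%:E f -> inL mu r%:E f.
Proof.
move=> p0 pr M0 fM /inLE-/(_ p0)[mf fp].
have r0 : 0 < r by exact: lt_le_trans pr.
apply/inLE => //; split => //.
apply: (@le_lt_trans _ _ ((M `^ (r - p))%:E * pint mu p f)%E); last first.
  by rewrite lte_mul_pinfty// lee_fin powR_ge0.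
rewrite -ge0_integralZl//; last 3 first.
- exact: measurable_powR_normc.
- by move=> x _; rewrite lee_fin powR_ge0.
- by rewrite lee_fin powR_ge0.
apply: ge0_le_integral => //.
- by move=> x _; rewrite lee_fin powR_ge0.
- exact: measurable_powR_normc.
- by apply: measurable_funeM; exact: measurable_powR_normc.
move=> x _; rewrite -EFinM lee_fin.
have [->|x0] := eqVneq (nc (f x)) 0.
  by rewrite powR0 ?gt_eqF// mulr_ge0// powR_ge0.
rewrite -{1}(subrK p r) powRD; last by apply/implyP.
rewrite ler_wpM2r ?powR_ge0//.
by apply: ge0_ler_powR; rewrite ?nnegrE ?normc_ge0 ?subr_ge0.
Qed.

(** Values larger than n are dropped rather than clipped, so the error is f itself on {|f| > n}. The
    truncation of an L^p function lies in every L^r with r >= p. *)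
Definition trunc (n : nat) f := crestr (~` [set x | n%:R < nc (f x)]) f.

Lemma measurable_high n f : cmeasurable f -> measurable [set x | (n%:R < nc (f x))%R].
Proof. by move=> mf; apply: measurable_tail; exact: cmeasurable_normc. Qed.

Lemma inL_trunc p r n f : 0 < p -> p <= r -> inL mu p%:E f ->
  inL mu p%:E (trunc n f) /\ inL mu r%:E (trunc n f).
Proof.
move=> p0 pr fp; have [mf _] := fp.
have h : inL mu p%:E (trunc n f).
  by apply: inL_crestr => //; [exact: ltW|apply: measurableC; exact: measurable_high].
split => //; apply: (@inL_bounded p r n%:R) => // x.
rewrite /trunc /crestr; case: ifPn; last by rewrite Normc.normc0.
by rewrite inE/= leNgt => /negP.
Qed.

Lemma pint_trunc_cvg p f : 0 < p -> inL mu p%:E f ->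
  pint mu p (fun x => trunc n f x - f x) @[n --> \oo] --> 0%E.
Proof.
move=> p0 /inLE-/(_ p0)[mf fp].
have mn := cmeasurable_normc mf.
have mp : measurable_fun setT (fun x => nc (f x) `^ p).
  exact: (measurableT_comp (measurable_powR _)).
have := integral_tail mn mp (fun x => powR_ge0 _ _) fp.
apply: cvg_trans; apply: near_eq_cvg; apply: nearW => n.
rewrite integral_mkcond /pint; apply: eq_integral => x _.
rewrite patchE /trunc /crestr in_setC; case: ifPn => _ /=.
  by rewrite sub0r normc_opp.
by rewrite subrr Normc.normc0 powR0// gt_eqF.
Qed.

Lemma cLnorm_lt p f (e : R) : 0 < p -> 0 < e ->
  (pint mu p f < (e `^ p)%:E)%E -> (cLnorm mu p%:E f < e%:E)%E.
Proof.
move=> p0 e0; have := pint_ge0 mu p f; rewrite cLnormE.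
case: (pint mu p f) => [r| |]//; rewrite lee_fin lte_fin => r0 re.
rewrite poweR_EFin lte_fin.
have -> : e = (e `^ p) `^ p^-1 by rewrite -powRrM mulfV ?gt_eqF// powRr1// ltW.
by apply: gt0_ltr_powR; rewrite ?invr_gt0 ?nnegrE// powR_ge0.
Qed.

Lemma trunc_near p f (e : R) : 0 < p -> 0 < e -> inL mu p%:E f ->
  \forall n \near \oo, (cLnorm mu p%:E (fun x => (trunc n f x - f x)%R) < e%:E)%E.
Proof.
move=> p0 e0 fp; have := cvge0_lt (powR_gt0 p e0) (pint_trunc_cvg p0 fp).
by apply: filterS => n; exact: cLnorm_lt.
Qed.

End truncation.

(** * Pairings with the extension of the inverse to L^1 + L^2 *)

Section L1L2_pairing.
Context {d : measure_display} {T : measurableType d} {R : realType}.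
Variable mu : {measure set T -> \bar R}.
Implicit Types (f g u v w G : T -> R[i]) (E : set T).
Local Notation nc := (@Normc.normc R).
Variables (F : (T -> R[i]) -> (T -> R[i])) (K : R).
Hypotheses (Funi : unitary_L2 mu F) (FK : L1_bounded mu F K) (K0 : 0 <= K).
Local Notation Finv := (inverse_L2 mu F).

Lemma ae_le_cLnormy f (e : R) : (cLnorm mu +oo%E f <= e%:E)%E ->
  {ae mu, forall x, nc (f x) <= e}.
Proof.
(* The norm at +oo is guarded by 0 < mu setT; on a space of measure zero every property holds almost
   everywhere. *)
rewrite /cLnorm unlock; case: ifPn => [_ /ess_supP|]; last first.
  rewrite -leNgt => mu0 _; apply: measure0_ae; apply/eqP.
  by rewrite eq_le mu0 measure_ge0.
by apply: filterS => x; rewrite /= lee_fin ger0_norm// normc_ge0.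
Qed.

Lemma ip_integrable_Loo_L1 u v (e : R) : cmeasurable u -> inL mu 1%:E v -> 0 <= e ->
  {ae mu, forall x, nc (u x) <= e} ->
  ip_integrable mu u v /\ `|ip mu u v| <= e * fine (pint mu 1 v).
Proof.
move=> mu_ /inL1P[mv v1] e0 ue.
have vE : (\int[mu]_x (e * nc (v x))%:E = e%:E * pint mu 1 v)%E.
  under eq_integral do rewrite EFinM.
  rewrite pint1E ge0_integralZl//.
  - by apply/measurable_EFinP; exact: cmeasurable_normc.
  - by move=> x _; rewrite lee_fin normc_ge0.
have [] := @le_ip_integrable _ _ _ mu u v (fun x => e * nc (v x)) mu_ mv.
- by apply: measurable_funM => //; exact: cmeasurable_normc.
- by move=> x; rewrite mulr_ge0// normc_ge0.
- by apply: filterS ue => x ux; rewrite ler_wpM2r// normc_ge0.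
- by rewrite vE lte_mul_pinfty.
move=> i; rewrite vE => h; split => //; rewrite -lee_fin EFinM fineK//.
by rewrite ge0_fin_numE ?pint_ge0.
Qed.

Lemma ip_sym u v : ip mu u v = ip mu v u.
Proof.
by apply: eq_Rintegral => x _; rewrite /rdot [X in X + _]mulrC [X in _ + X]mulrC.
Qed.

Lemma ip_integrable_sym u v : ip_integrable mu u v -> ip_integrable mu v u.
Proof.
apply: eq_integrable => // x _ /=.
by rewrite /rdot [X in X + _]mulrC [X in _ + X]mulrC.
Qed.

(** For the truncations of g1, which lie in L^1 and L^2, this is the adjointness of the inverse.
    Both sides pass to the limit: the left one since the images converge uniformly to w and g is in
    L^1, the right one since the truncations converge in L^1 and F g is bounded by K ||g||_1. *)
Lemma ip_L1_extension g1 w g : inL mu 1%:E g1 -> L1_extension mu Finv g1 w ->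
  inL mu 1%:E g -> inL mu 2%:E g ->
  [/\ ip_integrable mu w g, ip_integrable mu g1 (F g) & ip mu w g = ip mu g1 (F g)].
Proof.
move=> g11 [mw ext] g_1 g_2.
have [mg1 _] := g11.
have Fg2 := inL2_unitary Funi g_2; have [mFg _] := Fg2.
have le12 : (1 : R) <= 2 by rewrite ler1n.
pose kg := K * fine (pint mu 1 g).
have kg0 : 0 <= kg by rewrite mulr_ge0// fine_ge0// pint_ge0.
have Fgk : {ae mu, forall x, nc (F g x) <= kg} by exact: FK.
have u12 n := inL_trunc n ltr01 le12 g11.
have cu : cLnorm mu 1%:E (fun x => trunc n g1 x - g1 x) @[n --> \oo] --> 0%E.
  have := pint_trunc_cvg ltr01 g11; apply: cvg_trans; apply: near_eq_cvg.
  by apply: nearW => n; rewrite cLnormE invr1 poweRe1// pint_ge0.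
have cw := ext _ u12 cu.
have i1 : ip_integrable mu g1 (F g).
  by apply: ip_integrable_sym; apply: (ip_integrable_Loo_L1 mFg g11 kg0 Fgk).1.
have main (e : R) : 0 < e -> ip_integrable mu w g /\
    `|ip mu w g - ip mu g1 (F g)| <= e * (fine (pint mu 1 g) + kg).
  move=> e0.
  have [n] := @filter_ex _ _ _ _ (filterI (cvge0_lt e0 cu) (cvge0_lt e0 cw)).
  move=> [/= h1 h2].
  have un2 := (u12 n).2; have [Fun2 _] := inverse_L2P Funi un2.
  have mFun : cmeasurable (Finv (trunc n g1)) by case: Fun2.
  have [i3 b3] := ip_integrable_Loo_L1 (cmeasurableB mFun mw) g_1 (ltW e0) (ae_le_cLnormy (ltW h2)).
  have i4 : ip_integrable mu (Finv (trunc n g1)) g by exact: ip_integrable2.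
  (* The function w differs from one in L^2 by a bounded one, and g lies in both L^2 and L^1. *)
  have iw : ip_integrable mu w g.
    have := ip_integrableB i4 i3; apply: eq_integrable => // x _ /=.
    by rewrite opprB addrC subrK.
  split => //.
  have i5 : ip_integrable mu (trunc n g1) (F g) by exact: ip_integrable2.
  have d1 : inL mu 1%:E (fun x => trunc n g1 x - g1 x) by apply: inLB => //; exact: (u12 n).1.
  have [i6 b6] := ip_integrable_Loo_L1 mFg d1 kg0 Fgk.
  rewrite ipB// in b3.
  rewrite ip_sym ipB// in b6.
  have e4 : ip mu (Finv (trunc n g1)) g = ip mu (trunc n g1) (F g) by exact: ip_inverse.
  have b7 : fine (pint mu 1 (fun x => trunc n g1 x - g1 x)) <= e.
    have [_ dfin] := inL1P d1.
    rewrite -lee_fin fineK ?ge0_fin_numE ?pint_ge0//.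
    by move: h1; rewrite cLnormE invr1 poweRe1 ?pint_ge0// => /ltW.
  have -> : ip mu w g - ip mu g1 (F g) =
    (ip mu (trunc n g1) (F g) - ip mu g1 (F g)) - (ip mu (Finv (trunc n g1)) g - ip mu w g).
    by rewrite e4; ring.
  apply: (le_trans (ler_normB _ _)); rewrite mulrDr addrC; apply: lerD => //.
  by apply: (le_trans b6); rewrite mulrC ler_wpM2r.
split => //; first exact: (main 1 ltr01).1.
apply/eqP; rewrite -subr_eq0 -normr_le0; apply/ler_addgt0Pr => e e0; rewrite add0r.
set s := fine (pint mu 1 g) + kg in main.
have s0 : 0 <= s by rewrite addr_ge0// fine_ge0// pint_ge0.
have s1 : 0 < s + 1 by rewrite ltr_wpDl.
have [_] := main (e / (s + 1)) (divr_gt0 e0 s1); move/le_trans; apply.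
by rewrite -mulrA ler_piMr ?(ltW e0)// mulrC ler_pdivrMr// mul1r lerDl.
Qed.

(** The adjoint identities for the L^1 part and the L^2 part of G add up. The result mentions G
    alone and no decomposition of it; from here on A f is seen only through such pairings. *)
Lemma ip_L1L2_extension G v g : cmeasurable G -> cmeasurable v ->
  L1L2_extension mu Finv G v -> inL mu 1%:E g -> inL mu 2%:E g ->
  [/\ ip_integrable mu v g, ip_integrable mu G (F g) & ip mu v g = ip mu G (F g)].
Proof.
move=> mG mv [g1 [g2 [w [g11 g22 Ge ext ve]]]] g_1 g_2.
have [mg _] := g_1.
have Fg2 := inL2_unitary Funi g_2; have [mFg _] := Fg2.
have [mg1 _] := g11; have [mg2 _] := g22; have [mw _] := ext.
have [iw i1 e1] := ip_L1_extension g11 ext g_1 g_2.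
have [Fg22 _] := inverse_L2P Funi g22; have [mFg22 _] := Fg22.
have i2 : ip_integrable mu (Finv g2) g by exact: ip_integrable2.
have i3 : ip_integrable mu g2 (F g) by exact: ip_integrable2.
have e2 : ip mu (Finv g2) g = ip mu g2 (F g) by exact: ip_inverse.
have aesym (a b : T -> R[i]) : aeq mu a b -> aeq mu b a by apply: filterS => x ->.
have aerefl (a : T -> R[i]) : aeq mu a a by apply: aeW.
have [] := ae_ip_integrable (cmeasurableD mw mFg22) mg mv mg (aesym _ _ ve) (aerefl _) (ip_integrableD iw i2).
have [] := ae_ip_integrable (cmeasurableD mg1 mg2) mFg mG mFg (aesym _ _ Ge) (aerefl _) (ip_integrableD i1 i3).
move=> iG eG iv ev; split => //.
by rewrite ev eG !ipD// e1 e2.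
Qed.

End L1L2_pairing.

(** * The L^q norm by duality *)

Section duality.
Context {d : measure_display} {T : measurableType d} {R : realType}.
Variable mu : {measure set T -> \bar R}.
Implicit Types (f g u v w : T -> R[i]) (E : set T).
Local Notation nc := (@Normc.normc R).

Lemma inL_bounded_support r M E g : 0 < r -> 0 <= M -> measurable E -> (mu E < +oo)%E ->
  cmeasurable g -> (forall x, nc (g x) <= M * \1_E x) -> inL mu r%:E g.
Proof.
move=> r0 M0 mE Efin mg gM; apply/inLE => //; split => //.
apply: (@le_lt_trans _ _ (\int[mu]_x ((M `^ r)%:E * (\1_E x)%:E))%E).
  apply: ge0_le_integral => //.
  - by move=> x _; rewrite lee_fin powR_ge0.
  - exact: measurable_powR_normc.
  - by apply: measurable_funeM; apply/measurable_EFinP; exact: measurable_indic.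
  move=> x _; rewrite -EFinM lee_fin.
  have -> : \1_E x = \1_E x `^ r :> R.
    by rewrite indicE; case: (_ \in _); rewrite ?powR1// powR0// gt_eqF.
  rewrite -powRM//.
  by apply: ge0_ler_powR; rewrite ?nnegrE ?normc_ge0 ?mulr_ge0// ltW.
rewrite ge0_integralZl//; last 2 first.
- exact/measurable_EFinP/measurable_indic.
- by rewrite lee_fin powR_ge0.
by rewrite integral_indic// setIT lte_mul_pinfty// lee_fin powR_ge0.
Qed.

(** Converse of the Hoelder inequality, tested on |v|^(q - 2) v. Cutting to sets [B n] of finite
    measure on which |v| <= n puts the test function in every L^r and makes I, the integral of |v|^q
    over [B n], finite, so that I <= Q I^(1/q') can be divided by I^(1/q'). The sets [B n] increase
    to the whole space. *)
Lemma dual_cLnorm_le q Q v : sigma_finite setT mu -> 2 <= q -> 0 <= Q ->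
  cmeasurable v ->
  (forall g, inL mu 1%:E g -> inL mu 2%:E g -> inL mu (1 - q^-1)^-1%:E g ->
    `|ip mu v g| <= Q * fine (cLnorm mu (1 - q^-1)^-1%:E g)) ->
  (cLnorm mu q%:E v <= Q%:E)%E.
Proof.
move=> /sigma_finiteP[A [TA ndA Afin]] q2 Q0 mv H.
set q' := (1 - q^-1)^-1 in H *.
have q0 : 0 < q by apply: lt_le_trans q2.
have q1 : 1 < q by apply: lt_le_trans q2; rewrite ltr1n.
have iq1 : 0 < 1 - q^-1 by rewrite subr_gt0 invf_lt1.
have q'0 : 0 < q' by rewrite invr_gt0.
have mn := cmeasurable_normc mv.
pose B n := A n `&` [set x | nc (v x) <= n%:R].
have mB n : measurable (B n).
  apply: measurable_fun_le => //; [by have [] := Afin n|exact: measurable_funTS].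
have Bfin n : (mu (B n) < +oo)%E.
  have [mA] := Afin n; apply: le_lt_trans; apply: le_measure; rewrite ?inE//.
  exact: subIsetl.
have ndB : {homo B : n m / (n <= m)%N >-> (n <= m)%O}.
  move=> n m nm; apply/subsetPset => x [Anx /= vx]; split.
    by move: Anx; apply/subsetPset; exact: ndA.
  by rewrite /= (le_trans vx)// ler_nat.
have UB : \bigcup_n B n = setT.
  apply/seteqP; split => // x _.
  have [i _ Ai] : (\bigcup_i A i) x by rewrite -TA.
  have /archi_boundP hb := normc_ge0 (v x).
  exists (maxn i (Num.bound (nc (v x)))) => //; split => /=.
    by move: Ai; apply/subsetPset; apply: ndA; exact: leq_maxl.
  by rewrite (le_trans (ltW hb))// ler_nat leq_maxr.
have mp : measurable_fun setT (fun x => (nc (v x) `^ q)%:E) by exact: measurable_powR_normc.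
suff bound n : (\int[mu]_(x in B n) (nc (v x) `^ q)%:E <= (Q `^ q)%:E)%E.
  have vQ : (pint mu q v <= (Q `^ q)%:E)%E.
    rewrite /pint -UB.
    apply: (@cvge_to_le _ \oo _ _ (fun n => \int[mu]_(x in B n) (nc (v x) `^ q)%:E)%E).
      apply: ge0_nondecreasing_set_cvg_integral => //.
      - by move=> i; exact: measurable_funTS.
      - by move=> i x _; rewrite lee_fin powR_ge0.
    by apply: nearW.
  rewrite cLnormE (_ : Q%:E = ((Q `^ q)%:E `^ q^-1)%E); last first.
    by rewrite poweR_EFin -powRrM mulfV ?gt_eqF// powRr1.
  apply: gt0_ler_poweR => //.
  - by rewrite invr_ge0 ltW.
  - by rewrite in_itv/= pint_ge0 leey.
  - by rewrite in_itv/= lee_fin powR_ge0 leey.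
pose g x := ((\1_(B n) x * nc (v x) `^ (q - 2))%:C)%C * v x.
have mg : cmeasurable g.
  apply: cmeasurableM => //; apply: cmeasurable_real; apply: measurable_funM.
    exact: measurable_indic.
  exact: (measurableT_comp (measurable_powR _)).
have gE x : nc (g x) = \1_(B n) x * nc (v x) `^ (q - 1).
  rewrite Normc.normcM normc_real ger0_norm; last first.
    by rewrite mulr_ge0 ?powR_ge0// indicE ler0n.
  rewrite -mulrA; congr (_ * _).
  have [->|x0] := eqVneq (nc (v x)) 0.
    by rewrite mulr0 powR0// subr_eq0 gt_eqF.
  rewrite -[X in _ * X]powRr1 ?normc_ge0// -powRD; last by apply/implyP.
  by congr (_ `^ _); ring.
have gM x : nc (g x) <= n%:R `^ (q - 1) * \1_(B n) x.
  rewrite gE mulrC indicE; case: (boolP (_ \in _)) => [|_]; last by rewrite !mulr0.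
  rewrite inE !mulr1 => -[_ /= vn].
  by apply: ge0_ler_powR; rewrite ?nnegrE ?normc_ge0// subr_ge0 ltW.
have gL r : 0 < r -> inL mu r%:E g.
  by move=> r0; apply: (inL_bounded_support r0 _ (mB n) (Bfin n) mg gM); exact: powR_ge0.
(* The exponents are conjugate: (q - 1) q' = q. *)
have gq' : pint mu q' g = (\int[mu]_(x in B n) (nc (v x) `^ q)%:E)%E.
  rewrite integral_mkcond; apply: eq_integral => x _; rewrite gE patchE indicE.
  case: ifPn => _; last by rewrite mul0r powR0// gt_eqF.
  rewrite mul1r -powRrM; congr (_ `^ _)%:E.
  by rewrite /q'; field; rewrite gt_eqF//= subr_eq0 gt_eqF.
have [_ gfin] : cmeasurable g /\ (pint mu q' g < +oo)%E by apply/inLE => //; exact: gL.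
pose I := fine (pint mu q' g).
have IE : pint mu q' g = I%:E by rewrite fineK// ge0_fin_numE ?pint_ge0.
have I0 : 0 <= I by rewrite fine_ge0 ?pint_ge0.
have ipE : ip mu v g = I.
  rewrite /I gq' /ip /Rintegral [in RHS]integral_mkcond; congr fine; apply: eq_integral => x _.
  rewrite /g rdotZr rdotxx patchE indicE; case: ifPn => _; last by rewrite !mul0r.
  rewrite mul1r; congr _%:E.
  have [->|x0] := eqVneq (nc (v x)) 0.
    by rewrite expr0n/= mulr0 powR0// gt_eqF.
  by rewrite -powR_mulrn ?normc_ge0// -powRD ?subrK//; apply/implyP.
have := H g (gL _ ltr01) (gL _ (ltr0n _ 2)) (gL _ q'0).
rewrite ipE ger0_norm// cLnormE IE poweR_EFin /= => hI.
rewrite -gq' IE lee_fin.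
have [->|In0] := eqVneq I 0; first exact: powR_ge0.
have I1 : 0 < I by rewrite lt_neqAle eq_sym In0.
have IQ : I `^ q^-1 <= Q.
  have e : I = I `^ q^-1 * I `^ q'^-1.
    by rewrite -powRD ?In0 ?implybT// invrK addrC subrK powRr1.
  by move: hI; rewrite {1}e ler_pM2r ?powR_gt0.
have -> : I = (I `^ q^-1) `^ q by rewrite -powRrM mulVf ?gt_eqF// powRr1.
by apply: ge0_ler_powR; rewrite ?nnegrE ?powR_ge0// ltW.
Qed.

End duality.

(** * Completeness of L^q *)

Section real_sequences.
Variable R : realType.

(** Telescoping turns the sequence into an absolutely convergent series. *)
Lemma cvgn_bounded_variation (a : R^nat) (M : R) :
  (forall N, \sum_(n < N) `|a n.+1 - a n| <= M) -> cvgn a.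
Proof.
move=> aM; rewrite (_ : a = fun n => a 0%N + series (telescope a) n); last first.
  by apply/funext => n; rewrite eq_sum_telescope.
apply: is_cvgD; first exact: is_cvg_cst.
apply: normed_cvg; apply: nondecreasing_is_cvgn.
  by apply: nondecreasing_series => n _ _; exact: normr_ge0.
by exists M => _ [N _ <-]; have := aM N; rewrite -(big_mkord xpredT (fun n => `|a n.+1 - a n|)).
Qed.

Lemma limn_einf_ge0 (u : (\bar R)^nat) : (forall n, 0 <= u n)%E -> (0 <= limn_einf u)%E.
Proof.
move=> u0; rewrite limn_einf_lim; apply: lime_ge; first exact: is_cvg_einfs.
by apply: nearW => n; apply: le_ereal_inf_tmp => _ [m _ <-].
Qed.

(** For l > 0 the power is differentiable at l, hence continuous there; for l = 0 the left-hand side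
    is 0 and positivity suffices. *)
Lemma powR_le_limn_einf (q : R) (z : R^nat) (l : R) : 0 < q -> 0 <= l -> (forall n, 0 <= z n) ->
  z n @[n --> \oo] --> l -> ((l `^ q)%:E <= limn_einf (fun n => (z n `^ q)%:E))%E.
Proof.
move=> q0 l0 z0 zl; move: l0; rewrite le_eqVlt => /orP[/eqP <-|l0].
  rewrite powR0 ?gt_eqF//; apply: limn_einf_ge0 => n.
  by rewrite lee_fin powR_ge0.
have c : {for l, continuous (fun x : R => x `^ q)}.
  apply: differentiable_continuous; apply/derivable1_diffP.
  by have [] := is_derive1_powR q l0.
have : (fun n => (z n `^ q)%:E) @ \oo --> (l `^ q)%:E.
  by apply: cvg_EFin; [exact: nearW|exact: (continuous_cvg _ c zl)].
by move=> /cvg_limn_einf_sup[-> _].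
Qed.

End real_sequences.

Section completeness.
Context {d : measure_display} {T : measurableType d} {R : realType}.
Variable mu : {measure set T -> \bar R}.
Implicit Types (f g v w : T -> R[i]) (u : nat -> T -> R[i]) (E : set T) (q : R).
Local Notation nc := (@Normc.normc R).

Lemma fatou_pint q u v (M : \bar R) : 0 < q -> (forall n, cmeasurable (u n)) ->
  cmeasurable v ->
  {ae mu, forall x, nc (u n x - v x) @[n --> \oo] --> 0} ->
  (\forall n \near \oo, (pint mu q (u n) <= M)%E) -> (pint mu q v <= M)%E.
Proof.
move=> q0 mu_ mv uv uM.
pose h n x := (nc (u n x) `^ q)%:E.
have mh n : measurable_fun setT (h n) by exact: measurable_powR_normc.
have h0 n x : setT x -> (0 <= h n x)%E by rewrite lee_fin powR_ge0.
apply: (@le_trans _ _ (\int[mu]_x limn_einf (h^~ x))%E).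
  apply: ae_ge0_le_integral => //.
  - by move=> x _; rewrite lee_fin powR_ge0.
  - exact: measurable_powR_normc.
  - by move=> x _; apply: limn_einf_ge0 => n; exact: h0.
  - rewrite (_ : (fun x => _) = (fun x => - limn_esup (fun n => - h n x))%E).
      apply: measurableT_comp => //; apply: measurable_fun_limn_esup => n.
      exact: measurableT_comp.
    by apply/funext => x; rewrite -limn_einfN; congr limn_einf; apply/funext => n; rewrite /comp oppeK.
  apply: filterS uv => x ux _; apply: powR_le_limn_einf => //; try exact: normc_ge0.
    by move=> n; exact: normc_ge0.
  apply/cvgrPdist_le => e e0; move/cvgrPdist_le : ux => /(_ e e0).
  apply: filterS => n; rewrite sub0r normrN (ger0_norm (normc_ge0 _)).
  by apply: le_trans; rewrite normcB_sym; exact: ler_dist_normc.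
apply: (le_trans (fatou mu measurableT mh h0)).
rewrite limn_einf_lim; apply: lime_le; first exact: is_cvg_einfs.
case: uM => N _ uM; exists N => // n /= Nn.
apply: le_trans (uM n Nn); apply: ereal_inf_lbound; exists n => //=.
Qed.

Lemma cLnorm0 q : q != 0 -> cLnorm mu q%:E (fun=> 0) = 0%E.
Proof.
move=> q0; rewrite cLnormE /pint.
under eq_integral do rewrite Normc.normc0 powR0//.
by rewrite integral0 poweR0r// invr_neq0.
Qed.

Lemma pint_le_powR q f (M : R) : 0 < q -> 0 <= M -> (cLnorm mu q%:E f <= M%:E)%E ->
  (pint mu q f <= (M `^ q)%:E)%E.
Proof.
move=> q0 M0 fM; rewrite pintE ?gt_eqF// -poweR_EFin; apply: gt0_ler_poweR => //.
- exact: ltW.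
- by rewrite in_itv/= cLnorm_ge0 leey.
- by rewrite in_itv/= lee_fin M0 leey.
Qed.

Lemma cLnorm_le_powR q f (M : R) : 0 < q -> 0 <= M -> (pint mu q f <= (M `^ q)%:E)%E ->
  (cLnorm mu q%:E f <= M%:E)%E.
Proof.
move=> q0 M0 fM; rewrite cLnormE (_ : M%:E = ((M `^ q)%:E `^ q^-1)%E); last first.
  by rewrite poweR_EFin -powRrM mulfV ?gt_eqF// powRr1.
apply: gt0_ler_poweR => //.
- by rewrite invr_ge0 ltW.
- by rewrite in_itv/= pint_ge0 leey.
- by rewrite in_itv/= lee_fin powR_ge0 leey.
Qed.

(** Riesz-Fischer. The partial sums of |u (n+1) - u n| have L^q norm at most 2, so by monotone
    convergence they are bounded almost everywhere and u converges there. The rate, which the bare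
    convergence does not give, comes from Fatou's lemma. *)
Lemma Lq_complete q u : 1 <= q -> (forall n, cmeasurable (u n)) ->
  (forall n, (cLnorm mu q%:E (fun x => (u n.+1 x - u n x)%R) <= (2^-1 ^+ n)%:E)%E) ->
  exists2 v, cmeasurable v &
    forall n, (cLnorm mu q%:E (fun x => (u n x - v x)%R) <= (2 * 2^-1 ^+ n)%:E)%E.
Proof.
move=> q1 mu_ uh.
have q0 : 0 < q by exact: lt_le_trans q1.
pose h n : R := 2^-1 ^+ n.
have h0 n : 0 <= h n by rewrite exprn_ge0// invr_ge0.
have hS n : h n = 2 * h n.+1 by rewrite /h exprS mulrA divff ?mul1r// pnatr_eq0.
have mD n m : cmeasurable (fun x => u n x - u m x) by exact: cmeasurableB.
have step1 n k : (cLnorm mu q%:E (fun x => (u (n + k)%N x - u n x)%R) <= (2 * h n - 2 * h (n + k)%N)%:E)%E.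
  elim: k => [|k IH].
    rewrite addn0 subrr; under [X in cLnorm _ _ X]eq_fun do rewrite subrr.
    by rewrite cLnorm0// gt_eqF.
  have -> : (fun x => u (n + k.+1)%N x - u n x) =
      (fun x => (u (n + k).+1 x - u (n + k)%N x) + (u (n + k)%N x - u n x)).
    by apply/funext => x; rewrite addnS addrA subrK.
  apply: (le_trans (cLnormD mu q1 (mD _ _) (mD _ _))).
  apply: (le_trans (leeD (uh _) IH)).
  by rewrite -EFinD lee_fin addnS -/(h (n + k)%N) (hS (n + k)%N); lra.
pose S N x := \sum_(n < N) nc (u n.+1 x - u n x).
have S0 N x : 0 <= S N x by apply: sumr_ge0 => n _; exact: normc_ge0.
have mS N : measurable_fun setT (S N).
  by apply: measurable_sum => n; exact: cmeasurable_normc.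
have ndS x : {homo S^~ x : n m / (n <= m)%N >-> n <= m}.
  apply/nondecreasing_seqP => n.
  by rewrite /S big_ord_recr/= lerDl normc_ge0.
have SN N : (cLnorm mu q%:E (fun x => (S N x)%:C%C) <= (2 - 2 * h N)%:E)%E.
  elim: N => [|N IH].
    rewrite /h expr0 mulr1 subrr.
    rewrite (_ : (fun x => _) = fun=> 0); first by rewrite cLnorm0// gt_eqF.
    by apply/funext => x; rewrite /S big_ord0.
  have -> : (fun x => (S N.+1 x)%:C%C) =
      (fun x => (S N x)%:C%C + (nc (u N.+1 x - u N x))%:C%C).
    by apply/funext => x; rewrite /S big_ord_recr/= rmorphD.
  have mn : cmeasurable (fun x => (nc (u N.+1 x - u N x))%:C%C).
    by apply: cmeasurable_real; exact: cmeasurable_normc.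
  apply: (le_trans (cLnormD mu q1 (cmeasurable_real (mS N)) mn)).
  have le2 : (cLnorm mu q%:E (fun x => (nc (u N.+1 x - u N x)%R)%:C%C) <= (h N)%:E)%E.
    apply: le_trans (uh N); apply: le_cLnorm => //; first exact: ltW.
    by apply: aeW => x; rewrite normc_real ger0_norm// normc_ge0.
  apply: (le_trans (leeD IH le2)).
  by rewrite -EFinD lee_fin (hS N); lra.
pose g N x := (S N x `^ q)%:E.
have gE N : (\int[mu]_x g N x <= (2 `^ q)%:E)%E.
  have -> : (\int[mu]_x g N x = pint mu q (fun x => (S N x)%:C%C))%E.
    by apply: eq_integral => x _; rewrite normc_real ger0_norm.
  apply: pint_le_powR => //; apply: (le_trans (SN N)).
  by rewrite lee_fin lerBlDr lerDl mulr_ge0.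
have mg N : measurable_fun setT (g N).
  by apply/measurable_EFinP; exact: (measurableT_comp (measurable_powR _)).
have g0 N x : setT x -> (0 <= g N x)%E by rewrite lee_fin powR_ge0.
have ndg x : setT x -> {homo g^~ x : n m / (n <= m)%N >-> (n <= m)%E}.
  move=> _ n m nm; rewrite lee_fin; apply: ge0_ler_powR; rewrite ?nnegrE//; first exact: ltW.
  exact: ndS.
have mct := monotone_convergence mu measurableT mg g0 ndg.
have cg x : cvgn (g^~ x) by apply: ereal_nondecreasing_is_cvgn => n m; exact: (ndg x I).
have limfin : (\int[mu]_x limn (g^~ x) <= (2 `^ q)%:E)%E.
  rewrite mct; apply: lime_le; last exact: nearW.
  apply: ereal_nondecreasing_is_cvgn => n m nm; apply: ge0_le_integral => //.
  - by move=> x; exact: g0.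
  - by move=> x _; exact: (ndg x I).
have lim_i : mu.-integrable setT (fun x => limn (g^~ x)).
  apply/integrableP; split.
    exact: (emeasurable_fun_cvg g (fun x => limn (g^~ x)) mg (fun x _ => cg x)).
  apply: le_lt_trans (ltry (2 `^ q)); apply: le_trans limfin.
  rewrite le_eqVlt; apply/orP; left; apply/eqP; apply: eq_integral => x _.
  by rewrite gee0_abs//; apply: lime_ge => //; apply: nearW => n; exact: g0.
have bnd : {ae mu, forall x, exists M, forall N, S N x <= M}.
  apply: filterS (integrable_ae measurableT lim_i) => x /(_ I) fin.
  exists (fine (limn (g^~ x)) `^ q^-1) => N.
  have le : S N x `^ q <= fine (limn (g^~ x)).
    rewrite -lee_fin fineK//.
    have -> : limn (g^~ x) = ereal_sup (range (g^~ x)).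
      exact: cvg_lim (ereal_nondecreasing_cvgn (ndg x I)).
    by apply: ereal_sup_ubound; exists N.
  have -> : S N x = (S N x `^ q) `^ q^-1 by rewrite -powRrM mulfV ?gt_eqF// powRr1.
  apply: ge0_ler_powR; rewrite ?invr_ge0 ?nnegrE ?powR_ge0 ?(ltW q0)//.
  by apply: fine_ge0; apply: lime_ge; [exact: cg|apply: nearW => n; exact: g0].
(* Upper limits make v measurable on the whole space, whether or not the sequence converges at x. *)
pose v x := Complex (fine (limn_esup (fun n => (complex.Re (u n x))%:E)))
                    (fine (limn_esup (fun n => (complex.Im (u n x))%:E))).
have mv : cmeasurable v.
  split=> /=; apply: measurableT_comp => //; apply: measurable_fun_limn_esup => n;
    by apply/measurable_EFinP; case: (mu_ n).
have cv : {ae mu, forall x, nc (u n x - v x) @[n --> \oo] --> 0}.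
  apply: filterS bnd => x [M SM].
  have cre : cvgn (fun n => complex.Re (u n x)).
    apply: (@cvgn_bounded_variation _ _ M) => N; apply: le_trans (SM N).
    apply: ler_sum => n _; apply: le_trans (normc_Re _).
    by case: (u n.+1 x) (u n x) => [? ?] [].
  have cim : cvgn (fun n => complex.Im (u n x)).
    apply: (@cvgn_bounded_variation _ _ M) => N; apply: le_trans (SM N).
    apply: ler_sum => n _; apply: le_trans (normc_Im _).
    by case: (u n.+1 x) (u n x) => [? ?] [].
  have lim_sup (a : R^nat) : cvgn a -> a n @[n --> \oo] --> fine (limn_esup (fun n => (a n)%:E)).
    move=> ca; have c : (a n)%:E @[n --> \oo] --> (limn a)%:E.
      by apply: cvg_EFin; [exact: nearW|exact: ca].
    by rewrite (cvg_limn_einf_sup c).2.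
  have /cvgrPdist_le hre := lim_sup _ cre; have /cvgrPdist_le him := lim_sup _ cim.
  apply/cvgrPdist_le => e e0; have e2 : 0 < e / 2 by rewrite divr_gt0.
  apply: filterS2 (hre _ e2) (him _ e2) => n h1 h2.
  rewrite sub0r normrN (ger0_norm (normc_ge0 _)) normcB_sym.
  apply: (le_trans (normc_le_ReIm _)); rewrite (splitr e); apply: lerD.
    by move: h1; rewrite /v; case: (u n x).
  by move: h2; rewrite /v; case: (u n x).
exists v => // n; apply: cLnorm_le_powR => //.
(* Fatou's lemma in m with n fixed: for m >= n the norm of u n - u m is at most the tail 2 2^-n of
   the geometric series. *)
apply: (@fatou_pint q (fun m x => u n x - u m x)) => //; first exact: cmeasurableB.
  apply: filterS cv => x; apply: cvg_trans; apply: near_eq_cvg; apply: nearW => m.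
  by rewrite normcB_sym; congr nc; ring.
exists n => // m /= nm; apply: pint_le_powR => //.
apply: (@le_trans _ _ (cLnorm mu q%:E (fun x => (u m x - u n x)%R))).
  by apply: le_cLnorm => //; [exact: ltW|apply: aeW => x; rewrite normcB_sym].
rewrite -(subnKC nm); apply: (le_trans (step1 _ _)).
by rewrite lee_fin lerBlDr lerDl mulr_ge0.
Qed.

End completeness.

(** * Multipliers of a unitary operator with a bounded kernel *)

Section multiplier.
Context {d : measure_display} {T : measurableType d} {R : realType}.
Variable mu : {measure set T -> \bar R}.
Implicit Types (f g u v w : T -> R[i]) (E : set T).
Local Notation nc := (@Normc.normc R).
Variables (F : (T -> R[i]) -> (T -> R[i])).
Hypotheses (smu : sigma_finite setT mu) (Funi : unitary_L2 mu F).
Local Notation Finv := (inverse_L2 mu F).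

Variables (p q : R).
Hypotheses (p1 : 1 <= p) (p2 : p <= 2) (q2 : 2 <= q).
Local Notation q' := (1 - q^-1)^-1.

Variables (w1 w2 : T -> R) (C1 C2 S : R) (h : T -> R[i]).
Hypotheses (mw1 : measurable_fun setT w1) (mw2 : measurable_fun setT w2)
  (w1_ge0 : forall x, 0 <= w1 x) (w2_ge0 : forall x, 0 <= w2 x)
  (C1_ge0 : 0 <= C1) (C2_ge0 : 0 <= C2) (S_ge0 : 0 <= S)
  (mh : cmeasurable h).
Hypothesis F_w1 : forall f, inL mu 2%:E f ->
  (\int[mu]_x (nc (F f x) ^+ 2 * w1 x)%:E <= C1%:E * cLnorm mu p%:E f `^ 2)%E.
Hypothesis F_w2 : forall f, inL mu 2%:E f ->
  (\int[mu]_x (nc (F f x) ^+ 2 * w2 x)%:E <= C2%:E * cLnorm mu q'%:E f `^ 2)%E.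
Hypothesis h_w : {ae mu, forall x, nc (h x) ^+ 2 <= S ^+ 2 * (w1 x * w2 x)}.

Let p_gt0 : 0 < p. Proof. exact: lt_le_trans p1. Qed.
Let q_gt0 : 0 < q. Proof. by apply: lt_le_trans q2. Qed.
Let q_ge1 : 1 <= q. Proof. by apply: le_trans q2; rewrite ler1n. Qed.

(** In the application w1 is phi^(2/p - 1) and w2 is phi^(2/q' - 1). The set E localises the
    estimate, so that the part of f seen by the symbol on {|h| > n} can be made small. *)
Definition energy E f := (\int[mu]_(x in E) (nc (F f x) ^+ 2 * w1 x)%:E)%E.

Let mFf f : inL mu 2%:E f -> cmeasurable (F f).
Proof. by move=> /(inL2_unitary Funi)[]. Qed.

Let msq (f : T -> R[i]) (w : T -> R) : cmeasurable f -> measurable_fun setT w ->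
  measurable_fun setT (fun x => (nc (f x) ^+ 2 * w x)%:E).
Proof.
move=> mf mw; apply/measurable_EFinP; apply: measurable_funM => //.
by apply: measurable_funX; exact: cmeasurable_normc.
Qed.

Lemma energy_ge0 E f : (0 <= energy E f)%E.
Proof. by apply: integral_ge0 => x _; rewrite lee_fin mulr_ge0// sqr_ge0. Qed.

Lemma le_energy E E' f : measurable E -> measurable E' -> E `<=` E' ->
  inL mu 2%:E f -> (energy E f <= energy E' f)%E.
Proof.
move=> mE mE' EE' f2; apply: ge0_subset_integral => //.
- by apply: measurable_funTS; apply: msq => //; exact: mFf.
- by move=> x _; rewrite lee_fin mulr_ge0// sqr_ge0.
Qed.

Lemma fin_energy E f : measurable E -> inL mu 2%:E f -> inL mu p%:E f ->
  energy E f \is a fin_num.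
Proof.
move=> mE f2 [_ fp]; rewrite ge0_fin_numE ?energy_ge0//.
apply: (le_lt_trans (le_energy mE measurableT (@subsetT _ _) f2)).
by apply: (le_lt_trans (F_w1 f2)); rewrite lte_mul_pinfty// poweR_lty.
Qed.

Lemma sqrt_energy_le E f : measurable E -> inL mu 2%:E f -> inL mu p%:E f ->
  Num.sqrt (fine (energy E f)) <= Num.sqrt C1 * fine (cLnorm mu p%:E f).
Proof.
move=> mE f2 fp; have [_ fp'] := fp.
have nfin : cLnorm mu p%:E f \is a fin_num by rewrite ge0_fin_numE ?cLnorm_ge0.
have c0 : 0 <= fine (cLnorm mu p%:E f) by rewrite fine_ge0 ?cLnorm_ge0.
rewrite -(ger0_norm c0) -sqrtr_sqr -sqrtrM//.
apply: ler_wsqrtr; rewrite -lee_fin fineK ?fin_energy//.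
apply: (le_trans (le_energy mE measurableT (@subsetT _ _) f2)).
apply: (le_trans (F_w1 f2)).
by rewrite -{1}(fineK nfin) poweR_EFin powR_mulrn ?EFinM.
Qed.

(** As |h| <= S sqrt(w1 w2) almost everywhere, Cauchy-Schwarz separates |F f| sqrt(w1) from |F g|
    sqrt(w2). The restriction to E is kept in the first factor only: a small energy of f on E then
    gives a small pairing, uniformly in g. *)
Lemma ip_multiplier E f g : measurable E -> inL mu 2%:E f -> inL mu p%:E f ->
  inL mu 2%:E g -> inL mu q'%:E g ->
  ip_integrable mu (crestr E (fun x => h x * F f x)) (F g) /\
  `|ip mu (crestr E (fun x => h x * F f x)) (F g)| <=
    S * Num.sqrt (fine (energy E f)) * Num.sqrt C2 * fine (cLnorm mu q'%:E g).
Proof.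
move=> mE f2 fp g2 [_ gq].
have mF1 := mFf f2; have mF2 := mFf g2.
have msqrt (w : T -> R) : measurable_fun setT w -> measurable_fun setT (fun x => Num.sqrt (w x)).
  by apply: (measurableT_comp (continuous_measurable_fun (@sqrt_continuous R))).
pose a x := \1_E x * (nc (F f x) * Num.sqrt (w1 x)).
pose b x := nc (F g x) * Num.sqrt (w2 x).
have a0 x : 0 <= a x.
  by rewrite /a !mulr_ge0// ?normc_ge0// indicE ler0n.
have b0 x : 0 <= b x by rewrite mulr_ge0 ?normc_ge0.
have ma : measurable_fun setT a.
  apply: measurable_funM; first exact: measurable_indic.
  by apply: measurable_funM; [exact: cmeasurable_normc|exact: msqrt].
have mb : measurable_fun setT b.
  by apply: measurable_funM; [exact: cmeasurable_normc|exact: msqrt].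
have two : (2:R)^-1 + 2^-1 = 1 by field.
have H := hoelder mu ma mb (ltr0n R 2) (ltr0n R 2) two.
have gfin : cLnorm mu q'%:E g \is a fin_num by rewrite ge0_fin_numE ?cLnorm_ge0.
have sqrtE (x : \bar R) : (0 <= x)%E -> (x \is a fin_num) -> (x `^ 2^-1)%E = (Num.sqrt (fine x))%:E.
  by move=> x0 xf; rewrite -{1}(fineK xf) poweR_EFin powR12_sqrt ?fine_ge0.
have N2a : Lnorm mu 2%:E (EFin \o a) = (Num.sqrt (fine (energy E f)))%:E.
  rewrite -sqrtE ?energy_ge0 ?fin_energy// unlock /energy [in RHS]integral_mkcond.
  congr (_ `^ _)%E; apply: eq_integral => x _ /=.
  rewrite powR_mulrn// real_normK ?num_real// /a patchE indicE.
  by case: ifPn => _; rewrite ?mul1r ?mul0r ?expr0n// exprMn sqr_sqrtr.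
have N2b : (Lnorm mu 2%:E (EFin \o b) <= (Num.sqrt C2 * fine (cLnorm mu q'%:E g))%:E)%E.
  have -> : (Num.sqrt C2 * fine (cLnorm mu q'%:E g))%:E =
     ((C2%:E * cLnorm mu q'%:E g `^ 2) `^ 2^-1)%E.
    rewrite sqrtE.
    - rewrite -{2}(fineK gfin) poweR_EFin -EFinM/= powR_mulrn ?fine_ge0 ?cLnorm_ge0//.
      by rewrite sqrtrM// sqrtr_sqr ger0_norm ?fine_ge0 ?cLnorm_ge0.
    - by rewrite mule_ge0 ?poweR_ge0// lee_fin.
    - by rewrite fin_numM// fin_num_poweR.
  rewrite unlock; apply: gt0_ler_poweR.
  - by rewrite invr_ge0.
  - by rewrite in_itv/= leey andbT; apply: integral_ge0 => x _; rewrite lee_fin powR_ge0.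
  - by rewrite in_itv/= leey andbT mule_ge0 ?poweR_ge0// lee_fin.
  apply: le_trans (F_w2 g2); rewrite le_eqVlt; apply/orP; left; apply/eqP.
  apply: eq_integral => x _ /=.
  by rewrite powR_mulrn// real_normK ?num_real// /b exprMn sqr_sqrtr.
have mhF : cmeasurable (fun x => h x * F f x) by exact: cmeasurableM.
have abE : (\int[mu]_x (S * (a x * b x))%:E =
    S%:E * Lnorm mu 1%E (EFin \o (a \* b)%R))%E.
  rewrite Lnorm1 -ge0_integralZl//.
  - by apply: eq_integral => x _; rewrite EFinM /= ger0_norm// mulr_ge0.
  - by apply: measurableT_comp => //; apply/measurable_EFinP; exact: measurable_funM.
have bound : (\int[mu]_x (S * (a x * b x))%:E <=
    (S * Num.sqrt (fine (energy E f)) * Num.sqrt C2 * fine (cLnorm mu q'%:E g))%:E)%E.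
  rewrite abE -!mulrA EFinM; apply: lee_wpmul2l; first by rewrite lee_fin.
  apply: (le_trans H); rewrite N2a EFinM; apply: lee_wpmul2l => //.
have [] := @le_ip_integrable _ _ _ mu (crestr E (fun x => h x * F f x)) (F g)
   (fun x => S * (a x * b x)) (cmeasurable_crestr mE mhF) mF2.
- by apply: measurable_funM => //; exact: measurable_funM.
- by move=> x; exact: mulr_ge0 S_ge0 (mulr_ge0 (a0 x) (b0 x)).
- apply: filterS h_w => x hw.
  have hw' : nc (h x) <= S * (Num.sqrt (w1 x) * Num.sqrt (w2 x)).
    rewrite -(@ler_pXn2r _ 2)// ?nnegrE ?normc_ge0 ?mulr_ge0 ?sqrtr_ge0//.
    by rewrite !exprMn !sqr_sqrtr.
  rewrite normc_crestr Normc.normcM /a /b.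
  have -> : S * (\1_E x * (nc (F f x) * Num.sqrt (w1 x)) * (nc (F g x) * Num.sqrt (w2 x)))
    = \1_E x * (S * (Num.sqrt (w1 x) * Num.sqrt (w2 x)) * nc (F f x)) * nc (F g x) by ring.
  rewrite ler_wpM2r ?normc_ge0// ler_wpM2l ?indicE ?ler0n// ler_wpM2r ?normc_ge0//.
- by apply: (le_lt_trans bound); rewrite ltry.
by move=> i ile; split => //; rewrite -lee_fin; exact: le_trans ile bound.
Qed.

(** Serves four symbols: h itself, h on {|h| <= n}, h on {|h| > n}, and h between two heights. *)
Lemma dual_multiplier E f v : measurable E -> inL mu 2%:E f -> inL mu p%:E f ->
  cmeasurable v ->
  (forall g, inL mu 1%:E g -> inL mu 2%:E g -> inL mu q'%:E g ->
    ip mu v g = ip mu (crestr E (fun x => h x * F f x)) (F g)) ->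
  (cLnorm mu q%:E v <= (S * Num.sqrt (fine (energy E f)) * Num.sqrt C2)%:E)%E.
Proof.
move=> mE f2 fp mv H; apply: dual_cLnorm_le => //.
  by rewrite !mulr_ge0// sqrtr_ge0.
by move=> g g1 g2 gq; rewrite H//; exact: (ip_multiplier mE f2 fp g2 gq).2.
Qed.

Let c := S * Num.sqrt C1 * Num.sqrt C2.

Let c_ge0 : 0 <= c. Proof. by rewrite /c !mulr_ge0 ?sqrtr_ge0. Qed.

Let hF f x := h x * F f x.

Let mhF f : inL mu 2%:E f -> cmeasurable (hF f).
Proof. by move=> f2; apply: cmeasurableM => //; exact: mFf. Qed.

(** The weak form of F v = h F f. The functions g range over both L^1 and L^2, where pairings with
    an element of the extension to L^1 + L^2 make sense. *)
Definition multiplier_image f v := cmeasurable v /\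
  forall g, inL mu 1%:E g -> inL mu 2%:E g ->
    ip_integrable mu v g /\ ip mu v g = ip mu (hF f) (F g).

Let crestrT f : crestr setT f = f.
Proof. by apply/funext => x; rewrite /crestr in_setT. Qed.

Let energy_bound E f : measurable E -> inL mu 2%:E f -> inL mu p%:E f ->
  ((S * Num.sqrt (fine (energy E f)) * Num.sqrt C2)%:E <= c%:E * cLnorm mu p%:E f)%E.
Proof.
move=> mE f2 fp; have [_ fp'] := fp.
have nfin : cLnorm mu p%:E f \is a fin_num by rewrite ge0_fin_numE ?cLnorm_ge0.
rewrite -(fineK nfin) -EFinM lee_fin.
rewrite (_ : c * _ = S * (Num.sqrt C1 * fine (cLnorm mu p%:E f)) * Num.sqrt C2); last first.
  by rewrite /c; ring.
by rewrite ler_wpM2r ?sqrtr_ge0// ler_wpM2l// sqrt_energy_le.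
Qed.

Lemma multiplier_image_le f v : inL mu 2%:E f -> inL mu p%:E f ->
  multiplier_image f v -> (cLnorm mu q%:E v <= c%:E * cLnorm mu p%:E f)%E.
Proof.
move=> f2 fp [mv H]; apply: le_trans (energy_bound measurableT f2 fp).
by apply: dual_multiplier => // g g1 g2 gq; rewrite crestrT; have [] := H g g1 g2.
Qed.

Let high n : set T := [set x | n%:R < nc (h x)].

Let mhigh n : measurable (high n). Proof. exact: measurable_high. Qed.
Let mlow n : measurable (~` high n). Proof. exact: measurableC. Qed.

(** The multiplier with symbol h on {|h| <= n} and 0 elsewhere. The symbol is bounded, so the
    operator is defined on all of L^2 by the inverse on L^2 alone. *)
Definition cutoff_multiplier n f := Finv (crestr (~` high n) (hF f)).

Local Notation Tn := cutoff_multiplier.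

Let inL2_low n f : inL mu 2%:E f -> inL mu 2%:E (crestr (~` high n) (hF f)).
Proof.
move=> f2; apply: (@le_inL _ _ _ _ _ _ (fun x => (n%:R)%:C%C * F f x)) => //.
- by apply: cmeasurable_crestr => //; exact: mhF.
- by apply: inLZ => //; exact: inL2_unitary.
apply: aeW => x; rewrite !Normc.normcM normc_real ger0_norm// /crestr.
case: ifPn => [|_]; last by rewrite Normc.normc0 mulr_ge0 ?normc_ge0.
rewrite inE /high/= => /negP; rewrite -leNgt => hn.
by rewrite Normc.normcM ler_wpM2r ?normc_ge0.
Qed.

Lemma inL2_cutoff_multiplier n f : inL mu 2%:E f -> inL mu 2%:E (Tn n f).
Proof. by move=> f2; have [] := inverse_L2P Funi (inL2_low n f2). Qed.

Let mTn n f : inL mu 2%:E f -> cmeasurable (Tn n f).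
Proof. by move=> f2; have [] := inL2_cutoff_multiplier n f2. Qed.

Lemma ip_cutoff_multiplier n f g : inL mu 2%:E f -> inL mu 2%:E g ->
  ip mu (Tn n f) g = ip mu (crestr (~` high n) (hF f)) (F g).
Proof. by move=> f2 g2; apply: ip_inverse => //; exact: inL2_low. Qed.

Lemma cutoff_multiplier_le n f : inL mu 2%:E f -> inL mu p%:E f ->
  (cLnorm mu q%:E (Tn n f) <= c%:E * cLnorm mu p%:E f)%E.
Proof.
move=> f2 fp; apply: le_trans (energy_bound (mlow n) f2 fp).
apply: dual_multiplier => //; first exact: mTn.
by move=> g g1 g2 _; rewrite ip_cutoff_multiplier.
Qed.

Let tail n f := (S * Num.sqrt (fine (energy (high n) f)) * Num.sqrt C2)%:E.

Let ip_crestr E f g : measurable E -> inL mu 2%:E f -> inL mu p%:E f ->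
  inL mu 2%:E g -> inL mu q'%:E g -> ip_integrable mu (crestr E (hF f)) (F g).
Proof. by move=> mE f2 fp g2 gq; exact: (ip_multiplier mE f2 fp g2 gq).1. Qed.

(** The difference v - [Tn n f] is the image of f under the symbol h restricted to {|h| > n}. *)
Lemma cutoff_multiplier_dist n f v : inL mu 2%:E f -> inL mu p%:E f ->
  multiplier_image f v -> (cLnorm mu q%:E (fun x => (Tn n f x - v x)%R) <= tail n f)%E.
Proof.
move=> f2 fp [mv H]; rewrite cLnormB_sym; apply: dual_multiplier => //.
  by apply: cmeasurableB => //; exact: mTn.
move=> g g1 g2 gq; have [iv ev] := H g g1 g2.
have iT : ip_integrable mu (hF f) (F g) by rewrite -[hF f]crestrT; exact: ip_crestr.
rewrite ipB//; last by apply: ip_integrable2 => //; exact: inL2_cutoff_multiplier.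
rewrite ev ip_cutoff_multiplier// -ipB//; last exact: ip_crestr.
congr ip; apply/funext => x; rewrite /crestr in_setC.
by case: (x \in high n); rewrite /= ?subr0 ?subrr.
Qed.

(** The difference has the symbol h on {n < |h| <= m}, a part of {|h| > n}; hence one bound for all
    m >= n. *)
Lemma cutoff_multiplier_cauchy n m f : inL mu 2%:E f -> inL mu p%:E f -> (n <= m)%N ->
  (cLnorm mu q%:E (fun x => (Tn m f x - Tn n f x)%R) <= tail n f)%E.
Proof.
move=> f2 fp nm; have mE : measurable (high n `\` high m) by exact: measurableD.
apply: (@le_trans _ _ (S * Num.sqrt (fine (energy (high n `\` high m) f)) * Num.sqrt C2)%:E).
  apply: dual_multiplier => //; first by apply: cmeasurableB; exact: mTn.
  move=> g g1 g2 gq; rewrite ipB; last 2 first.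
  - by apply: ip_integrable2 => //; exact: inL2_cutoff_multiplier.
  - by apply: ip_integrable2 => //; exact: inL2_cutoff_multiplier.
  rewrite !ip_cutoff_multiplier// -ipB; [|exact: ip_crestr..].
  congr ip; apply/funext => x; rewrite /crestr in_setD !in_setC.
  have nmP : x \in high m -> x \in high n.
    by rewrite !inE /high/=; apply: le_lt_trans; rewrite ler_nat.
  move: nmP; case: (x \in high m) (x \in high n) => -[] //= nmP.
  - by rewrite subrr.
  - by have := nmP isT.
  - by rewrite subr0.
  - by rewrite subrr.
rewrite lee_fin ler_wpM2r ?sqrtr_ge0// ler_wpM2l//; apply: ler_wsqrtr.
apply: fine_le; rewrite ?fin_energy//.
by apply: le_energy => //; exact: subDsetl.
Qed.

(** For f in L^2 and L^p the weighted square |F f|^2 w1 is integrable by [F_w1], so its integral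
    over {|h| > n} tends to 0. *)
Lemma tail_near f (e : R) : inL mu 2%:E f -> inL mu p%:E f -> 0 < e ->
  \forall n \near \oo, (tail n f <= e%:E)%E.
Proof.
move=> f2 fp e0.
pose s := S * Num.sqrt C2.
have s0 : 0 <= s by rewrite mulr_ge0 ?sqrtr_ge0.
have s1 : 0 < s + 1 by rewrite ltr_wpDl.
have d0 : 0 < (e / (s + 1)) ^+ 2 by rewrite exprn_gt0// divr_gt0.
have mg : measurable_fun setT (fun x => nc (F f x) ^+ 2 * w1 x).
  by apply/measurable_EFinP; apply: msq => //; exact: mFf.
have g0 x : 0 <= nc (F f x) ^+ 2 * w1 x by rewrite mulr_ge0// sqr_ge0.
have gfin : (\int[mu]_x (nc (F f x) ^+ 2 * w1 x)%:E < +oo)%E.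
  by have := fin_energy measurableT f2 fp; rewrite ge0_fin_numE// energy_ge0.
have := cvge0_lt d0 (integral_tail (cmeasurable_normc mh) mg g0 gfin).
apply: filterS => n hn; rewrite lee_fin mulrAC -/s.
have h1 : Num.sqrt (fine (energy (high n) f)) <= e / (s + 1).
  rewrite -[leRHS]ger0_norm ?divr_ge0 ?(ltW e0) ?(ltW s1)// -sqrtr_sqr.
  by apply: ler_wsqrtr; rewrite -lee_fin fineK ?fin_energy// ltW.
apply: (@le_trans _ _ (s * (e / (s + 1)))); first by rewrite ler_wpM2l.
by rewrite mulrCA ler_piMr ?(ltW e0)// ler_pdivrMr// mul1r lerDl.
Qed.

Lemma unitary_inj u v : inL mu 2%:E u -> inL mu 2%:E v -> aeq mu (F u) (F v) -> aeq mu u v.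
Proof.
move=> u2 v2 Fuv; have [lin _ _] := Funi.
have d2 : inL mu 2%:E (fun x => -1 * u x + v x).
  by apply: inLD; rewrite ?ler1n//; apply: inLZ.
have [mu_ _] := u2; have [mv _] := v2; have [md _] := d2.
have F0 : pint mu 2 (F (fun x => -1 * u x + v x)) = 0%E.
  rewrite /pint (@ae_eq_integral _ _ _ _ _ (cst 0%E))//.
  - by rewrite integral0.
  - by apply: measurable_powR_normc; exact: mFf.
  apply: filterS2 Fuv (lin (-1) u v u2 v2) => x e1 -> _.
  by rewrite e1 mulN1r addNr Normc.normc0 powR0.
rewrite (pint2_unitary Funi d2) in F0.
apply: filterS (pint_eq0 (ltr0n _ 2) md F0) => x /Normc.eq0_normc/eqP.
by rewrite mulN1r addrC subr_eq0 => /eqP ->.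
Qed.

(** [inverse_L2] chooses a representative, so linearity can hold only almost everywhere; it is
    checked after applying F, which is injective on classes. *)
Lemma cutoff_multiplier_linear n : linear_on mu 2%:E (Tn n).
Proof.
move=> k f g f2 g2; have [lin _ _] := Funi.
have kf2 : inL mu 2%:E (fun x => k * f x + g x).
  by apply: inLD; rewrite ?ler1n//; exact: inLZ.
have [Tf2 eTf] := inverse_L2P Funi (inL2_low n f2).
have [Tg2 eTg] := inverse_L2P Funi (inL2_low n g2).
have [Tk2 eTk] := inverse_L2P Funi (inL2_low n kf2).
apply: unitary_inj => //.
  by apply: inLD; rewrite ?ler1n//; exact: inLZ.
have e1 := lin k f g f2 g2.
have e2 := lin k _ _ Tf2 Tg2.
apply: filterS2 (filterI eTf eTg) (filterI (filterI eTk e1) e2) => x [h1 h2] [[h3 h4] h5].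
rewrite h3 h5 h1 h2 /crestr /hF h4; case: ifPn => _; last by rewrite mulr0 addr0.
by rewrite mulrDr mulrCA.
Qed.

(* The closure of the graph of the multiplier on L^2 and L^p; its values are
   limits in L^q of those of the truncated symbols. *)
Definition multiplier_graph f v := cmeasurable v /\
  forall e : R, 0 < e -> exists f', [/\ inL mu 2%:E f', inL mu p%:E f',
    (cLnorm mu p%:E (fun x => (f' x - f x)%R) <= e%:E)%E &
    \forall n \near \oo, (cLnorm mu q%:E (fun x => (Tn n f' x - v x)%R) <= e%:E)%E].

Let cLnormB_tri r f g u : 1 <= r -> cmeasurable f -> cmeasurable g -> cmeasurable u ->
  (cLnorm mu r%:E (fun x => (f x - g x)%R) <=
   cLnorm mu r%:E (fun x => (f x - u x)%R) + cLnorm mu r%:E (fun x => (u x - g x)%R))%E.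
Proof.
move=> r1 mf mg mu_; rewrite (_ : (fun x => f x - g x) = (fun x => (f x - u x) + (u x - g x))).
  by apply: cLnormD => //; exact: cmeasurableB.
by apply/funext => x; rewrite addrA subrK.
Qed.

Let cLnorm_triB r f g : 1 <= r -> cmeasurable f -> cmeasurable g ->
  (cLnorm mu r%:E g <= cLnorm mu r%:E f + cLnorm mu r%:E (fun x => (f x - g x)%R))%E.
Proof.
move=> r1 mf mg; rewrite cLnormB_sym {1}(_ : g = (fun x => f x + (g x - f x))).
  by apply: cLnormD => //; exact: cmeasurableB.
by apply/funext => x; rewrite addrC subrK.
Qed.

Lemma multiplier_graph_image f v : inL mu 2%:E f -> inL mu p%:E f ->
  multiplier_image f v -> multiplier_graph f v.
Proof.
move=> f2 fp fv; split; first by case: fv.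
move=> e e0; exists f; split => //.
  under [X in cLnorm _ _ X]eq_fun do rewrite subrr.
  by rewrite cLnorm0 ?gt_eqF// lee_fin ltW.
apply: filterS (tail_near f2 fp e0) => n; apply: le_trans.
exact: cutoff_multiplier_dist.
Qed.

Lemma multiplier_graph_le f v : inL mu p%:E f -> multiplier_graph f v ->
  (cLnorm mu q%:E v <= c%:E * cLnorm mu p%:E f)%E.
Proof.
move=> fp [mv H]; have [mf fp'] := fp.
have nfin : cLnorm mu p%:E f \is a fin_num by rewrite ge0_fin_numE ?cLnorm_ge0.
have c1 : 0 < c + 1 by rewrite ltr_wpDl.
apply/lee_addgt0Pr => e e0.
(* The error in f counts c times and the error in v once, in all c + 1 times. *)
have d0 : 0 < e / (c + 1) by rewrite divr_gt0.
have [f' [f'2 f'p f'f nT]] := H _ d0.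
have [mf' _] := f'p.
have [n Tv] := filter_ex nT.
have Tf := cutoff_multiplier_le n f'2 f'p.
have f'le : (cLnorm mu p%:E f' <= cLnorm mu p%:E f + (e / (c + 1))%:E)%E.
  apply: (le_trans (cLnorm_triB p1 mf mf')); apply: leeD => //.
  by rewrite cLnormB_sym.
apply: (le_trans (cLnorm_triB q_ge1 (mTn n f'2) mv)).
apply: (le_trans (leeD Tf Tv)).
apply: (@le_trans _ _ (c%:E * (cLnorm mu p%:E f + (e / (c + 1))%:E) + (e / (c + 1))%:E)%E).
  by apply: leeD => //; apply: lee_wpmul2l.
rewrite -(fineK nfin) -!EFinD lee_fin le_eqVlt; apply/orP; left; apply/eqP.
by field; rewrite gt_eqF.
Qed.

Lemma multiplier_graph_linear k f g v w : inL mu p%:E f -> inL mu p%:E g ->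
  multiplier_graph f v -> multiplier_graph g w ->
  multiplier_graph (fun x => k * f x + g x) (fun x => k * v x + w x).
Proof.
move=> [mf _] [mg _] [mv Hv] [mw Hw].
have mk (z : R[i]) (f' : T -> R[i]) : cmeasurable f' -> cmeasurable (fun x => z * f' x).
  by move=> mf'; apply: cmeasurableM => //; exact: cmeasurable_cst.
have lin_le r (f1 f2 g1 g2 : T -> R[i]) (e : R) : 1 <= r -> 0 < e ->
    cmeasurable f1 -> cmeasurable f2 -> cmeasurable g1 -> cmeasurable g2 ->
    (cLnorm mu r%:E (fun x => (f1 x - f2 x)%R) <= (e / 2 / (nc k + 1))%:E)%E ->
    (cLnorm mu r%:E (fun x => (g1 x - g2 x)%R) <= (e / 2)%:E)%E ->
    (cLnorm mu r%:E (fun x => ((k * f1 x + g1 x) - (k * f2 x + g2 x))%R) <= e%:E)%E.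
  move=> r1 e0 mf1 mf2 mg1 mg2 le1 le2.
  rewrite (_ : (fun x => _) = (fun x => k * (f1 x - f2 x) + (g1 x - g2 x))); last first.
    by apply/funext => x; ring.
  apply: (le_trans (cLnormD mu r1 (mk k _ (cmeasurableB mf1 mf2)) (cmeasurableB mg1 mg2))).
  rewrite (splitr e) EFinD; apply: leeD => //.
  rewrite cLnormZ; [|exact: lt_le_trans r1|exact: cmeasurableB].
  apply: (@le_trans _ _ ((nc k)%:E * (e / 2 / (nc k + 1))%:E)%E).
    by apply: lee_wpmul2l => //; rewrite lee_fin normc_ge0.
  have k1 : 0 < nc k + 1 by rewrite ltr_wpDl// normc_ge0.
  rewrite -EFinM lee_fin mulrCA ler_piMr//; first by rewrite divr_ge0// ltW.
  by rewrite ler_pdivrMr// mul1r lerDl.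
split; first by apply: cmeasurableD => //; exact: mk.
move=> e e0.
have k1 : 0 < nc k + 1 by rewrite ltr_wpDl// normc_ge0.
have e1 : 0 < e / 2 / (nc k + 1) by rewrite !divr_gt0.
have e2 : 0 < e / 2 by rewrite divr_gt0.
have [f' [f'2 f'p f'f f'T]] := Hv _ e1.
have [g' [g'2 g'p g'g g'T]] := Hw _ e2.
have [mf' _] := f'p; have [mg' _] := g'p.
have kf'2 : inL mu 2%:E (fun x => k * f' x + g' x).
  by apply: inLD; rewrite ?ler1n//; exact: inLZ.
exists (fun x => k * f' x + g' x); split => //.
- by apply: inLD => //; exact: inLZ.
- exact: lin_le.
apply: filterS2 f'T g'T => n h1 h2.
apply: (@le_trans _ _ (cLnorm mu q%:E (fun x => ((k * Tn n f' x + Tn n g' x) - (k * v x + w x))%R))).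
  apply: le_cLnorm; first exact: ltW.
  - by apply: cmeasurableB; [exact: mTn|apply: cmeasurableD => //; exact: mk].
  - apply: cmeasurableB; apply: cmeasurableD => //; try exact: mk; try exact: mTn.
    by apply: mk; exact: mTn.
  by apply: filterS (cutoff_multiplier_linear n k f'2 g'2) => x ->.
by apply: lin_le => //; exact: mTn.
Qed.

(** By linearity the graph relates 0 to w - v, and the norm bound at 0 makes this vanish. *)
Lemma multiplier_graph_uniq f v w : inL mu p%:E f -> multiplier_graph f v ->
  multiplier_graph f w -> aeq mu v w.
Proof.
move=> fp fv fw; have [mf fp'] := fp.
have H := multiplier_graph_linear (-1) fp fp fv fw.
have z : (fun x => -1 * f x + f x) = fun=> 0 by apply/funext => x; rewrite mulN1r addNr.
rewrite z in H.
have zp : inL mu p%:E (fun _ : T => 0 : R[i]).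
  by split; [exact: cmeasurable_cst|rewrite cLnorm0// gt_eqF].
have := multiplier_graph_le zp H; rewrite cLnorm0 ?gt_eqF// mule0 => le0.
have [md _] := H.
have n0 : pint mu q (fun x => -1 * v x + w x) = 0%E.
  rewrite pintE ?gt_eqF// (_ : cLnorm _ _ _ = 0%E) ?poweR0r ?gt_eqF//.
  by apply/eqP; rewrite eq_le le0 cLnorm_ge0.
apply: filterS (pint_eq0 q_gt0 md n0) => x /Normc.eq0_normc/eqP.
by rewrite mulN1r addrC subr_eq0 => /eqP ->.
Qed.

(** A diagonal choice: f is approximated in L^p by truncations [fk k], which lie in L^2, and the
    symbol is cut at a height [N k] beyond which the images of [fk k] hardly change. The resulting
    [u k] are Cauchy in L^q at a geometric rate. *)
Lemma multiplier_graph_ex f : inL mu p%:E f -> exists v, multiplier_graph f v.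
Proof.
move=> fp; have [mf _] := fp.
have c1 : 0 < 1 + c by rewrite ltr_pwDl.
(* The step from [u k] to [u k.+1] will cost (1 + c) (hk k + hk (k+1)); this normalisation turns it
   into 3/4 of 2^-k. *)
pose hk k : R := (2 * (1 + c))^-1 * 2^-1 ^+ k.
have hk0 k : 0 < hk k by rewrite mulr_gt0 ?exprn_gt0// invr_gt0 ?mulr_gt0.
have hkS k : (1 + c) * (hk k + hk k.+1) <= 2^-1 ^+ k.
  rewrite /hk exprS.
  have -> : (1 + c) * ((2 * (1 + c))^-1 * 2^-1 ^+ k + (2 * (1 + c))^-1 * (2^-1 * 2^-1 ^+ k)) =
    (3 / 4) * 2^-1 ^+ k.
    by field; rewrite gt_eqF.
  by rewrite ler_piMl ?exprn_ge0//; lra.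
have /choice[fk fkP] k : exists f', [/\ inL mu 2%:E f', inL mu p%:E f' &
    (cLnorm mu p%:E (fun x => (f' x - f x)%R) < (hk k)%:E)%E].
  have [n hn] := filter_ex (trunc_near p_gt0 (hk0 k) fp).
  by exists (trunc n f); have [] := inL_trunc n p_gt0 p2 fp.
have fk2 k : inL mu 2%:E (fk k) by have [] := fkP k.
have fkp k : inL mu p%:E (fk k) by have [] := fkP k.
have mfk k : cmeasurable (fk k) by case: (fkp k).
have /choice[N NP] k : exists N, forall n, (N <= n)%N ->
    (cLnorm mu q%:E (fun x => (Tn n (fk k) x - Tn N (fk k) x)%R) <= (hk k)%:E)%E.
  have [N hN] := filter_ex (tail_near (fk2 k) (fkp k) (hk0 k)).
  exists N => n Nn; apply: le_trans hN.
  exact: cutoff_multiplier_cauchy.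
pose u k := Tn (N k) (fk k).
have mu_ k : cmeasurable (u k) by exact: mTn.
have uu k : (cLnorm mu q%:E (fun x => (u k.+1 x - u k x)%R) <= (2^-1 ^+ k)%:E)%E.
  (* The two terms are cut at different heights. At a height beyond both, their difference becomes
     [Tn n] applied to [fk k.+1] - [fk k], where linearity and the bound uniform in n apply. *)
  pose n := maxn (N k) (N k.+1).
  have t1 := NP k n (leq_maxl _ _); have t2 := NP k.+1 n (leq_maxr _ _).
  have m1 : cmeasurable (Tn n (fk k)) by exact: mTn.
  have m2 : cmeasurable (Tn n (fk k.+1)) by exact: mTn.
  have t3 : (cLnorm mu q%:E (fun x => (Tn n (fk k.+1) x - Tn n (fk k) x)%R) <=
      (c * (hk k + hk k.+1))%:E)%E.
    pose D x := -1 * fk k x + fk k.+1 x.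
    have D2 : inL mu 2%:E D by apply: inLD; rewrite ?ler1n//; exact: inLZ.
    have Dp : inL mu p%:E D by apply: inLD => //; exact: inLZ.
    apply: (@le_trans _ _ (cLnorm mu q%:E (Tn n D))).
      apply: le_cLnorm; [exact: ltW|exact: cmeasurableB|exact: mTn|].
      apply: filterS (cutoff_multiplier_linear n (-1) (fk2 k) (fk2 k.+1)) => x ->.
      by rewrite mulN1r addrC.
    apply: (le_trans (cutoff_multiplier_le n D2 Dp)); rewrite [leRHS]EFinM.
    apply: lee_wpmul2l; first by rewrite lee_fin.
    rewrite (_ : D = fun x => fk k.+1 x - fk k x); last first.
      by apply/funext => x; rewrite /D mulN1r addrC.
    apply: (le_trans (cLnormB_tri p1 (mfk _) (mfk _) mf)).
    have [_ _ /ltW a1] := fkP k; have [_ _ /ltW a2] := fkP k.+1.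
    by rewrite addrC EFinD; apply: leeD => //; rewrite cLnormB_sym.
  apply: (le_trans (cLnormB_tri q_ge1 (mu_ k.+1) (mu_ k) m2)).
  apply: (@le_trans _ _ ((hk k.+1)%:E + ((c * (hk k + hk k.+1))%:E + (hk k)%:E))%E).
    apply: leeD; first by rewrite cLnormB_sym.
    by apply: (le_trans (cLnormB_tri q_ge1 m2 (mu_ k) m1)); exact: leeD.
  rewrite -!EFinD lee_fin; apply: le_trans (hkS k).
  by rewrite mulrDl mul1r; lra.
have [v mv uv] := Lq_complete q_ge1 mu_ uu.
exists v; split => // e e0.
have [k hke] : exists k, hk k + 2 * 2^-1 ^+ k <= e.
  pose B := (2 * (1 + c))^-1 + 2.
  have B0 : 0 < B by rewrite addr_gt0// invr_gt0 mulr_gt0.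
  have /archi_boundP hb : 0 <= B / e by rewrite divr_ge0// ltW.
  exists (Num.bound (B / e)); rewrite /hk -mulrDl -/B exprVn ler_pdivrMr ?exprn_gt0//.
  rewrite mulrC -ler_pdivrMr// (le_trans (ltW hb))// -natrX ler_nat ltnW//.
  exact: ltn_expl.
exists (fk k); split => //.
  have [_ _ /ltW a1] := fkP k; apply: (le_trans a1); rewrite lee_fin.
  by apply: le_trans hke; rewrite lerDl mulr_ge0// exprn_ge0.
exists (N k) => // n /= Nn.
apply: (le_trans (cLnormB_tri q_ge1 (mTn _ (fk2 k)) mv (mu_ k))).
apply: (@le_trans _ _ ((hk k)%:E + (2 * 2^-1 ^+ k)%:E)%E); last by rewrite -EFinD lee_fin.
by apply: leeD => //; exact: NP.
Qed.

(** On L^p any value related to f by the graph is taken; uniqueness makes the choice linear almost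
    everywhere. Outside L^p the operator is set equal to A, so agreement with A holds there by
    construction. *)
Lemma multiplier_extension (A : (T -> R[i]) -> (T -> R[i])) : exists2 A',
  bounded_operator mu p%:E q%:E A' &
  forall f, (inL mu p%:E f -> inL mu 2%:E f /\ multiplier_image f (A f)) -> aeq mu (A' f) (A f).
Proof.
pose A' f := if `[< inL mu p%:E f >] then xget (fun=> 0) (multiplier_graph f) else A f.
have A'P f : inL mu p%:E f -> multiplier_graph f (A' f).
  move=> fp; rewrite /A' asboolT//.
  case: xgetP => [y _ []//|]; have [v fv] := multiplier_graph_ex fp.
  by move=> /(_ v).
exists A'.
  split.
    move=> k f g fp gp.
    have kp : inL mu p%:E (fun x => k * f x + g x) by apply: inLD => //; exact: inLZ.
    apply: (multiplier_graph_uniq kp); first exact: A'P.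
    by apply: multiplier_graph_linear => //; exact: A'P.
  exists c => f fp; have H := multiplier_graph_le fp (A'P _ fp).
  split => //; split; first by case: (A'P _ fp).
  by apply: (le_lt_trans H); have [_ ?] := fp; rewrite lte_mul_pinfty.
move=> f; have [fp|nfp] := pselect (inL mu p%:E f).
  move=> /(_ fp)[f2 fA]; apply: (multiplier_graph_uniq fp); first exact: A'P.
  exact: multiplier_graph_image.
by move=> _; rewrite /A' asboolF//; apply: aeW.
Qed.

End multiplier.

(** * The weighted measure and test functions *)

Section row_vectors.
Context {R : realType} {N : nat}.
Implicit Types (f : 'rV[R]_N -> R).

(** The sigma-algebra is generated by the coordinates, while open sets come from the sup norm. An
    open set is the countable union of the cubes with rational centre and radius 1/(m + 1) that it
    contains. *)
Lemma open_measurable_rV (U : set 'rV[R]_N) : open U -> measurable U.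
Proof.
move=> oU.
pose box (z : 'rV[rat]_N * nat) : set 'rV[R]_N :=
  [set y | forall j, `|ratr (z.1 0 j) - y 0 j| < z.2.+1%:R^-1].
pose V z : set 'rV[R]_N := if `[< box z `<=` U >] then box z else set0.
have -> : U = \bigcup_z V z.
  apply/seteqP; split => [x Ux|x [z _]]; last first.
    by rewrite /V; case: asboolP => // zU; exact: zU.
  have /nbhs_ballP[e /= e0 eU] : nbhs x U by apply: open_nbhs_nbhs.
  have /archi_boundP hb : 0 <= 2 / e by rewrite divr_ge0// ltW.
  set n := Num.bound (2 / e) in hb.
  have n0 : 0 < n.+1%:R^-1 :> R by rewrite invr_gt0.
  have /choice[r rP] j : exists r : rat, `|ratr r - x 0 j| < n.+1%:R^-1.
    have [|r] := @rat_in_itvoo R (x 0 j - n.+1%:R^-1) (x 0 j + n.+1%:R^-1).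
      by rewrite ltrD2l gtrN.
    rewrite in_itv/= => /andP[r1 r2]; exists r.
    by rewrite ltr_distl r1 r2.
  have ne : n.+1%:R^-1 + n.+1%:R^-1 < e.
    have -> : n.+1%:R^-1 + n.+1%:R^-1 = 2 / n.+1%:R :> R by rewrite mulr2n mulrDl mul1r.
    rewrite ltr_pdivrMr// mulrC -ltr_pdivrMr// (lt_le_trans hb)// ler_nat//.
  exists (\row_j r j, n) => //; rewrite /V asboolT.
    by move=> j /=; rewrite mxE.
  move=> y yb; apply: eU; split => // i j; rewrite ord1 /= -ball_normE/=.
  have := yb j; rewrite /= mxE => yj; apply: le_lt_trans ne.
  rewrite (_ : x 0 j - y 0 j = (ratr (r j) - y 0 j) - (ratr (r j) - x 0 j)); last by ring.
  by apply: (le_trans (ler_normB _ _)); apply: lerD; exact: ltW.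
apply: countable_bigcupT_measurable => [|z]; first exact: countableP.
rewrite /V; case: ifPn => _ //.
rewrite (_ : box z = \bigcap_(j in [set: 'I_N]) ~` [set y | z.2.+1%:R^-1 <= `|ratr (z.1 0 j) - y 0 j|]).
  apply: fin_bigcap_measurable => // j _; apply: measurableC.
  rewrite -[X in measurable X]setTI; apply: measurable_fun_le => //.
  by apply: measurableT_comp => //; apply: measurable_funB => //; exact: measurable_coor.
apply/seteqP; split => y /=.
  by move=> yb j _ /=; rewrite leNgt (yb j).
by move=> yb j; have := yb j I; rewrite /= => /negP; rewrite -ltNge.
Qed.

Lemma continuous_measurable_rV f : continuous f -> measurable_fun setT f.
Proof.
move=> cf; apply: (measurability _ (RGenOInfty.measurableE R)).
move=> _ [_ [x ->] <-]; apply: measurableI => //; apply: open_measurable_rV.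
by move/continuousP : cf; apply; exact: rray_open.
Qed.

Lemma test_function_measurable (f : 'rV[R]_N -> R[i]) : test_function f -> cmeasurable f.
Proof.
by move=> [/(_ [::])[cr _] /(_ [::])[ci _] _]; split; exact: continuous_measurable_rV.
Qed.

Lemma test_function_bounded (f : 'rV[R]_N -> R[i]) : test_function f ->
  exists2 M : R, 0 <= M & forall x, Normc.normc (f x) <= M.
Proof.
move=> [/(_ [::])[/= cr _] /(_ [::])[/= ci _] kf].
have bd (g : 'rV[R]_N -> R) : continuous g -> exists M, forall x,
    closure [set x | f x != 0] x -> `|g x| <= M.
  move=> cg.
  have /compact_bounded[M [Mr gM]] : compact [set g x | x in closure [set x | f x != 0]].
    by apply: continuous_compact => //; exact: continuous_subspaceT.
  exists (M + 1) => x Sx; apply: (gM (M + 1)); first by rewrite ltrDl.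
  by exists x.
have [M1 h1] := bd _ cr; have [M2 h2] := bd _ ci.
exists (`|M1| + `|M2|); first by rewrite addr_ge0.
move=> x; have [->|fx] := eqVneq (f x) 0; first by rewrite Normc.normc0 addr_ge0.
have Sx : closure [set x | f x != 0] x by apply: subset_closure.
apply: (le_trans (normc_le_ReIm _)); apply: lerD.
  by apply: (le_trans (h1 x Sx)); exact: ler_norm.
by apply: (le_trans (h2 x Sx)); exact: ler_norm.
Qed.

End row_vectors.

(** Sets of finite m-measure are intersected with {w <= n}, on which the density costs at most a
    factor n. *)
Lemma sigma_finite_density d (T : measurableType d) (R : realType)
    (m : {sigma_finite_measure set T -> \bar R}) (w : T -> R) :
  measurable_fun setT w -> (forall x, 0 <= w x) ->
  sigma_finite setT (fun A => \int[m]_(x in A) (w x)%:E)%E.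
Proof.
move=> mw w0; have /sigma_finiteP[E [TE ndE Efin]] := sigma_finiteT m.
exists (fun n => E n `&` [set x | w x <= n%:R]).
  apply/seteqP; split => // x _.
  have [i _ Ei] : (\bigcup_i E i) x by rewrite -TE.
  have /archi_boundP hb := w0 x.
  exists (maxn i (Num.bound (w x))) => //; split => /=.
    by move: Ei; apply/subsetPset; apply: ndE; exact: leq_maxl.
  by rewrite (le_trans (ltW hb))// ler_nat leq_maxr.
move=> n; have [mE Ey] := Efin n.
have mG : measurable (E n `&` [set x | w x <= n%:R]).
  by apply: measurable_fun_le => //; exact: measurable_funTS.
split => //; apply: (@le_lt_trans _ _ (\int[m]_(x in E n `&` [set x | (w x <= n%:R)%R]) (cst n%:R%:E x))%E).
  apply: ge0_le_integral => //.
  - by move=> x _; rewrite lee_fin.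
  - by apply/measurable_EFinP; exact: measurable_funTS.
  - by move=> x [_].
rewrite integral_cst// lte_mul_pinfty// ?lee_fin//.
by apply: le_lt_trans Ey; apply: le_measure; rewrite ?inE//; exact: subIsetl.
Qed.

(** * From the symbol to a weight of weak type *)

Section weights.
Context {d : measure_display} {T : measurableType d} {R : realType}.
Variable mu : {measure set T -> \bar R}.
Implicit Types (f g : T -> R[i]).
Local Notation nc := (@Normc.normc R).

(** The unit ball of weak L^1. Normalising phi here leaves S as the only quantity that depends on
    the size of h. *)
Definition weak_L1 (phi : T -> R) :=
  [/\ measurable_fun setT phi, (forall x, 0 <= phi x) &
      forall t, 0 < t -> (mu [set x | (t <= phi x)%R] <= (t^-1)%:E)%E].

(** The Hausdorff-Young-Paley inequality with middle exponent 2. The constant is chosen before phi,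
    which is what makes the final constant independent of the multiplier. At p = 2 the weight is
    phi^0 = 1 and C = 1 by Plancherel. *)
Lemma pitt (F : (T -> R[i]) -> (T -> R[i])) (K p : R) :
  unitary_L2 mu F -> L1_bounded mu F K -> 0 <= K -> 1 < p -> p <= 2 ->
  exists2 C : R, 0 < C & forall phi, weak_L1 phi -> forall f, inL mu 2%:E f ->
    (\int[mu]_x (nc (F f x) ^+ 2 * phi x `^ (2 / p - 1))%:E
      <= C%:E * cLnorm mu p%:E f `^ 2)%E.
Proof.
move=> Funi FK K0 p1; rewrite le_eqVlt => /orP[/eqP ->|p2].
  exists 1 => // phi _ f f2; rewrite mul1e -pintE ?pnatr_eq0//.
  rewrite -(pint2_unitary Funi f2) pint2E divff ?pnatr_eq0// subrr.
  by under eq_integral do rewrite powRr0 mulr1.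
exists (pitt_const p K + 1); first by rewrite ltr_wpDl// pitt_const_ge0.
move=> phi [mphi phi0 phiw] f f2.
rewrite (_ : (cLnorm mu p%:E f `^ 2)%E = (pint mu p f `^ (2 / p))%E).
  exact: (pitt_lt2 Funi FK K0 mphi phi0 phiw p1 p2 f2).
by rewrite cLnormE -poweRrM mulrC.
Qed.

(* phi = (|h| / S)^r with 1/r = 1/p - 1/q; when p = q = 2 or S = 0 it degenerates
   to phi = 0, with 0 `^ 0 = 1. *)
Lemma symbol_weight (p q S : R) (h : T -> R[i]) : 1 < p -> p <= 2 -> 2 <= q -> 0 <= S ->
  cmeasurable h ->
  (forall s, 0 < s -> (s%:E *
     (if (p^-1 - q^-1 == 0)%R then (if mu [set x | (s <= nc (h x))%R] == 0 then 0 else 1)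
      else mu [set x | (s <= nc (h x))%R] `^ (p^-1 - q^-1)%R) <= S%:E)%E) ->
  exists2 phi, weak_L1 phi & {ae mu, forall x, nc (h x) ^+ 2 <=
    S ^+ 2 * (phi x `^ (2 / p - 1) * phi x `^ (2 / (1 - q^-1)^-1 - 1))}.
Proof.
move=> p1 p2 q2 S0 mh H; set r0 := p^-1 - q^-1 in H *.
have mn := cmeasurable_normc mh.
have p0 : 0 < p by exact: lt_trans p1.
have q0 : 0 < q by exact: lt_le_trans q2.
have mlev s : measurable [set x | s <= nc (h x)].
  by rewrite -[X in measurable X]setTI; apply: measurable_fun_le.
have weak0 : weak_L1 (fun=> 0).
  split => // t t0; have -> : [set x : T | t <= (fun=> 0) x] = set0.
    by apply/seteqP; split => x //=; rewrite leNgt t0.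
  by rewrite measure0 lee_fin invr_ge0 ltW.
have ae_lt (s0 : R) : (forall n : nat, mu [set x | (s0 + n.+1%:R^-1 <= nc (h x))%R] = 0%E) ->
    {ae mu, forall x, nc (h x) <= s0}.
  move=> z.
  have : {ae mu, forall x, forall n : nat, ~ (s0 + n.+1%:R^-1 <= nc (h x))}.
    apply: ae_foralln => n; exists [set x | s0 + n.+1%:R^-1 <= nc (h x)]; split => //.
    by move=> x /= /contrapT.
  apply: filterS => x hx; apply/ler_addgt0Pr => e e0; rewrite leNgt; apply/negP => lt.
  have /archi_boundP hb : 0 <= e^-1 by rewrite invr_ge0 ltW.
  apply: (hx (Num.bound e^-1)); apply: le_trans (ltW lt); rewrite lerD2l.
  rewrite invf_ple ?posrE//; apply: (le_trans (ltW hb)); by rewrite ler_nat.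
(* The exponents for p and q' add up to 2 r0, so the two powers of (|h| / S)^(1/r0) multiply to (|h|
   / S)^2. *)
have e12 : (2 / p - 1) + (2 / (1 - q^-1)^-1 - 1) = 2 * r0 by rewrite invrK /r0; ring.
have pq : q^-1 <= p^-1 by rewrite lef_pV2 ?posrE// (le_trans p2).
have r00 : 0 <= r0 by rewrite subr_ge0.
have [r0z|r0nz] := eqVneq r0 0.
  (* As p <= 2 <= q, equal exponents are both 2, and the bracket convention says that |h| <= S
     almost everywhere. *)
  have pq' : p = q by apply: invr_inj; apply/eqP; rewrite -subr_eq0 -/r0 r0z.
  have pE : p = 2 by apply/eqP; rewrite eq_le p2 pq' q2.
  have qE : q = 2 by rewrite -pq'.
  exists (fun=> 0) => //.
  have : {ae mu, forall x, nc (h x) <= S}.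
    apply: ae_lt => n; have s0 : 0 < S + n.+1%:R^-1 by rewrite ltr_wpDl// invr_gt0.
    have := H _ s0; rewrite r0z eqxx; case: ifPn => [/eqP//|_].
    by rewrite mule1 lee_fin gerDl leNgt invr_gt0 ltr0n.
  apply: filterS => x hS; rewrite pE qE invrK divff// subrr powRr0 mul1r.
  rewrite (_ : 2 * (1 - 2^-1) - 1 = 0 :> R) ?powRr0 ?mulr1; last by field.
  by rewrite ler_pXn2r ?nnegrE ?normc_ge0.
have r0_gt0 : 0 < r0 by rewrite lt_neqAle eq_sym r0nz.
(* S = 0 makes every set {|h| >= s} null, hence h = 0 almost everywhere; the quotient |h| / S is
   formed only for S > 0. *)
move: S0; rewrite le_eqVlt => /orP[/eqP S0|S_gt0].
  exists (fun=> 0) => //.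
  have : {ae mu, forall x, nc (h x) <= 0}.
    apply: ae_lt => n; have s0 : 0 < 0 + n.+1%:R^-1 :> R by rewrite add0r invr_gt0.
    have := H _ s0; rewrite (negbTE r0nz) -S0.
    move=> Hs; apply/eqP; rewrite eq_le measure_ge0 andbT leNgt; apply/negP => m0.
    by move: Hs; rewrite leNgt mule_gt0 ?poweR_gt0.
  apply: filterS => x hx; rewrite (_ : nc (h x) = 0) ?expr0n/=; last first.
    by apply/eqP; rewrite eq_le hx normc_ge0.
  by rewrite -S0 expr0n/= mul0r.
pose phi x := (nc (h x) / S) `^ r0^-1.
have phi0 x : 0 <= phi x by exact: powR_ge0.
exists phi.
  split => //.
    apply: (measurableT_comp (measurable_powR _)).
    exact: measurable_funM.
  move=> t t0.
  (* The set {phi >= t} is {|h| >= s} for s = S t^r0, where the hypothesis reads (t m)^r0 <= 1 with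
     m its measure. *)
  have s0 : 0 < S * t `^ r0 by rewrite mulr_gt0// powR_gt0.
  have -> : [set x | t <= phi x] = [set x | S * t `^ r0 <= nc (h x)].
    apply/seteqP; split => x /=.
      rewrite mulrC -ler_pdivlMr// => tx.
      have -> : nc (h x) / S = phi x `^ r0.
        by rewrite /phi -powRrM mulVf// powRr1// divr_ge0 ?normc_ge0 ?ltW.
      by apply: ge0_ler_powR => //; rewrite nnegrE ?phi0 ?(ltW t0).
    rewrite mulrC -ler_pdivlMr// => tx.
    have -> : t = (t `^ r0) `^ r0^-1 by rewrite -powRrM mulfV// powRr1// ltW.
    apply: ge0_ler_powR => //; rewrite ?nnegrE ?invr_ge0 ?powR_ge0//.
    by rewrite divr_ge0 ?normc_ge0 ?ltW.
  have := H _ s0; rewrite (negbTE r0nz).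
  have : (0 <= mu [set x | (S * t `^ r0 <= nc (h x))%R])%E by exact: measure_ge0.
  case: (mu [set x | (S * t `^ r0 <= nc (h x))%R]) => [m| |]//; last first.
    by rewrite poweRyr// gt0_muley ?lte_fin// leye_eq.
  rewrite lee_fin poweR_EFin -EFinM !lee_fin => m0.
  rewrite -mulrA -[leRHS]mulr1 ler_pM2l// => tm.
  rewrite -[leRHS]mul1r ler_pdivlMr// mulrC.
  have : ((t * m) `^ r0) `^ r0^-1 <= 1 `^ r0^-1.
    apply: ge0_ler_powR; rewrite ?nnegrE ?invr_ge0 ?powR_ge0//.
    by rewrite powRM// ltW.
  by rewrite powR1 -powRrM mulfV// powRr1// mulr_ge0// ltW.
apply: aeW => x; rewrite -powRD; last first.
  by rewrite e12 mulf_eq0 (negbTE r0nz) pnatr_eq0.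
rewrite e12 /phi -powRrM [2 * _]mulrC mulrA mulVf// mul1r powR_mulrn; last first.
  by rewrite divr_ge0 ?normc_ge0 ?ltW.
by rewrite exprMn exprVn mulrCA mulfV ?mulr1// expf_neq0// gt_eqF.
Qed.

End weights.

Lemma unitary_L2_scale d (T : measurableType d) (R : realType)
    (mu : {measure set T -> \bar R}) (U F : (T -> R[i]) -> (T -> R[i])) (z : R[i]) :
  Normc.normc z = 1 -> (forall f x, F f x = z * U f x) ->
  unitary_L2 mu U -> unitary_L2 mu F.
Proof.
move=> z1 FU [Ulin Uiso Usurj].
have z0 : z != 0 by apply/eqP => z0; move: z1; rewrite z0 Normc.normc0 => /eqP; rewrite eq_sym oner_eq0.
have FE f : F f = fun x => z * U f x by apply/funext => x.
split.
- move=> k f g f2 g2; apply: filterS (Ulin k f g f2 g2) => x e.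
  by rewrite !FU e mulrDr mulrCA.
- move=> f f2; have [Uf2 e] := Uiso f f2; rewrite FE; split; first exact: inLZ.
  by rewrite cLnormZ// ?z1 ?mul1e//; case: Uf2.
move=> g g2; have [f f2 fg] := Usurj (fun x => z^-1 * g x) (inLZ _ (ltr0n R 2) g2).
exists f => //; apply: filterS fg => x e.
by rewrite FU e mulrA divff// mul1r.
Qed.

(** The factor 2 comes from estimating the real and imaginary parts of the integral separately. *)
Lemma L1_bounded_kernel d (T : measurableType d) (R : realType)
    (mu : {measure set T -> \bar R}) (F : (T -> R[i]) -> (T -> R[i])) (c : R[i])
    (B : T -> T -> R[i]) (M : R) :
  0 <= M -> cmeasurable (fun z : T * T => B z.1 z.2) ->
  (forall xi x, Normc.normc (B xi x) <= M) ->
  (forall f, inL mu 1%:E f -> inL mu 2%:E f ->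
    aeq mu (F f) (fun xi => c * cintegral mu (fun x => B xi x * f x))) ->
  L1_bounded mu F (Normc.normc c * (2 * M)).
Proof.
move=> M0 [mBr mBi] BM FB f f1 f2; apply: filterS (FB f f1 f2) => xi ->.
have [mf ffin] := inL1P f1; rewrite pint1E in ffin.
have mn := cmeasurable_normc mf.
have mB : cmeasurable (B xi).
  by split; [have := measurableT_comp mBr (pair1_measurable xi)|
             have := measurableT_comp mBi (pair1_measurable xi)].
have mBf : cmeasurable (fun x => B xi x * f x) by exact: cmeasurableM.
have bound (g : T -> R) : measurable_fun setT g ->
    (forall x, `|g x| <= M * Normc.normc (f x)) ->
    `|\int[mu]_x g x| <= M * fine (pint mu 1 f).
  move=> mg gM.
  have hE : (\int[mu]_x `|(g x)%:E| <= M%:E * pint mu 1 f)%E.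
    rewrite pint1E -ge0_integralZl//; last 2 first.
    - exact/measurable_EFinP.
    - by move=> x _; rewrite lee_fin normc_ge0.
    apply: ge0_le_integral => //.
    - by apply: measurableT_comp => //; exact/measurable_EFinP.
    - by apply: measurable_funeM; exact/measurable_EFinP.
    by move=> x _; rewrite -EFinM lee_fin.
  have ffn : pint mu 1 f \is a fin_num by rewrite ge0_fin_numE ?pint_ge0// pint1E.
  have gi : mu.-integrable setT (EFin \o g).
    apply/integrableP; split; first exact/measurable_EFinP.
    by apply: (le_lt_trans hE); rewrite -(fineK ffn) -EFinM ltry.
  rewrite -lee_fin EFin_normr_Rintegral//.
  apply: le_trans (_ : (\int[mu]_x `|(g x)%:E| <= _)%E); last by rewrite EFinM fineK.
  by apply: le_abse_integral => //; exact/measurable_EFinP.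
rewrite Normc.normcM -mulrA ler_wpM2l ?normc_ge0//.
apply: (le_trans (normc_le_ReIm _)); rewrite /cintegral/=.
have nM x : Normc.normc (B xi x * f x) <= M * Normc.normc (f x).
  by rewrite Normc.normcM ler_wpM2r ?normc_ge0.
rewrite -mulrA mulrDl mul1r; apply: lerD; apply: bound.
- by case: mBf.
- by move=> x; apply: le_trans (normc_Re _) (nM x).
- by case: mBf.
- by move=> x; apply: le_trans (normc_Im _) (nM x).
Qed.

Lemma normc_cis (R : realType) (t : R) : Normc.normc (cis t) = 1.
Proof. by rewrite /cis/= cos2Dsin2 sqrtr1. Qed.

Theorem theorem2p4 (R : realType) (N : nat) (Rs Rp : {fset 'rV[R]_N})
    (k : 'rV[R]_N -> R) (a : R)
    (F : ('rV[R]_N -> R[i]) -> ('rV[R]_N -> R[i]))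
    (c : R[i]) (B : 'rV[R]_N -> 'rV[R]_N -> R[i]) (M p q : R) :
  (0 < N)%N ->
  root_system Rs -> positive_subsystem Rs Rp -> multiplicity_function Rs k ->
  0 < a -> 0 < a + 2 * mult_sum Rs k + N%:R - 2 ->
  generalised_fourier Rs Rp k a F ->
  integral_kernel Rs k a F c B ->
  (forall xi x, Normc.normc (B xi x) <= M) ->
  1 < p -> p <= 2 -> 2 <= q ->
  exists2 C : R, 0 < C &
    forall (h : 'rV[R]_N -> R[i])
      (A : ('rV[R]_N -> R[i]) -> ('rV[R]_N -> R[i])),
      fourier_multiplier Rs k a F h A ->
      (operator_norm Rs k a p q A <= C%:E * symbol_bound Rs k a p q h)%E /\
      ((symbol_bound Rs k a p q h < +oo)%E ->
        exists2 A' : ('rV[R]_N -> R[i]) -> ('rV[R]_N -> R[i]),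
          bounded_operator (mu_ka Rs k a) p%:E q%:E A' &
          forall f, test_function f -> aeq (mu_ka Rs k a) (A' f) (A f)).
Proof.
move=> _ _ _ _ _ _ [U [Uuni _] FU] [mB _ FB] BM p1 p2 q2.
pose mu : {measure set 'rV[R]_N -> \bar R} := mu_ka Rs k a.
have Funi : unitary_L2 mu F by exact: (unitary_L2_scale (normc_cis _) FU Uuni).
have M0 : 0 <= M by apply: le_trans (BM 0 0); exact: normc_ge0.
pose K := Normc.normc c * (2 * M).
have K0 : 0 <= K by rewrite mulr_ge0 ?normc_ge0// mulr_ge0.
have FK : L1_bounded mu F K by exact: (L1_bounded_kernel M0 mB BM FB).
have smu : sigma_finite setT mu.
  exact: (sigma_finite_density (lebesgue_rV N) (measurable_weight Rs k a) (weight_ge0 Rs k a)).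
have p0 : 0 < p by exact: lt_trans p1.
have q0 : 0 < q by exact: lt_le_trans q2.
have p1' := ltW p1.
(* Since 2 <= q, the conjugate exponent lies in (1, 2], so the weighted estimate is available for it
   too. *)
pose q' : R := (1 - q^-1)^-1.
have qi : q^-1 <= 2^-1 by rewrite lef_pV2 ?posrE.
have qi0 : 0 < q^-1 by rewrite invr_gt0.
have q'1 : 1 < q' by rewrite invf_gt1; lra.
have q'2 : q' <= 2 by rewrite invf_ple ?posrE; lra.
have [C1 C10 H1] := pitt Funi FK K0 p1 p2.
have [C2 C20 H2] := pitt Funi FK K0 q'1 q'2.
(* Cauchy-Schwarz takes the square root of each of the two weighted estimates; both constants are
   fixed before h and A. *)
pose C := Num.sqrt C1 * Num.sqrt C2.
have C0 : 0 < C by rewrite mulr_gt0 ?sqrtr_gt0.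
exists C => // h A [mh hA].
have sb0 : (0 <= symbol_bound Rs k a p q h)%E.
  apply: (@le_trans _ _ (1%:E * measure_power Rs k a [set xi | (1 <= Normc.normc (h xi))%R] (p^-1 - q^-1)%R)%E).
    rewrite mul1e /measure_power; case: ifP => _; first by case: ifP.
    exact: poweR_ge0.
  apply: ereal_sup_ubound; exists 1; [exact: ltr01|]. by [].
(* A test function is bounded, so p <= 2 lifts membership in L^p to L^2. *)
have testL f : test_function f -> inL mu p%:E f -> inL mu 2%:E f.
  move=> tf fp; have [Mf Mf0 fM] := test_function_bounded tf.
  exact: (inL_bounded p0 p2 Mf0 fM fp).
have image f : test_function f -> inL mu p%:E f -> inL mu 2%:E f /\ multiplier_image mu F h f (A f).
  move=> tf fp; have f2 := testL f tf fp; split => //.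
  have [mAf ext] := hA f tf; split => // g g1 g2.
  have mhF : cmeasurable (fun x => h x * F f x).
    by apply: cmeasurableM => //; have [] := inL2_unitary Funi f2.
  by have [] := ip_L1L2_extension Funi FK K0 mhF mAf ext g1 g2.
(* With an infinite bound the inequality is trivial, as C > 0, and the second claim is vacuous. *)
have [sby|] := eqVneq (symbol_bound Rs k a p q h) +oo%E.
  by rewrite sby gt0_muley ?lte_fin// leey; split.
rewrite -ltey => sbfin.
pose S := fine (symbol_bound Rs k a p q h).
have SE : symbol_bound Rs k a p q h = S%:E by rewrite fineK// ge0_fin_numE.
have S0 : 0 <= S by rewrite fine_ge0.
have [|phi phiw hphi] := @symbol_weight _ _ _ mu p q S h p1 p2 q2 S0 mh.
  move=> s s0; rewrite -SE; apply: ereal_sup_ubound; exists s => //.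
have [mphi phi0 _] := phiw.
have mw (r : R) : measurable_fun setT (fun x => phi x `^ r).
  exact: (measurableT_comp (measurable_powR _)).
have w0 (r : R) x : 0 <= phi x `^ r by exact: powR_ge0.
have bound := @multiplier_image_le _ _ _ mu F smu Funi p q q2 _ _ _ _ _ _
  (mw _) (mw _) (w0 _) (w0 _) (ltW C10) (ltW C20) S0 mh (H1 phi phiw) (H2 phi phiw) hphi.
split.
  apply: ge_ereal_sup => _ [f [tf _] <-].
  have mf := test_function_measurable tf.
  have Csb : (0 <= C%:E * symbol_bound Rs k a p q h)%E by rewrite mule_ge0// lee_fin ltW.
  (* Whether f lies in L^p need not be settled, since x / +oo = 0. *)
  have [fy|] := eqVneq (cLnorm mu p%:E f) +oo%E; first by rewrite fy invey mule0.
  rewrite -ltey => fy; have fp : inL mu p%:E f by split.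
  have [f2 fA] := image f tf fp; have le := bound f (A f) f2 fp fA.
  (* If f vanishes almost everywhere, the bound gives the same for A f, and the quotient is 0. *)
  have /orP[/eqP fz|] : (0 == cLnorm mu p%:E f)%E || (0 < cLnorm mu p%:E f)%E.
    by rewrite -le_eqVlt cLnorm_ge0.
    rewrite (_ : cLnorm _ _ (A f) = 0%E) ?mul0e//.
    by apply/eqP; rewrite eq_le cLnorm_ge0 andbT; move: le; rewrite -fz mule0.
  have fn : cLnorm mu p%:E f \is a fin_num by rewrite ge0_fin_numE ?cLnorm_ge0.
  move: le; rewrite -(fineK fn) lte_fin => le f0.
  rewrite inver gt_eqF// lee_pdivrMr// SE -EFinM.
  apply: (le_trans le); rewrite le_eqVlt; apply/orP; left; apply/eqP.
  by rewrite -?EFinM; congr EFin; rewrite /C; ring.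
move=> _.
have [A' A'bd A'A] := @multiplier_extension _ _ _ mu F smu Funi p q p1' p2 q2 _ _ _ _ _ _
  (mw _) (mw _) (w0 _) (w0 _) (ltW C10) (ltW C20) S0 mh (H1 phi phiw) (H2 phi phiw) hphi A.
by exists A' => // f tf; apply: A'A => fp; exact: image.
Qed.
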